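(* Let $S$ be a measurable space, $\mathfrak{H}$ a separable Hilbert space, and $E$ a standard spectral measure for $(S,\mathfrak{H})$. Let $\mathcal{P}_E=\{E(A) : A\subset S \text{ measurable}\}$, and let $\mathcal{X}$ be a set of closed densely defined operators in $\mathfrak{H}$. Then the von Neumann algebra $\mathcal{A}(\mathcal{P}_E)$ is generated by $\mathcal{X}$, i.e. $\mathcal{A}(\mathcal{X})=\mathcal{A}(\mathcal{P}_E)$, if and only if the following two conditions hold: (1) For every $T\in\mathcal{X}$, there is an $E$-measurable complex function $f$ on $S$ such that $T=J^E_f$. (2) There is an $E$-separating family $\{f_\iota\}_{\iota\in I}$ of $E$-measurable complex functions on $S$ such that $J^E_{f_\iota}\in\mathcal{X}$ for all $\iota\in I$.
   Context: Hilbert spaces are complex, $\langle\cdot,\cdot\rangle$ denotes the scalar product (linear in the second argument), and $L(\mathfrak{H})$ is the algebra of all bounded everywhere defined linear operators in $\mathfrak{H}$. Commutants and generated algebras. An operator $T$ in $\mathfrak{H}$ with domain $D_T$ commutes with $R\in L(\mathfrak{H})$ if $R\Psi\in D_T$ and $RT\Psi=TR\Psi$ for every $\Psi\in D_T$. For a set $\mathcal{X}$ of closed densely defined operators in $\mathfrak{H}$, the commutant $\mathcal{X}'$ is the set of all $R\in L(\mathfrak{H})$ commuting with every element of $\mathcal{X}$, and $\mathcal{X}^*=\{T^* : T\in\mathcal{X}\}$. A von Neumann algebra is a subalgebra $\mathcal{M}$ of $L(\mathfrak{H})$ with $\mathcal{M}^*=\mathcal{M}$ and $\mathcal{M}=\mathcal{M}''$.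 The von Neumann algebra generated by $\mathcal{X}$ is $\mathcal{A}(\mathcal{X})=(\mathcal{X}\cup\mathcal{X}^* )''$; if $\mathcal{X}\subset L(\mathfrak{H})$, this is the smallest von Neumann algebra containing $\mathcal{X}$. Spectral measures. A spectral measure for $(S,\mathfrak{H})$ is a map $E$ from the $\sigma$-algebra of measurable subsets of $S$ to the set of orthogonal projections on $\mathfrak{H}$ that is countably additive with respect to the strong operator topology and such that $E(S)$ is the identity operator. A set $N$ is $E$-null if it is measurable and $E(N)=0$; ''$E$-a.e.'' means outside some $E$-null set. A standard Borel space is a measurable space whose $\sigma$-algebra is the Borel $\sigma$-algebra of some Polish topology on it. $E$ is called standard if there is a measurable set $S'\subset S$ with $E(S\setminus S')=0$ such that $S'$, considered as a measurable subspace of $S$, is a standard Borel space. Measurable functions and integrals. A complex function on $S$ is called $E$-measurable if it is defined $E$-a.e. on $S$ and coincides $E$-a.e. with a (Borel) measurable complex function on $S$. For $\Psi\in\mathfrak{H}$, $E_\Psi$ is the finite positive measure $E_\Psi(A)=\langle E(A)\Psi,\Psi\rangle$. For an $E$-measurable complex function $f$, the integral $J^E_f$ of $f$ with respect to $E$ is the unique linear operator in $\mathfrak{H}$ with domain $D_{J^E_f}=\{\Psi\in\mathfrak{H} : \int|f(s)|^2\,dE_\Psi(s)<\infty\}$ such that $\langle\Psi,J^E_f\Psi\rangle=\int f(s)\,dE_\Psi(s)$ for all $\Psi\in D_{J^E_f}$; it is a (possibly unbounded) normal operator, in particular closed and densely defined. Separating families. A family of maps $\{f_\iota\}_{\iota\in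 I}$ separates points of a set $S_0$ contained in the domains of all $f_\iota$ if for any two distinct $s_1,s_2\in S_0$ there is $\iota\in I$ with $f_\iota(s_1)\neq f_\iota(s_2)$. A family $\{f_\iota\}_{\iota\in I}$ of maps defined $E$-a.e. on $S$ is $E$-separating on $S$ if $I$ is countable (finite or countably infinite) and $\{f_\iota\}_{\iota\in I}$ separates points of $S\setminus N$ for some $E$-null set $N$. *)

(* Defs.v *)
From HB Require Import structures.
From mathcomp Require Import all_boot all_order all_algebra.
From mathcomp Require Import all_classical all_reals all_analysis.
From mathcomp Require Import complex.
From mathcomp Require Import ring lra.

Set Implicit Arguments.
Unset Strict Implicit.
Unset Printing Implicit Defensive.

Import Order.TTheory GRing.Theory Num.Theory.
Import numFieldNormedType.Exports.
Import ComplexField.Normc.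

Local Open Scope classical_set_scope.
Local Open Scope ring_scope.
Local Open Scope complex_scope.

(* The norm of a normed module over [R[i]] takes its values in the nonnegative
   reals of [R[i]], so [inner_norm] also says that the form is positive. *)
HB.mixin Record CompleteNormedModule_isHilbert (R : realType) H
    & CompleteNormedModule R[i] H := {
  inner : H -> H -> R[i] ;
  inner_linear : forall (x : H) (a : R[i]) (y z : H),
    inner x (a *: y + z) = a * inner x y + inner x z ;
  inner_conj : forall x y : H, inner y x = (inner x y)^* ;
  inner_norm : forall x : H, inner x x = `|x| ^+ 2
}.

#[short(type="hilbertType")]
HB.structure Definition Hilbert (R : realType) :=
  {H of CompleteNormedModule_isHilbert R H & CompleteNormedModule R[i] H}.

Definition separable (T : topologicalType) : Prop :=
  exists2 D : set T, countable D & dense D.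

Section InnerTheory.
Context {R : realType} {H : hilbertType R}.
Implicit Types x y z : H.

Lemma innerDr x y z : inner x (y + z) = inner x y + inner x z.
Proof. by have := inner_linear x 1 y z; rewrite scale1r mul1r. Qed.

Lemma innerDl x y z : inner (y + z) x = inner y x + inner z x.
Proof. by rewrite inner_conj innerDr rmorphD/= -!inner_conj. Qed.

Lemma inner0r x : inner x 0 = 0.
Proof.
by apply: (addrI (inner x 0)); rewrite -innerDr addr0 addr0.
Qed.

Lemma inner0l x : inner 0 x = 0.
Proof. by rewrite inner_conj inner0r rmorph0. Qed.

Lemma innerZr (a : R[i]) x y : inner x (a *: y) = a * inner x y.
Proof. by have := inner_linear x a y 0; rewrite inner0r !addr0. Qed.

Lemma inner_suml x (u : nat -> H) n :
  inner (\sum_(0 <= k < n) u k) x = \sum_(0 <= k < n) inner (u k) x.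
Proof.
elim: n => [|n IHn]; first by rewrite !big_geq ?inner0l.
by rewrite !big_nat_recr//= innerDl IHn.
Qed.

Lemma Re_inner_ge0 x : 0 <= complex.Re (inner x x).
Proof.
have : 0 <= inner x x by rewrite inner_norm exprn_ge0.
by rewrite lecE => /andP[].
Qed.

Lemma Re_inner_sym x y : complex.Re (inner y x) = complex.Re (inner x y).
Proof. by rewrite inner_conj; case: (inner x y). Qed.

Lemma Re_inner_le (t : R) x y : 0 < t ->
  `|complex.Re (inner x y)| <=
    t * complex.Re (inner x x) + t^-1 * complex.Re (inner y y).
Proof.
move=> t0.
have key (s : R) : 0 <= s ^+ 2 * complex.Re (inner x x) +
    complex.Re (inner y y) + 2 * s * complex.Re (inner x y).
  have := Re_inner_ge0 (s%:C *: x + y).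
  rewrite innerDr innerZr (inner_conj x) (inner_conj y).
  rewrite !innerDr !innerZr (inner_conj x y).
  have : complex.Im (inner x x) = 0.
    by apply: ger0_Im; rewrite inner_norm exprn_ge0.
  case: (inner x x) => a b /= ->; case: (inner x y) => c e /=.
  case: (inner y y) => f g /=. lra.
have ti0 : 0 < t^-1 by rewrite invr_gt0.
have tt : t * t^-1 = 1 by rewrite mulfV// gt_eqF.
have hp := key t; have hm := key (- t).
have hx := Re_inner_ge0 x; have hy := Re_inner_ge0 y.
move: hp hm hx hy; set a := complex.Re (inner x x).
set b := complex.Re (inner y y); set c := complex.Re (inner x y).
move=> hp hm a0 b0.
have hp' := mulr_ge0 (ltW ti0) hp; have hm' := mulr_ge0 (ltW ti0) hm.
have ta : 0 <= t * a by rewrite mulr_ge0// ltW.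
have tb : 0 <= t^-1 * b by rewrite mulr_ge0// ltW.
have e1 : t^-1 * (t ^+ 2 * a + b + 2 * t * c) = t * a + t^-1 * b + 2 * c.
  by field; rewrite gt_eqF.
have e2 : t^-1 * ((- t) ^+ 2 * a + b + 2 * (- t) * c) =
    t * a + t^-1 * b - 2 * c.
  by field; rewrite gt_eqF.
rewrite e1 in hp'; rewrite e2 in hm'.
by rewrite ler_norml; apply/andP; split; lra.
Qed.

Lemma cvg_Re_inner (u : H^nat) (l x : H) : u @ \oo --> l ->
  (fun n => complex.Re (inner (u n) x)) @ \oo --> complex.Re (inner l x).
Proof.
move=> ul; apply/cvgrPdist_lt => /= e e0.
set b := complex.Re (inner x x); have b0 : 0 <= b := Re_inner_ge0 x.
pose t := 2 * (b + 1) / e.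
have t0 : 0 < t by rewrite divr_gt0// mulr_gt0// ltr_wpDl.
pose r : R := Num.sqrt (e / (2 * t)).
have et : 0 < e / (2 * t) by rewrite divr_gt0// mulr_gt0.
have r0 : 0 < r%:C by rewrite ltcR sqrtr_gt0.
have /cvgrPdist_lt/(_ _ r0) := ul.
apply: filterS => n lun.
have -> : complex.Re (inner l x) - complex.Re (inner (u n) x) =
    complex.Re (inner (l - u n) x).
  have {1}-> : l = (l - u n) + u n by rewrite subrK.
  by rewrite innerDl raddfD/= addrK.
apply: le_lt_trans (Re_inner_le _ _ t0) _.
have hr : complex.Re (inner (l - u n) (l - u n)) < e / (2 * t).
  have : inner (l - u n) (l - u n) < (e / (2 * t))%:C.
    rewrite inner_norm -[e / _]sqr_sqrtr ?(ltW et)// rmorphXn/=.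
    by rewrite ltr_pXn2r ?nnegrE ?normr_ge0 ?(ltW r0).
  by rewrite ltcE => /andP[].
have h1 : t * complex.Re (inner (l - u n) (l - u n)) < e / 2.
  have -> : e / 2 = t * (e / (2 * t)) by field; rewrite gt_eqF.
  by rewrite ltr_pM2l.
have h2 : t^-1 * b <= e / 2.
  rewrite /t invf_div mulrAC ler_pdivrMr ?mulr_gt0 ?ltr_wpDl//.
  have -> : e / 2 * (2 * (b + 1)) = e * b + e by lra.
  by rewrite lerDl ltW.
by rewrite [e]splitr ltr_leD.
Qed.

End InnerTheory.

Section Operators.
Context {R : realType} {H : hilbertType R}.

(* A linear operator in [H], with domain [dom]; [app] is set to [0] outside
   the domain so that Leibniz equality is equality of operators. *)
Record operator := Operator {
  dom : set H ;
  app :> H -> H ;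
  dom0 : dom 0 ;
  dom_linear : forall (a : R[i]) x y, dom x -> dom y -> dom (a *: x + y) ;
  app_linear : forall (a : R[i]) x y, dom x -> dom y ->
    app (a *: x + y) = a *: app x + app y ;
  app_out : forall x, ~ dom x -> app x = 0
}.

Definition densely_defined (T : operator) : Prop := dense (dom T).

Definition closed_operator (T : operator) : Prop :=
  closed [set p : H * H | dom T p.1 /\ T p.1 = p.2].

(* [bounded_operator A] is membership of [A] in L(H). *)
Definition bounded_operator (A : operator) : Prop :=
  dom A = setT /\ exists M : R[i], forall x, `|A x| <= M * `|x|.

Definition commutes (T A : operator) : Prop :=
  forall x, dom T x -> dom T (A x) /\ A (T x) = T (A x).

Definition commutant (X : set operator) : set operator :=
  [set A | bounded_operator A /\ forall T, X T -> commutes T A].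

(* For densely defined [T], [z] below is unique and this determines the
   adjoint [T'] of [T]. *)
Definition is_adjoint (T T' : operator) : Prop :=
  forall y z, (dom T' y /\ T' y = z) <->
              (forall x, dom T x -> inner y (T x) = inner z x).

Definition adjoints (X : set operator) : set operator :=
  [set T' | exists2 T, X T & is_adjoint T T'].

Definition generated_vN (X : set operator) : set operator :=
  commutant (commutant (X `|` adjoints X)).

Definition orthogonal_projection (P : operator) : Prop :=
  [/\ bounded_operator P, forall x, P (P x) = P x
    & forall x y, inner (P x) y = inner x (P y)].

End Operators.
Arguments operator {R} H.

(* The values on nonmeasurable sets are irrelevant. *)
Record spectral_measure d (S : measurableType d) (R : realType)
    (H : hilbertType R) := SpectralMeasure {
  spectral_val :> set S -> operator H ;
  spectral_proj : forall A, measurable A ->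
    orthogonal_projection (spectral_val A) ;
  spectral_sigma_additive : forall F : (set S)^nat,
    (forall n, measurable (F n)) -> trivIset setT F -> forall x : H,
    series (fun n => spectral_val (F n) x) @ \oo
      --> spectral_val (\bigcup_n F n) x ;
  spectral_setT : forall x, spectral_val setT x = x
}.

(* The set system [G] on [T] is the Borel sigma-algebra of a Polish topology,
   i.e. of the topology of a complete separable metric. *)
Definition standard_borel (R : realType) (T : Type) (G : set (set T)) : Prop :=
  exists c : Metric.axioms_ R T, let M : metricType R := Metric.Pack c in
    [/\ forall F : set_system M, ProperFilter F -> cauchy F ->
          exists x : M, F --> x,
        separable M
      & G = <<s @open M >>].

(* Functions defined on a part of [S] are encoded with values in [option]. *)
Definition defined_on (S T : Type) (f : S -> option T) : set S :=
  [set s | exists t, f s = Some t].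

Definition separates_points (S T I : Type) (f : I -> S -> option T)
    (S0 : set S) : Prop :=
  (forall i, S0 `<=` defined_on (f i)) /\
  forall s1 s2, S0 s1 -> S0 s2 -> s1 <> s2 -> exists i, f i s1 <> f i s2.

Section SpectralMeasure.
Context d (S : measurableType d) (R : realType) (H : hilbertType R).
Variable E : spectral_measure S H.

Definition spectral_projections : set (operator H) :=
  [set E A | A in [set A : set S | measurable A]].

Definition E_null (N : set S) : Prop := measurable N /\ forall x, E N x = 0.

Definition E_ae (P : set S) : Prop := exists2 N, E_null N & ~` N `<=` P.

Definition standard_spectral_measure : Prop :=
  exists S' : set S, [/\ measurable S', E_null (~` S')
    & standard_borel R
        (preimage_set_system setT (@set_val S S') (@measurable d S))].

(* <E(A) x, x> is a nonnegative real; the value 0 on nonmeasurable sets is a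
   junk value needed for the [measure] instance below. *)
Definition vector_measure (x : H) (A : set S) : \bar R :=
  (if `[< measurable A >] then complex.Re (inner (E A x) x) else 0)%:E.

Lemma spectral_val0 x : E set0 x = 0.
Proof.
have h : series (fun=> E set0 x) @ \oo --> E set0 x.
  have := @spectral_sigma_additive _ _ _ _ E (fun=> set0)
    (fun=> measurable0) (@trivIset_set0 _ _ setT) x.
  by rewrite bigcup0.
have {}h : (fun=> E set0 x : H) @ \oo --> (0 : H).
  by apply: cvg_series_cvg_0; apply/cvg_ex; exists (E set0 x).
exact: (cvg_unique _ (cvg_cst _) h).
Qed.

Section VectorMeasure.
Variable x : H.

Let mu0 : vector_measure x set0 = 0%E.
Proof.
rewrite /vector_measure asboolT; last exact: measurable0.
by rewrite spectral_val0 inner0l.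
Qed.

Let mu_ge0 A : (0 <= vector_measure x A)%E.
Proof.
rewrite lee_fin; case: ifPn => // /asboolP mA.
have [_ EE Esym] := spectral_proj E mA.
by rewrite -[E A x]EE Esym Re_inner_ge0.
Qed.

Let mu_sigma_additive : semi_sigma_additive (vector_measure x).
Proof.
move=> F mF tF mUF.
have h := cvg_Re_inner (x := x) (@spectral_sigma_additive _ _ _ _ E F mF tF x).
rewrite /vector_measure asboolT//.
rewrite (_ : (fun n => _) = EFin \o (fun n =>
    complex.Re (inner (series (fun k => E (F k) x) n) x))).
  exact: cvg_comp h _.
apply/funext => n /=; rewrite inner_suml raddf_sum/= -sumEFin.
by apply: eq_bigr => k _; rewrite asboolT.
Qed.

HB.instance Definition _ := isMeasure.Build d S R (vector_measure x)
  mu0 mu_ge0 mu_sigma_additive.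

Let mu_fin : fin_num_fun (vector_measure x).
Proof. by move=> A mA; rewrite /vector_measure. Qed.

HB.instance Definition _ := Measure_isFinite.Build d S R (vector_measure x)
  mu_fin.

End VectorMeasure.

Definition borel_measurable (f : S -> R[i]) : Prop :=
  measurable_fun setT (f : S -> g_sigma_algebraType (@open (R[i])^o)).

Definition E_measurable (f : S -> option R[i]) : Prop :=
  exists2 g : S -> R[i], borel_measurable g & E_ae [set s | f s = Some (g s)].

Definition E_separating (I : Type) (f : I -> S -> option R[i]) : Prop :=
  [/\ forall i, E_ae (defined_on (f i)), countable [set: I]
    & exists2 N, E_null N & separates_points f (~` N)].

(* Integrals below are those of [total f]. For [E]-measurable [f] they agree
   with the integral of any Borel function equal to [f] E-a.e.: library
   integrals of nonnegative functions are suprema over measurable simple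
   functions below, which do not see the values on a measurable null set, even
   if [total f] is not measurable there. *)
Definition total (f : S -> option R[i]) (s : S) : R[i] := odflt 0 (f s).

(* These conditions determine [T] (by polarization on the subspace [dom T]), so
   this reads as T = J^E_f. *)
Definition is_spectral_integral (f : S -> option R[i]) (T : operator H)
    : Prop :=
  dom T = [set x |
    (\int[vector_measure x]_s (normc (total f s) ^+ 2)%:E < +oo)%E] /\
  forall x, dom T x ->
    inner x (T x) = (\int[vector_measure x]_s complex.Re (total f s))
                 +i* (\int[vector_measure x]_s complex.Im (total f s)).

End SpectralMeasure.

(* Main.v *)
(* Write J_g for the spectral integral of g; everything reduces to comparing the
   commutants of X together with its adjoints and of P_E.

   Sufficiency.  Operators commuting with P_E commute with every J_g.
   Conversely let Q commute with the operators J_{f_i}.  Fuglede's theorem gives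
   that Q commutes with E(|f_i - c| <= r) for all c and r.  These countably many
   sets (rational c, r) separate points off a null set, and for a finite Borel
   measure on a Polish space such a family generates the Borel sets up to null
   sets: on a compact set of almost full measure on which all members of the
   family are clopen, every closed set is a countable intersection of finite
   Boolean combinations.  Hence Q commutes with P_E.

   Necessity.  The entries of the projection onto the graph of T in X lie in
   the double commutant of X and its adjoints, which is that of P_E, so T
   commutes with P_E'.  Separability gives a vector separating for E, and a
   resolvent-like entry of the graph projection moves it into a separating z in
   dom T.  By the Radon-Nikodym theorem T z = J_f z for some f; every y is a
   limit of vectors E(A_n) y = R_n z with R_n in P_E', which forces T = J_f.
   For the separating family, restrict E to the sigma-algebra generated by the
   functions of the operators in X.  The same argument, applied to each E(A) and
   this restriction, shows that A agrees up to a null set with a member of that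
   sigma-algebra, hence with a set depending on countably many operators of X.
   Take for A the members of a countable base. *)
Require Import Defs.
From HB Require Import structures.
From mathcomp Require Import all_boot all_order all_algebra.
From mathcomp Require Import all_classical all_reals all_analysis.
From mathcomp Require Import measurable_realfun finmap complex.
From mathcomp Require Import ring lra.

Set Implicit Arguments.
Unset Strict Implicit.
Unset Printing Implicit Defensive.

Import Order.TTheory GRing.Theory Num.Theory.
Import numFieldNormedType.Exports.
Import ComplexField.Normc.

Local Open Scope classical_set_scope.
Local Open Scope ring_scope.
Local Open Scope complex_scope.

(** Necessity starts from an equality of double commutants only, and X is an arbitrary, possibly
    uncountable, set of unbounded operators. Such operators cannot lie in a double commutant, but
    the bounded entries of their graph projections can, and a closed operator is recovered from
    these entries: commuting with it can be tested on them. Recognizing an operator as a spectral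
    integral is proved for an arbitrary spectral measure with a separating vector, so that the same
    result serves for E and for its restriction to a sub-sigma-algebra about which nothing else is
    known. That restriction replaces a selection of countably many operators from X, which is only
    possible once individual sets are at hand. The integral J_g is built as an L^2 limit along one
    fixed sequence of simple functions on the complex plane composed with g. Its approximants
    involve only projections onto preimages under g, so that commutation with J_g is read off from
    those preimages alone. *)

Section ComplexModulus.
Context {R : realType}.
Implicit Types (z : R[i]).

Lemma normc_ge0 z : 0 <= normc z.
Proof. by case: z => a b; rewrite sqrtr_ge0. Qed.

Lemma normcJ z : normc z^* = normc z.
Proof. by case: z => a b; rewrite /= sqrrN. Qed.

Lemma normc_real (r : R) : normc r%:C = `|r|.
Proof. by rewrite /= expr0n addr0 sqrtr_sqr. Qed.

Lemma sqr_normcE z : normc z ^+ 2 = complex.Re z ^+ 2 + complex.Im z ^+ 2.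
Proof. by case: z => a b /=; rewrite sqr_sqrtr// addr_ge0 ?sqr_ge0. Qed.

Lemma mulJc z : z^* * z = (normc z ^+ 2)%:C.
Proof.
rewrite sqr_normcE; case: z => a b.
by apply/eqP; rewrite eq_complex/=; apply/andP; split; apply/eqP; ring.
Qed.

End ComplexModulus.

(** * Hilbert space geometry and unbounded operators *)

Section HilbertNorm.
Context {R : realType} {H : hilbertType R}.
Implicit Types (x y z : H) (a : R[i]).

(** The norm of [H] takes values in [R[i]]; its real part carries the same information and makes the
    order and the limits of [R] available. *)
Definition vnorm x : R := complex.Re `|x|.

Lemma vnormE x : `|x| = (vnorm x)%:C.
Proof.
have : 0 <= `|x| by exact: normr_ge0.
by rewrite /vnorm; case: `|x| => a b; rewrite lecE /= => /andP[/eqP -> _].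
Qed.

Lemma vnorm_ge0 x : 0 <= vnorm x.
Proof. by have := normr_ge0 x; rewrite vnormE lecR. Qed.

Lemma vnorm0 : vnorm 0 = 0.
Proof. by rewrite /vnorm normr0. Qed.

Lemma vnorm0_eq0 x : vnorm x = 0 -> x = 0.
Proof. by move=> x0; apply: normr0_eq0; rewrite vnormE x0. Qed.

Lemma vnormN x : vnorm (- x) = vnorm x.
Proof. by rewrite /vnorm normrN. Qed.

Lemma vnormB x y : vnorm (x - y) = vnorm (y - x).
Proof. by rewrite /vnorm distrC. Qed.

Lemma vnormD x y : vnorm (x + y) <= vnorm x + vnorm y.
Proof. by rewrite -lecR rmorphD/= -!vnormE ler_normD. Qed.

Lemma vnormZ a x : vnorm (a *: x) = normc a * vnorm x.
Proof.
have -> : normc a * vnorm x = complex.Re ((normc a)%:C * (vnorm x)%:C).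
  by rewrite -rmorphM.
by rewrite -vnormE /vnorm normrZ.
Qed.

Lemma inner_vnorm x : inner x x = (vnorm x ^+ 2)%:C.
Proof. by rewrite inner_norm vnormE rmorphXn. Qed.

Lemma innerZl a x y : inner (a *: x) y = a^* * inner x y.
Proof. by rewrite inner_conj innerZr rmorphM/= -inner_conj. Qed.

Lemma innerNr x y : inner x (- y) = - inner x y.
Proof. by rewrite -scaleN1r innerZr mulN1r. Qed.

Lemma innerNl x y : inner (- x) y = - inner x y.
Proof. by rewrite inner_conj innerNr rmorphN/= -inner_conj. Qed.

Lemma innerBr x y z : inner x (y - z) = inner x y - inner x z.
Proof. by rewrite innerDr innerNr. Qed.

Lemma innerBl x y z : inner (y - z) x = inner y x - inner z x.
Proof. by rewrite innerDl innerNl. Qed.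

Lemma inner_eq0 x : inner x x = 0 -> x = 0.
Proof.
rewrite inner_vnorm => /(congr1 (@complex.Re R))/= /eqP.
by rewrite expf_eq0/= => /eqP; exact: vnorm0_eq0.
Qed.

Lemma vnorm_sqrD x y :
  vnorm (x + y) ^+ 2 = vnorm x ^+ 2 + 2 * complex.Re (inner x y) + vnorm y ^+ 2.
Proof.
have E u : vnorm u ^+ 2 = complex.Re (inner u u) by rewrite inner_vnorm.
rewrite !E innerDr !innerDl !raddfD/= (Re_inner_sym x y); lra.
Qed.

Lemma parallelogram x y :
  vnorm (x + y) ^+ 2 + vnorm (x - y) ^+ 2 = 2 * vnorm x ^+ 2 + 2 * vnorm y ^+ 2.
Proof. by rewrite !vnorm_sqrD vnormN innerNr raddfN/=; lra. Qed.

Lemma Re_cauchy_schwarz x y : `|complex.Re (inner x y)| <= vnorm x * vnorm y.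
Proof.
have k t : 0 <= vnorm x ^+ 2 + 2 * t * complex.Re (inner x y) + t ^+ 2 * vnorm y ^+ 2.
  have := sqr_ge0 (vnorm (x + t%:C *: y)).
  rewrite vnorm_sqrD innerZr vnormZ exprMn.
  rewrite normc_real real_normK ?num_real//.
  by case: (inner x y) => r s /=; lra.
have [y0|y0] := eqVneq (vnorm y) 0.
  by rewrite (vnorm0_eq0 y0) inner0r vnorm0 mulr0 normr0.
have yp : 0 < vnorm y by rewrite lt_def y0 vnorm_ge0.
(* Minimizer of the quadratic polynomial in [t] that [k] bounds below by 0. *)
have := k (- complex.Re (inner x y) / vnorm y ^+ 2).
set r := complex.Re _; move=> h.
rewrite -(@ler_pXn2r _ 2) ?nnegrE ?mulr_ge0 ?vnorm_ge0 ?normr_ge0//.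
rewrite real_normK ?num_real// exprMn.
rewrite -subr_ge0.
have -> : vnorm x ^+ 2 * vnorm y ^+ 2 - r ^+ 2 = vnorm y ^+ 2 *
  (vnorm x ^+ 2 + 2 * (- r / vnorm y ^+ 2) * r + (- r / vnorm y ^+ 2) ^+ 2 * vnorm y ^+ 2).
  by field.
by rewrite mulr_ge0 ?sqr_ge0.
Qed.

(** The phase conj(<x,y>)/|<x,y>| turns the scalar product into its modulus; this lifts the
    Cauchy-Schwarz inequality from real parts to moduli. *)
Lemma Re_inner_normc x y : exists2 a : R[i], normc a = 1 &
  complex.Re (inner x (a *: y)) = normc (inner x y).
Proof.
have [n0|n0] := eqVneq (inner x y) 0.
  by exists 1; [exact: normc1|rewrite innerZr n0 mulr0 normc0].
exists ((inner x y)^* / (normc (inner x y))%:C).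
  have nz : normc (inner x y) != 0.
    by apply: contra_neq n0; exact: eq0_normc.
  rewrite normcM normcJ normcV normc_real ger0_norm ?normc_ge0//.
  by rewrite mulfV.
rewrite innerZr mulrAC [X in X / _]mulrC.
have -> : inner x y * (inner x y)^* = (normc (inner x y) ^+ 2)%:C by rewrite mulrC mulJc.
have nz : normc (inner x y) != 0.
  by apply: contra_neq n0; exact: eq0_normc.
by rewrite -fmorphV -rmorphM/= expr2 mulfK.
Qed.

Lemma cauchy_schwarz x y : normc (inner x y) <= vnorm x * vnorm y.
Proof.
have [a a1 <-] := Re_inner_normc x y.
apply: le_trans (ler_norm _) _; apply: le_trans (Re_cauchy_schwarz _ _) _.
by rewrite vnormZ a1 mul1r.
Qed.

Lemma hcvgP (u : H^nat) (l : H) :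
  u @ \oo --> l <-> (fun n => vnorm (u n - l)) @ \oo --> (0 : R).
Proof.
split.
  move=> /cvgrPdist_lt ul; apply/cvgrPdist_lt => e e0.
  have e0' : 0 < e%:C by rewrite ltcR.
  apply: filterS (ul _ e0') => n.
  by rewrite sub0r normrN ger0_norm ?vnorm_ge0// vnormE ltcR vnormB.
move=> /cvgrPdist_lt ul; apply/cvgrPdist_lt => e.
case: e => e e'; rewrite ltcE /= => /andP[/eqP -> e0].
apply: filterS (ul _ e0) => n.
by rewrite sub0r normrN ger0_norm ?vnorm_ge0// vnormE ltcR vnormB.
Qed.

Lemma hcauchy_cvg (u : H^nat) :
  (forall e : R, 0 < e -> exists N, forall m n, (N <= m)%N -> (N <= n)%N ->
     vnorm (u m - u n) < e) -> exists l : H, u @ \oo --> l.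
Proof.
move=> uc; apply/cvg_ex; apply: cauchy_cvg.
apply/cauchy_ballP => e.
case: e => e e'; rewrite ltcE /= => /andP[/eqP -> e0].
have [N uN] := uc _ e0.
exists ([set x | exists2 n, (N <= n)%N & x = u n], [set x | exists2 n, (N <= n)%N & x = u n]).
  by split; exists N => //= n Nn; exists n.
case=> _ _ [[n Nn ->] [m Nm ->]] /=.
by rewrite -ball_normE /ball_/= vnormE ltcR uN.
Qed.

End HilbertNorm.

Section HilbertOperators.
Context {R : realType} {H : hilbertType R}.
Implicit Types (x y z w : H) (T A : operator H).

Lemma operator_ext T T' : dom T = dom T' -> (forall x, T x = T' x) -> T = T'.
Proof.
case: T => D f p1 p2 p3 p4; case: T' => D' f' q1 q2 q3 q4 /= DD /funext ff.
subst D' f'; congr Operator; exact: Prop_irrelevance.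
Qed.

Lemma domD T x y : dom T x -> dom T y -> dom T (x + y).
Proof. by move=> Tx Ty; rewrite -[x]scale1r; exact: dom_linear. Qed.

Lemma domZ T (a : R[i]) x : dom T x -> dom T (a *: x).
Proof. by move=> Tx; rewrite -[_ *: _]addr0; apply: dom_linear => //; exact: dom0. Qed.

Lemma domB T x y : dom T x -> dom T y -> dom T (x - y).
Proof. by move=> Tx Ty; apply: domD => //; rewrite -scaleN1r; exact: domZ. Qed.

Lemma appD T x y : dom T x -> dom T y -> T (x + y) = T x + T y.
Proof. by move=> Tx Ty; rewrite -[x]scale1r app_linear// !scale1r. Qed.

Lemma app0 T : T 0 = 0.
Proof.
have T0 := dom0 T.
by apply: (addIr (T 0)); rewrite -appD// addr0 add0r.
Qed.

Lemma appZ T (a : R[i]) x : dom T x -> T (a *: x) = a *: T x.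
Proof.
move=> Tx; rewrite -[_ *: x]addr0 app_linear// ?app0 ?addr0//; exact: dom0.
Qed.

Lemma appB T x y : dom T x -> dom T y -> T (x - y) = T x - T y.
Proof.
by move=> Tx Ty; rewrite -scaleN1r appD ?appZ ?scaleN1r// -scaleN1r; exact: domZ.
Qed.

Lemma bounded_domE A : bounded_operator A -> forall x, dom A x.
Proof. by move=> [-> _]. Qed.

Lemma bounded_vnorm A : bounded_operator A ->
  exists2 M : R, 0 <= M & forall x, vnorm (A x) <= M * vnorm x.
Proof.
case=> _ [M AM]; exists `|complex.Re M| => // x.
have := AM x; rewrite (vnormE (A x)) (vnormE x).
case: M AM => m m' _ /=; rewrite lecE/= => /andP[_].
rewrite mulr0 subr0 => /le_trans; apply.
by rewrite ler_wpM2r ?vnorm_ge0// ler_norm.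
Qed.

Definition bounded_linear (f : H -> H) (M : R) : Prop :=
  (forall (a : R[i]) x y, f (a *: x + y) = a *: f x + f y) /\
  forall x, vnorm (f x) <= M * vnorm x.

Lemma bounded_operatorE (f : H -> H) (M : R) : bounded_linear f M ->
  exists2 A : operator H, bounded_operator A & forall x, A x = f x.
Proof.
move=> [flin fM].
have f0 x : ~ [set: H] x -> f x = 0 by move=> /(_ I).
exists (@Operator R H setT f I (fun _ _ _ _ _ => I) (fun a x y _ _ => flin a x y) f0) => //.
split=> //; exists M%:C => x /=.
by rewrite (vnormE (f x)) (vnormE x) -rmorphM/= lecR.
Qed.

Lemma bounded_cvg A (u : H^nat) x : bounded_operator A ->
  u @ \oo --> x -> A (u n) @[n --> \oo] --> A x.
Proof.
move=> bA; have dA := bounded_domE bA; have [M M0 AM] := bounded_vnorm bA.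
move=> /hcvgP ux; apply/hcvgP.
apply: (@squeeze_cvgr _ _ _ _ (cst 0) (fun n => M * vnorm (u n - x))).
- by near=> n; rewrite vnorm_ge0/= -appB.
- exact: cvg_cst.
- by rewrite -(mulr0 M); apply: cvgM => //; exact: cvg_cst.
Unshelve. all: by end_near. Qed.

(** Sequential closedness of the graph. It is the form that minimizing sequences use, and it covers
    closed operators, bounded ones and the zero operator on a closed subspace. *)
Definition seq_closed T : Prop := forall (u : H^nat) x y,
  (forall n, dom T (u n)) -> u @ \oo --> x -> T (u n) @[n --> \oo] --> y ->
  dom T x /\ T x = y.

Lemma closed_operator_seq T : closed_operator T -> seq_closed T.
Proof.
move=> cT u x y du ux Tuy.
apply: (@closed_cvg _ _ \oo _ (fun n => (u n, T (u n))) _ cT _ (x, y)).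
  by apply: nearW => n /=.
exact: cvg_pair.
Qed.

Lemma bounded_seq_closed A : bounded_operator A -> seq_closed A.
Proof.
move=> bA u x y _ ux Auy; split; first exact: bounded_domE.
by apply: (cvg_unique _ (bounded_cvg bA ux) Auy).
Qed.

Lemma vnorm_cvg (u : H^nat) x : u @ \oo --> x ->
  vnorm (u n) @[n --> \oo] --> vnorm x.
Proof.
move=> /hcvgP/cvgrPdist_lt ux; apply/cvgrPdist_lt => e e0.
apply: filterS (ux _ e0) => n; rewrite sub0r normrN ger0_norm ?vnorm_ge0//.
apply: le_lt_trans; rewrite ler_norml.
have := vnormD (u n - x) x; have := vnormD (x - u n) (u n); rewrite !subrK.
by rewrite (vnormB x (u n)) => ? ?; apply/andP; split; lra.
Qed.

(** First-order condition at a minimum: the polynomial vanishes at t = 0, so its slope there is 0.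
    For q > 0 the value at t = p/q is -p^2/q. *)
Lemma quadratic_ge0 (p q : R) : (forall t, 0 <= t ^+ 2 * q - 2 * t * p) -> p = 0.
Proof.
move=> h; apply/eqP; case: (eqVneq p 0) => // p0.
have [q0|q0] := leP q 0.
  have := h p; have := h (- p); have : 0 < p ^+ 2 by rewrite exprn_even_gt0.
  have : p ^+ 2 * q <= 0 by rewrite mulr_ge0_le0 ?sqr_ge0.
  rewrite sqrrN; nra.
have := h (p / q).
have -> : (p / q) ^+ 2 * q - 2 * (p / q) * p = - (p ^+ 2 / q) by field; rewrite gt_eqF.
rewrite oppr_ge0 => /(lt_le_trans _) -/(_ 0).
by rewrite ltxx => -> //; rewrite divr_gt0// exprn_even_gt0.
Qed.

Section GraphProjection.
Variables (T : operator H) (cT : seq_closed T) (a b : H).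

(** Squared distance from (a, b) to the point (w, T w) of the graph. *)
Let Q w : R := vnorm (a - w) ^+ 2 + vnorm (b - T w) ^+ 2.

Let Qmid z w : dom T z -> dom T w ->
  vnorm (z - w) ^+ 2 + vnorm (T z - T w) ^+ 2 =
  2 * Q z + 2 * Q w - 4 * Q (2^-1 *: (z + w)).
Proof.
have mid (c u v : H) : vnorm (u - v) ^+ 2 =
    2 * vnorm (c - u) ^+ 2 + 2 * vnorm (c - v) ^+ 2 - 4 * vnorm (c - 2^-1 *: (u + v)) ^+ 2.
  have := parallelogram (c - u) (c - v).
  have -> : c - u - (c - v) = v - u by rewrite opprB [v - c]addrC addrACA subrr add0r addrC.
  have -> : c - u + (c - v) = 2 *: (c - 2^-1 *: (u + v)).
    rewrite scalerBr scalerA mulfV ?pnatr_eq0// scale1r scaler_nat mulr2n opprD.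
    by rewrite addrACA.
  rewrite vnormZ (vnormB v u) exprMn.
  have -> : normc (2 : R[i]) ^+ 2 = 4.
    have -> : (2 : R[i]) = (2 : R)%:C by rewrite rmorphMn.
    by rewrite normc_real ger0_norm// -natrX.
  lra.
move=> Tz Tw; rewrite /Q appZ; last exact: domD.
by rewrite appD// (mid a z w) (mid b (T z) (T w)); ring.
Qed.

Let m := inf [set Q w | w in dom T].

Let Qinf : has_inf [set Q w | w in dom T].
Proof.
split; first by exists (Q 0); exists 0 => //; exact: dom0.
by exists 0 => _ [w _ <-]; rewrite addr_ge0 ?sqr_ge0.
Qed.

Let m_le w : dom T w -> m <= Q w.
Proof. by move=> Tw; apply: ge_inf; [case: Qinf|exists w]. Qed.

(** Nearest point of the graph to (a, b): by the parallelogram identity [Qmid] a minimizing sequence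
    is Cauchy together with its image under [T], closedness gives the limit, and the first variation
    of [Q] at the minimum is the orthogonality relation. *)
Lemma graph_projection : exists2 z, dom T z &
  forall w, dom T w -> inner (a - z) w + inner (b - T z) (T w) = 0.
Proof.
have /choice[u uP] : forall n, exists w, dom T w /\ Q w < m + n.+1%:R^-1.
  move=> n; have [] := @inf_adherent _ _ (n.+1%:R^-1) _ Qinf; first by rewrite invr_gt0.
  by move=> _ [w Tw <-] ?; exists w.
have Tu n : dom T (u n) by case: (uP n).
have uQ n : Q (u n) < m + n.+1%:R^-1 by case: (uP n).
have hc (e : R) : 0 < e -> exists N, forall p q, (N <= p)%N -> (N <= q)%N ->
    vnorm (u p - u q) ^+ 2 + vnorm (T (u p) - T (u q)) ^+ 2 < e.
  (* With both excesses over the infimum below e/4, [Qmid] leaves less than 2(e/4) + 2(e/4) = e,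
     since the midpoint term is at least [m]. *)
  move=> e0; have [N _ NP] := near_infty_natSinv_lt (PosNum (divr_gt0 e0 (ltr0n R 4))).
  exists N => p q /NP/= hp /NP/= hq.
  have := m_le (@domZ T (2^-1) _ (domD (Tu p) (Tu q))).
  rewrite (Qmid (Tu p) (Tu q)).
  have : forall q1 q2 q3 i1 i2 : R, i1 < e / 4 -> i2 < e / 4 -> q1 < m + i1 ->
    q2 < m + i2 -> m <= q3 -> 2 * q1 + 2 * q2 - 4 * q3 < e by move: m => m0 *; lra.
  by apply; [exact: hp|exact: hq| |].
have sq_lt (s t e : R) : 0 <= s -> 0 <= e -> s ^+ 2 + t ^+ 2 < e ^+ 2 -> s < e.
  move=> s0 e0 h; rewrite -(@ltr_pXn2r _ 2) ?nnegrE//.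
  by apply: le_lt_trans h; rewrite lerDl sqr_ge0.
have [|z uz] := @hcauchy_cvg _ _ u.
  move=> e e0; have [N NP] := hc (e ^+ 2) (exprn_gt0 _ e0).
  exists N => p q hp hq; apply: sq_lt (NP _ _ hp hq); rewrite ?vnorm_ge0 ?ltW//.
have [|z' Tuz] := @hcauchy_cvg _ _ (T \o u).
  move=> e e0; have [N NP] := hc (e ^+ 2) (exprn_gt0 _ e0).
  exists N => p q hp hq; have := NP _ _ hp hq; rewrite addrC.
  by apply: sq_lt; rewrite ?vnorm_ge0 ?ltW//.
have [Tz Tzz] := cT Tu uz Tuz.
exists z => //.
have Qz : Q z <= m.
  have Qu : Q (u n) @[n --> \oo] --> Q z.
    rewrite /Q Tzz; apply: cvgD; (under eq_fun do rewrite expr2; rewrite expr2);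
      apply: cvgM; apply: vnorm_cvg; apply: cvgB => //; exact: cvg_cst.
  apply: (@ler_cvg_to _ _ _ _ (fun n => Q (u n)) (fun n => m + n.+1%:R^-1)) Qu _ _.
    rewrite -[X in _ --> X]addr0; apply: cvgD; first exact: cvg_cst.
    exact: cvg_harmonic.
  by apply: nearW => n; exact: ltW.
have key w : dom T w -> complex.Re (inner (a - z) w + inner (b - T z) (T w)) = 0.
  move=> Tw; apply: (@quadratic_ge0 _ (vnorm w ^+ 2 + vnorm (T w) ^+ 2)) => t.
  have := le_trans Qz (m_le (domD Tz (@domZ T t%:C _ Tw))).
  rewrite /Q appD ?appZ//; last exact: domZ.
  rewrite !opprD !addrA ![vnorm (_ - _ - _) ^+ 2]vnorm_sqrD.
  rewrite !innerNr !vnormN !innerZr !vnormZ !exprMn normc_real real_normK ?num_real//.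
  rewrite raddfD/=.
  by case: (inner (a - z) w) => ? ?; case: (inner (b - T z) (T w)) => ? ? /=; lra.
(* [key] only controls real parts; applied to the multiple of [w] by the imaginary unit it yields
   the imaginary part. *)
move=> w Tw; have := key _ Tw; have := key _ (@domZ T 'i _ Tw).
rewrite appZ// !innerZr !raddfD/=.
case: (inner (a - z) w) => ? ?; case: (inner (b - T z) (T w)) => ? ? /= h1 h2.
by apply/eqP; rewrite eq_complex/=; apply/andP; split; apply/eqP; lra.
Qed.

End GraphProjection.

Lemma inner_all0 x (D : set H) : dense D -> (forall y, D y -> inner x y = 0) -> x = 0.
Proof.
move=> dD Dx; apply: vnorm0_eq0; apply/eqP; rewrite eq_le vnorm_ge0 andbT.
apply/ler_addgt0Pl => e e0; rewrite addr0.
have [||y [xy Dy]] := dD (ball x e%:C).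
  by exists x; apply: ballxx; rewrite ltcR.
  exact: ball_open.
have h : vnorm (x - y) < e by move: xy; rewrite -ball_normE /ball_/= vnormE ltcR.
have := cauchy_schwarz x (x - y); rewrite innerBr (Dx _ Dy) subr0 inner_vnorm normc_real.
rewrite ger0_norm ?sqr_ge0// expr2 => k.
have [->|x0] := eqVneq (vnorm x) 0; first exact: ltW.
by rewrite -(ler_pM2l (_ : 0 < vnorm x)) ?lt_def ?x0 ?vnorm_ge0// (le_trans k)// ler_wpM2l ?vnorm_ge0 ?ltW.
Qed.

Lemma inner_ext x y : (forall w, inner x w = inner y w) -> x = y.
Proof.
move=> xy; apply/eqP; rewrite -subr_eq0; apply/eqP/inner_eq0.
by rewrite innerBl xy subrr.
Qed.

Lemma inner_cvg (u : H^nat) x y : u @ \oo --> x -> (forall n, inner (u n) y = 0) -> inner x y = 0.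
Proof.
move=> /hcvgP ux uy; apply: eq0_normc; apply/eqP; rewrite eq_le normc_ge0 andbT.
have ux' : vnorm (u n - x) * vnorm y @[n --> \oo] --> (0 : R).
  by rewrite -(mul0r (vnorm y)); apply: cvgM => //; exact: cvg_cst.
apply: (@ler_cvg_to _ _ _ _ (cst (normc (inner x y))) _ _ _ (cvg_cst _) ux').
apply: nearW => n /=; rewrite -[inner x y](subr0) -(uy n) -innerBl vnormB.
exact: cauchy_schwarz.
Qed.

Definition subspace (K : set H) : Prop :=
  [/\ K 0, forall (a : R[i]) x y, K x -> K y -> K (a *: x + y)
    & forall (u : H^nat) x, (forall n, K (u n)) -> u @ \oo --> x -> K x].

Lemma projection_on (K : set H) : subspace K ->
  exists P : operator H, [/\ bounded_operator P, forall x, K (P x)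
    & forall x w, K w -> inner (x - P x) w = 0].
Proof.
move=> [K0 Klin Kcl].
(* The projection onto [K] is the graph projection of (x, 0) for the zero operator with domain
   [K]. *)
pose T := @Operator R H K (fun=> 0) K0 Klin
  (fun a x y _ _ => esym (etrans (addr0 _) (scaler0 _ a))) (fun _ _ => erefl).
have cT : seq_closed T.
  move=> u x y Ku ux uy; split; first exact: Kcl ux.
  by apply: cvg_unique (cvg_cst _) uy; exact: norm_hausdorff.
have /choice[P PP] : forall x, exists z, K z /\ forall w, K w -> inner (x - z) w = 0.
  move=> x; have [z Kz zP] := graph_projection cT x 0.
  by exists z; split=> // w Kw; have := zP w Kw; rewrite inner0r addr0.
have KP x : K (P x) by case: (PP x).
have PK x w : K w -> inner (x - P x) w = 0 by case: (PP x) => _; apply.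
have [|A bA AP] := @bounded_operatorE P 1.
  split=> [a x y|x].
    apply/eqP; rewrite -subr_eq0; apply/eqP/inner_eq0.
    (* The defect of linearity lies in [K] and is also a combination of the vectors x - P x, which
       are orthogonal to [K]; hence it is 0. *)
    set w := (X in inner _ X).
    have Kw : K w.
      by rewrite /w -scaleN1r addrC; apply: (Klin) => //; apply: (Klin).
    have wE : w = a *: (x - P x) + (y - P y) - (a *: x + y - P (a *: x + y)).
      by rewrite /w scalerBr addrACA -opprD opprB [RHS]addrC addrA subrK.
    change (inner w w = 0); rewrite {1}wE.
    by rewrite innerBl innerDl innerZl !PK// mulr0 addr0 subr0.
  rewrite mul1r -(@ler_pXn2r _ 2) ?nnegrE ?vnorm_ge0//.
  rewrite -[in leRHS](subrK (P x) x) vnorm_sqrD PK//= mulr0 addr0.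
  by rewrite lerDr sqr_ge0.
by exists A; split=> // x *; rewrite ?AP//; exact: PK.
Qed.

(** The functional <y, A w> has a closed kernel [K]. Unless it is zero, the component [e] orthogonal
    to [K] of a vector outside [K] represents it up to a scalar, because every w differs from a
    multiple of [e] by an element of [K]. *)
Lemma riesz A y : bounded_operator A -> exists z, forall w, inner z w = inner y (A w).
Proof.
move=> bA; have dA := bounded_domE bA.
pose K := [set w | inner y (A w) = 0].
have sK : subspace K.
  split; rewrite /K/=; first by rewrite app0 inner0r.
    by move=> a u v Ku Kv; rewrite app_linear// innerDr innerZr Ku Kv mulr0 addr0.
  move=> u x Ku ux; rewrite inner_conj (inner_cvg (bounded_cvg bA ux)) ?rmorph0// => n.
  by rewrite inner_conj (Ku n) rmorph0.
have [P [bP KP PK]] := projection_on sK.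
case: (pselect (exists a, inner y (A a) <> 0)) => [[a a0]|na]; last first.
  exists 0 => w; rewrite inner0l; apply/esym/eqP/negP => /negP/eqP ?.
  by apply: na; exists w.
pose e := a - P a.
have ye : inner y (A e) = inner y (A a).
  by rewrite /e appB// innerBr [X in _ - X](KP a) subr0.
have e0 : inner e e != 0.
  apply/eqP => /inner_eq0 e0; apply: a0; by rewrite -ye e0 app0 inner0r.
pose c : R[i] := inner y (A e) / inner e e.
exists (c^* *: e) => w; rewrite innerZl conjCK.
have : inner e (w - (inner y (A w) / inner y (A e)) *: e) = 0.
  apply: PK; rewrite /K/= appB// ?appZ// innerBr innerZr divfK ?subrr//.
  by rewrite ye; apply/eqP.
rewrite innerBr innerZr => /eqP; rewrite subr_eq0 => /eqP ->.
by rewrite mulrCA /c divfK// divfK// ye; apply/eqP.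
Qed.

Lemma bounded_adjoint A : bounded_operator A -> exists2 A' : operator H,
  bounded_operator A' & forall x y, inner (A' x) y = inner x (A y).
Proof.
move=> bA; have dA := bounded_domE bA; have [M M0 AM] := bounded_vnorm bA.
have /choice[f fP] := fun y => riesz y bA.
have [|A' bA' A'f] := @bounded_operatorE f M; last by exists A' => // x y; rewrite A'f.
split=> [a x y|x].
  by apply: inner_ext => w; rewrite !(fP, innerDl, innerZl).
have [->|x0] := eqVneq (vnorm (f x)) 0; first by rewrite mulr_ge0 ?vnorm_ge0.
have fx0 : 0 < vnorm (f x) by rewrite lt_def x0 vnorm_ge0.
rewrite -(ler_pM2l fx0) -expr2.
have := cauchy_schwarz x (A (f x)); rewrite -fP inner_vnorm normc_real ger0_norm ?sqr_ge0//.
move=> /le_trans; apply; rewrite mulrCA mulrA [leRHS]mulrC mulrA -mulrA.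
by rewrite ler_wpM2l ?vnorm_ge0// (le_trans (AM _))// mulrC.
Qed.

End HilbertOperators.

(** * Spectral integrals *)

Section SpectralProjections.
Context d (S : measurableType d) (R : realType) (H : hilbertType R).
Variable E : spectral_measure S H.
Implicit Types (x y : H) (A B : set S).

Lemma spectral_bounded A : measurable A -> bounded_operator (E A).
Proof. by move=> mA; have [] := spectral_proj E mA. Qed.

Lemma spectral_dom A x : measurable A -> dom (E A) x.
Proof. by move=> mA; apply: bounded_domE; exact: spectral_bounded. Qed.

Lemma spectral_idem A x : measurable A -> E A (E A x) = E A x.
Proof. by move=> mA; have [] := spectral_proj E mA. Qed.

Lemma spectral_sym A x y : measurable A -> inner (E A x) y = inner x (E A y).
Proof. by move=> mA; have [] := spectral_proj E mA. Qed.

Lemma spectralD A x y : measurable A -> E A (x + y) = E A x + E A y.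
Proof. by move=> mA; rewrite appD//; exact: spectral_dom. Qed.

Lemma spectralB A x y : measurable A -> E A (x - y) = E A x - E A y.
Proof. by move=> mA; rewrite appB//; exact: spectral_dom. Qed.

Lemma spectralZ A (a : R[i]) x : measurable A -> E A (a *: x) = a *: E A x.
Proof. by move=> mA; rewrite appZ//; exact: spectral_dom. Qed.

Lemma vector_measureE x A : measurable A ->
  vector_measure E x A = (vnorm (E A x) ^+ 2)%:E.
Proof.
move=> mA; rewrite /vector_measure asboolT//; congr EFin.
by rewrite -[E A x]spectral_idem// spectral_sym// inner_vnorm spectral_idem.
Qed.

Lemma vector_measureT x : vector_measure E x setT = (vnorm x ^+ 2)%:E.
Proof. by rewrite vector_measureE// spectral_setT. Qed.

Lemma spectral_contract A x : measurable A -> vnorm (E A x) <= vnorm x.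
Proof.
move=> mA; rewrite -(@ler_pXn2r _ 2) ?nnegrE ?vnorm_ge0// -lee_fin.
by rewrite -vector_measureE// -vector_measureT le_measure//; exact: mem_set.
Qed.

Lemma spectralU A B x : measurable A -> measurable B -> A `&` B = set0 ->
  E (A `|` B) x = E A x + E B x.
Proof.
move=> mA mB AB0.
have mF n : measurable (bigcup2 A B n) by case: n => [|[|n]]//=; exact: measurable0.
have tF : trivIset setT (bigcup2 A B) by rewrite -trivIset_bigcup2 in AB0 *.
have := @spectral_sigma_additive _ _ _ _ E _ mF tF x; rewrite bigcup2E => h.
apply: (cvg_unique _ h); first exact: norm_hausdorff.
apply: cvg_near_cst; exists 2%N => // n /= n2.
rewrite /series/= -(subnK n2) addn2 !big_nat_recl//= big1 ?addr0//.
by move=> i _ ; rewrite spectral_val0.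
Qed.

Lemma spectralC A x : measurable A -> E (~` A) x = x - E A x.
Proof.
move=> mA; have := @spectralU A (~` A) x mA (measurableC mA) (setICr A).
by rewrite setUCr spectral_setT => {2}->; rewrite addrC addKr.
Qed.

(** First case of multiplicativity, which the definition of a spectral measure does not postulate:
    the vector measure of x - E B x gives mass 0 to [B], hence to its subset [A]. *)
Lemma spectral_subl A B x : measurable A -> measurable B -> A `<=` B ->
  E A (E B x) = E A x.
Proof.
move=> mA mB AB; apply/eqP; rewrite -subr_eq0 -spectralB// -oppr_eq0.
rewrite -[_ - _]opprB -[in X in - X]scaleN1r spectralZ// scaleN1r opprK -spectralC//.
apply/eqP/vnorm0_eq0/eqP; rewrite -sqrf_eq0 eq_le sqr_ge0 andbT -lee_fin.
rewrite -vector_measureE// (le_trans (le_measure _ _ _ AB)) ?mem_set//.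
rewrite [X in (X <= _)%E](vector_measureE _ mB).
by rewrite spectralC// spectralB// spectral_idem// subrr vnorm0 expr0n.
Qed.

Lemma spectral_subr A B x : measurable A -> measurable B -> A `<=` B ->
  E B (E A x) = E A x.
Proof.
move=> mA mB AB; apply: inner_ext => w.
by rewrite !spectral_sym// spectral_subl.
Qed.

Lemma spectralI A B x : measurable A -> measurable B ->
  E A (E B x) = E (A `&` B) x.
Proof.
move=> mA mB; have mI : measurable (A `&` B) by exact: measurableI.
have mD : measurable (B `\` A) by exact: measurableD.
have -> : E B x = E (A `&` B) x + E (B `\` A) x.
  rewrite -spectralU//; first by rewrite setIC setUIDK.
  by apply/seteqP; split=> // s [[As _] [_ nAs]]; exact: nAs.
rewrite spectralD// spectral_subr//.
have : E (~` A) (E (B `\` A) x) = E (B `\` A) x.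
  by apply: spectral_subr => //; exact: measurableC.
by rewrite spectralC// => /eqP; rewrite subr_eq addrC -subr_eq subrr => /eqP <-; rewrite addr0.
Qed.

Lemma spectral_comm A B x : measurable A -> measurable B ->
  E A (E B x) = E B (E A x).
Proof. by move=> mA mB; rewrite !spectralI// setIC. Qed.

Lemma vector_measure_spectral A B x : measurable A -> measurable B ->
  vector_measure E (E A x) B = vector_measure E x (A `&` B).
Proof.
move=> mA mB; rewrite !vector_measureE ?spectralI// 1?setIC//; exact: measurableI.
Qed.

Lemma spectral_setD A B x : measurable A -> measurable B -> A `<=` B ->
  E (B `\` A) x = E B x - E A x.
Proof.
move=> mA mB AB; rewrite setDE -spectralI//; last exact: measurableC.
by rewrite spectralC// spectralB// spectral_subr.
Qed.

(** By Pythagoras the squared distance to the limit is a difference of two values of the vector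
    measure of [x], so continuity of that measure from below suffices. *)
Lemma spectral_cvg (F : (set S)^nat) x : (forall n, measurable (F n)) ->
  nondecreasing_seq F -> E (F n) x @[n --> \oo] --> E (\bigcup_n F n) x.
Proof.
move=> mF ndF; have mU : measurable (\bigcup_n F n) by exact: bigcupT_measurable.
have FU n : F n `<=` \bigcup_n F n by move=> s Fs; exists n.
have sq n : vnorm (E (F n) x - E (\bigcup_n F n) x) ^+ 2 =
    vnorm (E (\bigcup_n F n) x) ^+ 2 - vnorm (E (F n) x) ^+ 2.
  rewrite vnormB -spectral_setD//.
  have -> : E (\bigcup_n F n) x = E (F n) x + E (\bigcup_n F n `\` F n) x.
    by rewrite spectral_setD// addrC subrK.
  rewrite vnorm_sqrD [inner _ _](_ : _ = 0)//=; first by rewrite mulr0 addr0 addrC addKr.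
  rewrite spectral_sym// spectralI//; last exact: measurableD.
  by rewrite setDE setIA setIAC setICr set0I spectral_val0 inner0r.
apply/hcvgP/cvgrPdist_lt => e e0.
have := @nondecreasing_cvg_mu _ _ _ (vector_measure E x) F mF mU.
move=> /(_ ndF); rewrite [X in _ --> X](vector_measureE x mU) => h.
have {h}h : vnorm (E (F n) x) ^+ 2 @[n --> \oo] --> vnorm (E (\bigcup_n F n) x) ^+ 2.
  rewrite (_ : (fun n => _) = fine \o (vector_measure E x \o F)); first exact: fine_cvg.
  by apply/funext => n; rewrite /comp (vector_measureE x (mF n)).
have /cvgrPdist_lt/(_ _ (exprn_gt0 2 e0)) := h.
apply: filterS => n; rewrite -sq sub0r normrN !ger0_norm ?sqr_ge0 ?vnorm_ge0//.
by rewrite ltr_pXn2r ?nnegrE ?vnorm_ge0 ?ltW.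
Qed.

Lemma vector_measure_eq0 A x : measurable A ->
  vector_measure E x A = 0%E <-> E A x = 0.
Proof.
move=> mA; rewrite vector_measureE//; split => [[/eqP]|->]; last by rewrite vnorm0 expr0n.
by rewrite sqrf_eq0 => /eqP /vnorm0_eq0.
Qed.

End SpectralProjections.

(** * Borel measurability of complex functions *)

Section ComplexBorel.
Context {R : realType}.
Implicit Types (z w : R[i]).

Definition complexB : measurableType _ := g_sigma_algebraType (@open (R[i])^o).

Lemma normrcE z : `|z| = (normc z)%:C.
Proof. by []. Qed.

Lemma openC_ballP (U : set (R[i])^o) : open U <->
  forall z, U z -> exists2 e : R, 0 < e & forall w, normc (w - z) < e -> U w.
Proof.
rewrite openE; split=> [oU z Uz|oU z Uz].
  have [e /=] := (nbhs_ballP _ _).1 (oU z Uz).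
  case: e => e e'; rewrite ltcE /= => /andP[/eqP -> e0] eU.
  exists e => // w wz; apply: eU; rewrite -ball_normE /ball_/= -normrN opprB.
  by rewrite normrcE ltcR.
have [e e0 eU] := oU z Uz.
apply/nbhs_ballP; exists e%:C; first by rewrite /= ltcR.
move=> w; rewrite -ball_normE /ball_/= -normrN opprB normrcE ltcR; exact: eU.
Qed.

Lemma Re_le_normc z : `|complex.Re z| <= normc z.
Proof.
rewrite -(@ler_pXn2r _ 2) ?nnegrE ?normc_ge0//.
by rewrite sqr_normcE real_normK ?num_real// lerDl sqr_ge0.
Qed.

Lemma Im_le_normc z : `|complex.Im z| <= normc z.
Proof.
rewrite -(@ler_pXn2r _ 2) ?nnegrE ?normc_ge0//.
by rewrite sqr_normcE real_normK ?num_real// lerDr sqr_ge0.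
Qed.

Lemma normc_le_ReIm z : normc z <= `|complex.Re z| + `|complex.Im z|.
Proof.
rewrite -(@ler_pXn2r _ 2) ?nnegrE ?normc_ge0 ?addr_ge0// sqr_normcE sqrrD.
by rewrite !real_normK ?num_real// -addrA lerD2l lerDr mulrn_wge0// mulr_ge0.
Qed.

Lemma measurable_Re : measurable_fun setT (@complex.Re R : complexB -> R).
Proof.
apply: (measurability _ (RGenOInfty.measurableE R)) => //.
move=> _ [_ [a ->] <-]; rewrite setTI; apply: sub_sigma_algebra.
apply/openC_ballP => z; rewrite /preimage/= in_itv/= andbT => az.
exists (complex.Re z - a); first by rewrite subr_gt0.
move=> w wz; rewrite /preimage/= in_itv/= andbT.
have := le_lt_trans (Re_le_normc _) wz; rewrite raddfB/= ltr_norml => /andP[+ _]; lra.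
Qed.

Lemma measurable_Im : measurable_fun setT (@complex.Im R : complexB -> R).
Proof.
apply: (measurability _ (RGenOInfty.measurableE R)) => //.
move=> _ [_ [a ->] <-]; rewrite setTI; apply: sub_sigma_algebra.
apply/openC_ballP => z; rewrite /preimage/= in_itv/= andbT => az.
exists (complex.Im z - a); first by rewrite subr_gt0.
move=> w wz; rewrite /preimage/= in_itv/= andbT.
have := le_lt_trans (Im_le_normc _) wz; rewrite raddfB/= ltr_norml => /andP[+ _]; lra.
Qed.

Lemma borel_measurableP d (S : measurableType d) (f : S -> R[i]) :
  borel_measurable f <-> measurable_fun setT (@complex.Re R \o f) /\
                         measurable_fun setT (@complex.Im R \o f).
Proof.
split=> [mf|[mRe mIm]].
  split; first exact: (measurableT_comp measurable_Re mf).
  exact: (measurableT_comp measurable_Im mf).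
apply: (@measurability _ _ S complexB _ _ _ (erefl _)) => _ [U oU <-]; rewrite setTI.
(* [U] is the union of the open squares with rational centre (p, q) and half-side r contained in it,
   the ones selected by [good]; the union is countable. *)
pose box (p q r : rat) : set S := [set s | `|complex.Re (f s) - ratr p| < ratr r] `&`
  [set s | `|complex.Im (f s) - ratr q| < ratr r].
pose good (p q r : rat) := `[< forall z, `|complex.Re z - ratr p| < ratr r ->
   `|complex.Im z - ratr q| < ratr r -> U z >].
have -> : f @^-1` U = \bigcup_p \bigcup_q \bigcup_r (if good p q r then box p q r else set0).
  apply/seteqP; split=> s /=.
    move=> Us; have [e e0 eU] := (openC_ballP U).1 oU _ Us.
    (* A square of half-side r < e/4 whose centre is within r of the point in both coordinates
       contains the point, and each coordinate varies by less than e/2 from it. *)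
    have [r] := @rat_in_itvoo _ 0 (e / 4) (divr_gt0 e0 (ltr0n R 4)).
    rewrite in_itv/= => /andP[r0 re].
    have [p] := @rat_in_itvoo _ (complex.Re (f s)) (complex.Re (f s) + ratr r) ltac:(by rewrite ltrDl).
    rewrite in_itv/= => /andP[p1 p2].
    have [q] := @rat_in_itvoo _ (complex.Im (f s)) (complex.Im (f s) + ratr r) ltac:(by rewrite ltrDl).
    rewrite in_itv/= => /andP[q1 q2].
    exists p => //; exists q => //; exists r => //; rewrite ifT.
      by split; rewrite /= ltr_norml; apply/andP; split; lra.
    apply/asboolP => z; rewrite !ltr_norml => /andP[? ?] /andP[? ?].
    apply: eU; apply: le_lt_trans (normc_le_ReIm _) _; rewrite !raddfB/=.
    have : `|complex.Re z - complex.Re (f s)| < e / 2 by rewrite ltr_norml; apply/andP; split; lra.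
    have : `|complex.Im z - complex.Im (f s)| < e / 2 by rewrite ltr_norml; apply/andP; split; lra.
    lra.
  move=> [p _ [q _ [r _]]]; case: ifPn => // /asboolP gU [/= h1 h2]; exact: gU.
apply: bigcupT_measurable_rat => p; apply: bigcupT_measurable_rat => q.
apply: bigcupT_measurable_rat => r; case: ifPn => // _.
have mb (h : S -> R) (c e : R) : measurable_fun setT h -> measurable [set s | `|h s - c| < e].
  move=> mh; rewrite -[X in measurable X]setTI.
  have : measurable_fun setT (fun s => `|h s - c|).
    by apply: measurableT_comp => //; apply: measurable_funB => //.
  move=> /(_ measurableT `]-oo, e[%classic (measurable_itv _)).
  rewrite setTI; congr measurable; apply/seteqP; split=> s; rewrite /= in_itv//=.
by apply: measurableI; apply: mb.
Qed.

Lemma measurable_normc2 d (S : measurableType d) (f : S -> R[i]) :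
  borel_measurable f -> measurable_fun setT (fun s => normc (f s) ^+ 2).
Proof.
move=> /borel_measurableP[mRe mIm]; under eq_fun do rewrite sqr_normcE.
by apply: measurable_funD; apply: measurable_funX.
Qed.

Lemma borel_measurableD d (S : measurableType d) (f g : S -> R[i]) :
  borel_measurable f -> borel_measurable g -> borel_measurable (fun s => f s + g s).
Proof.
move=> /borel_measurableP[f1 f2] /borel_measurableP[g1 g2]; apply/borel_measurableP.
split.
  rewrite (_ : _ \o _ = (@complex.Re R \o f) \+ (@complex.Re R \o g)); first exact: measurable_funD.
  by apply/funext => s /=; rewrite raddfD.
rewrite (_ : _ \o _ = (@complex.Im R \o f) \+ (@complex.Im R \o g)); first exact: measurable_funD.
by apply/funext => s /=; rewrite raddfD.
Qed.

Lemma borel_measurableM d (S : measurableType d) (f g : S -> R[i]) :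
  borel_measurable f -> borel_measurable g -> borel_measurable (fun s => f s * g s).
Proof.
move=> /borel_measurableP[f1 f2] /borel_measurableP[g1 g2]; apply/borel_measurableP.
split.
  rewrite (_ : _ \o _ = ((@complex.Re R \o f) \* (@complex.Re R \o g)) \- ((@complex.Im R \o f) \* (@complex.Im R \o g))).
    by apply: measurable_funB; apply: measurable_funM.
  by apply/funext => s /=; case: (f s) => ? ?; case: (g s).
rewrite (_ : _ \o _ = ((@complex.Re R \o f) \* (@complex.Im R \o g)) \+ ((@complex.Im R \o f) \* (@complex.Re R \o g))).
  by apply: measurable_funD; apply: measurable_funM.
by apply/funext => s /=; case: (f s) => ? ?; case: (g s).
Qed.

Lemma borel_measurable_cst d (S : measurableType d) z : borel_measurable (cst z : S -> R[i]).
Proof. by apply/borel_measurableP; split; apply: measurable_cst. Qed.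

Lemma borel_measurable_real d (S : measurableType d) (f : S -> R) :
  measurable_fun setT f -> borel_measurable (fun s => (f s)%:C).
Proof. by move=> mf; apply/borel_measurableP; split=> //; apply: measurable_cst. Qed.

Lemma borel_measurableB d (S : measurableType d) (f g : S -> R[i]) :
  borel_measurable f -> borel_measurable g -> borel_measurable (fun s => f s - g s).
Proof.
move=> mf mg; under [X in borel_measurable X]eq_fun do rewrite -mulN1r.
apply: borel_measurableD => //; apply: borel_measurableM => //.
exact: borel_measurable_cst.
Qed.

End ComplexBorel.
Arguments complexB : clear implicits.

(** * Simple functions and the approximation of the identity of the complex plane *)

Section SimpleFunctions.
Context {R : realType}.

(** A simple function is a list of weighted sets that may overlap, so sums, products, conjugates and
    compositions are list operations and never require a common refinement. *)
Definition simple_fun {T : Type} (s : seq (R[i] * set T)) (t : T) : R[i] :=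
  \sum_(p <- s) p.1 * (\1_(p.2) t)%:C.

Definition simple_measurable d (S : measurableType d) (s : seq (R[i] * set S)) : Prop :=
  {in s, forall p, measurable p.2}.

Lemma simple_fun_cat T (s s' : seq (R[i] * set T)) t :
  simple_fun (s ++ s') t = simple_fun s t + simple_fun s' t.
Proof. by rewrite /simple_fun big_cat. Qed.

Lemma simple_measurable_cat d (S : measurableType d) (s s' : seq (R[i] * set S)) :
  simple_measurable s -> simple_measurable s' -> simple_measurable (s ++ s').
Proof. by move=> ms ms' p; rewrite mem_cat => /orP[/ms|/ms']. Qed.

Definition simple_scale {T} (a : R[i]) (s : seq (R[i] * set T)) :=
  [seq (a * p.1, p.2) | p <- s].

Lemma simple_fun_scale T a (s : seq (R[i] * set T)) t :
  simple_fun (simple_scale a s) t = a * simple_fun s t.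
Proof. by rewrite /simple_fun big_map mulr_sumr; apply: eq_bigr => p _ /=; rewrite mulrA. Qed.

Lemma simple_measurable_scale d (S : measurableType d) a (s : seq (R[i] * set S)) :
  simple_measurable s -> simple_measurable (simple_scale a s).
Proof. by move=> ms _ /mapP[p /ms ? ->]. Qed.

Definition simple_conj {T} (s : seq (R[i] * set T)) := [seq (p.1^*, p.2) | p <- s].

Lemma simple_fun_conj T (s : seq (R[i] * set T)) t :
  simple_fun (simple_conj s) t = (simple_fun s t)^*.
Proof.
rewrite /simple_fun big_map rmorph_sum/=; apply: eq_bigr => p _ /=.
by rewrite rmorphM; congr (_ * _); apply/esym; exact: conjc_real.
Qed.

Lemma simple_measurable_conj d (S : measurableType d) (s : seq (R[i] * set S)) :
  simple_measurable s -> simple_measurable (simple_conj s).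
Proof. by move=> ms _ /mapP[p /ms ? ->]. Qed.

Definition simple_mul {T} (s s' : seq (R[i] * set T)) :=
  [seq (p.1 * q.1, p.2 `&` q.2) | p <- s, q <- s'].

Lemma simple_fun_mul T (s s' : seq (R[i] * set T)) t :
  simple_fun (simple_mul s s') t = simple_fun s t * simple_fun s' t.
Proof.
rewrite /simple_fun big_allpairs_dep mulr_suml; apply: eq_bigr => p _.
rewrite mulr_sumr; apply: eq_bigr => q _ /=.
by rewrite indicI /= rmorphM/= mulrACA.
Qed.

Lemma simple_measurable_mul d (S : measurableType d) (s s' : seq (R[i] * set S)) :
  simple_measurable s -> simple_measurable s' -> simple_measurable (simple_mul s s').
Proof.
move=> ms ms' _ /allpairsP[[p q] [/= /ms ? /ms' ? ->]]; exact: measurableI.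
Qed.

Definition simple_comp {T T'} (g : T -> T') (s : seq (R[i] * set T')) :=
  [seq (p.1, g @^-1` p.2) | p <- s].

Lemma simple_fun_comp T T' (g : T -> T') (s : seq (R[i] * set T')) t :
  simple_fun (simple_comp g s) t = simple_fun s (g t).
Proof. by rewrite /simple_fun big_map; apply: eq_bigr => p _ /=; rewrite !indicE. Qed.

Lemma simple_measurable_comp d (S : measurableType d) (g : S -> R[i])
    (s : seq (R[i] * set (complexB R))) : borel_measurable g ->
  simple_measurable s -> simple_measurable (simple_comp g s).
Proof.
by move=> mg ms _ /mapP[p /ms ? ->] /=; rewrite -[X in measurable X]setTI; exact: mg.
Qed.

Lemma borel_measurable_simple d (S : measurableType d) (s : seq (R[i] * set S)) :
  simple_measurable s -> borel_measurable (simple_fun s).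
Proof.
elim: s => [|p s IHs] ms.
  rewrite (_ : simple_fun _ = cst 0); first exact: borel_measurable_cst.
  by apply/funext => t; rewrite /simple_fun big_nil.
rewrite (_ : simple_fun _ = fun t => p.1 * (\1_(p.2) t)%:C + simple_fun s t).
  apply: borel_measurableD; last by apply: IHs => q qs; apply: ms; rewrite inE qs orbT.
  apply: borel_measurableM; first exact: borel_measurable_cst.
  by apply: borel_measurable_real; apply: measurable_indic; apply: ms; rewrite inE eqxx.
by apply/funext => t; rewrite /simple_fun big_cons.
Qed.

Import HBNNSimple.

Lemma nnsfun_simple d (S : measurableType d) (h : {nnsfun S >-> R}) :
  exists s : seq (R[i] * set S), simple_measurable s /\
    forall t, simple_fun s t = (h t)%:C.
Proof.
exists [seq (y%:C, h @^-1` [set y]) | y <- enum_fset (fset_set (range h))]; split.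
  by move=> _ /mapP[y _ ->] /=; exact: measurable_sfunP.
move=> t; rewrite /simple_fun big_map fimfunE fsbig_finite//= rmorph_sum/=.
by apply: eq_bigr => y _; rewrite rmorphM.
Qed.

Lemma nnsfun_approx_exists d (S : measurableType d) (phi : S -> R) :
  (forall t, 0 <= phi t) -> measurable_fun setT phi ->
  exists h : nat -> {nnsfun S >-> R}, forall t,
    (forall n, 0 <= h n t <= phi t) /\ h n t @[n --> \oo] --> phi t.
Proof.
move=> phi0 mphi; have mE : measurable_fun setT (EFin \o phi) by apply/measurable_EFinP.
exists (nnsfun_approx measurableT mE) => t.
have ct : nnsfun_approx measurableT mE n t @[n --> \oo] --> phi t.
  apply: (@fine_cvg _ _ _ _ (EFin \o _)).
  by apply: cvg_nnsfun_approx => // s _; rewrite lee_fin.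
split=> // n; rewrite fun_ge0/=.
rewrite -(cvg_lim (@Rhausdorff R) ct); apply: nondecreasing_cvgn_le.
  by move=> m k mk; have /lefP := nd_nnsfun_approx measurableT mE mk; apply.
by apply/cvg_ex; exists (phi t).
Qed.

(** A single sequence on the complex plane approximates the identity from below in modulus; composed
    with any Borel g it approximates g by simple functions whose sets are preimages under g. *)
Lemma complex_approx : exists s : nat -> seq (R[i] * set (complexB R)),
  forall n, simple_measurable (s n) /\ forall z, normc (simple_fun (s n) z) <= normc z /\
    normc (simple_fun (s n) z - z) @[n --> \oo] --> (0 : R).
Proof.
have mp (phi : complexB R -> R) : measurable_fun setT phi ->
    exists s : nat -> seq (R[i] * set (complexB R)),
    forall n, simple_measurable (s n) /\ forall z,
      exists h : nat -> R, [/\ forall n, simple_fun (s n) z = (h n)%:C,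
        forall n, `|h n| <= `|phi z| & h n @[n --> \oo] --> phi z].
  move=> mphi.
  have [||h hP] := @nnsfun_approx_exists _ _ (fun z => Num.max (phi z) 0).
    by move=> t; rewrite le_max lexx orbT.
    by apply: measurable_maxr => //; exact: measurable_cst.
  have [||k kP] := @nnsfun_approx_exists _ _ (fun z => Num.max (- phi z) 0).
    by move=> t; rewrite le_max lexx orbT.
    by apply: measurable_maxr; [exact: measurableT_comp|exact: measurable_cst].
  have /choice[u uP] := fun n => nnsfun_simple (h n).
  have /choice[v vP] := fun n => nnsfun_simple (k n).
  exists (fun n => u n ++ simple_scale (-1) (v n)) => n; split.
    apply: simple_measurable_cat; first by case: (uP n).
    by apply: simple_measurable_scale; case: (vP n).
  move=> z; exists (fun n => h n z - k n z); split.
  - move=> m; rewrite simple_fun_cat simple_fun_scale; case: (uP m) => _ ->.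
    by case: (vP m) => _ ->; rewrite mulN1r rmorphB.
  - move=> m; have [/(_ m) + _] := hP z; have [/(_ m) + _] := kP z.
    rewrite ler_norml /Num.max.
    case: (ltrP (phi z) 0) => p0; case: (ltrP (- phi z) 0) => p1;
      rewrite ?(ltr0_norm p0) ?(ger0_norm p0) => /andP[? ?] /andP[? ?];
      by apply/andP; split; lra.
  (* At each point at most one of the two parts of [phi] is nonzero; their difference recovers
     [phi]. *)
  - have -> : phi z = Num.max (phi z) 0 - Num.max (- phi z) 0.
      by rewrite /Num.max; case: ifPn; case: ifPn; rewrite ?oppr_lt0 -?leNgt => *; lra.
    by apply: cvgB; [case: (hP z)|case: (kP z)].
have [u uP] := mp _ measurable_Re; have [v vP] := mp _ measurable_Im.
exists (fun n => u n ++ simple_scale 'i (v n)) => n; split.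
  apply: simple_measurable_cat; first by case: (uP n).
  by apply: simple_measurable_scale; case: (vP n).
(* The pointwise clause of [mp] stands under a quantifier over n on which it does not depend; the
   instance 0 already speaks of the whole sequence. *)
move=> z; have [_ /(_ z)[h [hE hle hcvg]]] := uP 0%N; have [_ /(_ z)[k [kE kle kcvg]]] := vP 0%N.
have E m : simple_fun (u m ++ simple_scale 'i (v m)) z = h m +i* k m.
  rewrite simple_fun_cat simple_fun_scale hE kE.
  by apply/eqP; rewrite eq_complex/=; apply/andP; split; apply/eqP; ring.
split.
  rewrite E -(@ler_pXn2r _ 2) ?nnegrE ?normc_ge0// !sqr_normcE/= lerD//.
    by rewrite -[leLHS]real_normK ?num_real// -[leRHS]real_normK ?num_real// lerXn2r ?nnegrE.
  by rewrite -[leLHS]real_normK ?num_real// -[leRHS]real_normK ?num_real// lerXn2r ?nnegrE.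
under eq_fun do rewrite E.
apply: (@squeeze_cvgr _ _ _ _ (cst 0) (fun n => `|h n - complex.Re z| + `|k n - complex.Im z|)).
- by apply: nearW => m; rewrite normc_ge0/=; apply: le_trans (normc_le_ReIm _) _; rewrite !raddfB.
- exact: cvg_cst.
- by rewrite -[X in _ --> X]addr0; apply: cvgD; apply/norm_cvg0P/subr_cvg0.
Qed.

End SimpleFunctions.

(** * Spectral integrals as limits of simple operators *)

Section SpectralIntegral.
Context d (S : measurableType d) (R : realType) (H : hilbertType R).
Variable E : spectral_measure S H.
Implicit Types (x y : H) (A B : set S) (s : seq (R[i] * set S)) (f g : S -> R[i]).

Definition simple_op s x : H := \sum_(p <- s) p.1 *: E p.2 x.

Lemma simple_op_nil x : simple_op [::] x = 0.
Proof. by rewrite /simple_op big_nil. Qed.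

Lemma simple_op_cons p s x : simple_op (p :: s) x = p.1 *: E p.2 x + simple_op s x.
Proof. by rewrite /simple_op big_cons. Qed.

Lemma simple_op_cat s s' x : simple_op (s ++ s') x = simple_op s x + simple_op s' x.
Proof. by rewrite /simple_op big_cat. Qed.

Lemma simple_op_scale a s x : simple_op (simple_scale a s) x = a *: simple_op s x.
Proof.
by rewrite /simple_op big_map scaler_sumr; apply: eq_bigr => p _ /=; rewrite scalerA.
Qed.

Lemma simple_measurable_cons p s : simple_measurable (p :: s) ->
  measurable p.2 /\ simple_measurable s.
Proof.
move=> ms; split; first by apply: ms; rewrite inE eqxx.
by move=> q qs; apply: ms; rewrite inE qs orbT.
Qed.

Lemma simple_op_linear s (a : R[i]) x y : simple_measurable s ->
  simple_op s (a *: x + y) = a *: simple_op s x + simple_op s y.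
Proof.
elim: s => [|p s IHs]; first by rewrite !simple_op_nil scaler0 addr0.
move=> /simple_measurable_cons[mp ms]; rewrite !simple_op_cons IHs//.
rewrite spectralD// spectralZ// !scalerDr !scalerA [_ * a]mulrC.
by rewrite addrACA.
Qed.

Lemma simple_op_conj s x y : simple_measurable s ->
  inner (simple_op s x) y = inner x (simple_op (simple_conj s) y).
Proof.
elim: s => [|p s IHs]; first by rewrite /= !simple_op_nil inner0l inner0r.
move=> /simple_measurable_cons[mp ms]; rewrite /= !simple_op_cons innerDl innerDr IHs//=.
by rewrite innerZl innerZr spectral_sym.
Qed.

Lemma simple_op_mul s s' x : simple_measurable s -> simple_measurable s' ->
  simple_op (simple_mul s s') x = simple_op s (simple_op s' x).
Proof.
move=> + ms'; elim: s => [|p s IHs]; first by rewrite !simple_op_nil.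
move=> /simple_measurable_cons[mp ms]; rewrite /simple_mul allpairs_cons simple_op_cat.
rewrite simple_op_cons [X in _ + X]IHs//; congr (_ + _).
elim: s' ms' {IHs} => [|q s' IH]; first by rewrite !simple_op_nil app0 scaler0.
move=> /simple_measurable_cons[mq ms']; rewrite /= !simple_op_cons IH//=.
by rewrite spectralD// spectralZ// scalerDr scalerA spectralI.
Qed.

Lemma simple_fun_nil (t : S) : simple_fun [::] t = 0 :> R[i].
Proof. by rewrite /simple_fun big_nil. Qed.

Lemma simple_fun_cons p s (t : S) : simple_fun (p :: s) t = p.1 * (\1_(p.2) t)%:C + simple_fun s t.
Proof. by rewrite /simple_fun big_cons. Qed.

Lemma integrable_scale_indic A (r : R) x : measurable A ->
  (vector_measure E x).-integrable setT (EFin \o (fun t => r * \1_A t)).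
Proof.
move=> mA; apply: (@eq_integrable _ _ _ _ _ measurableT (fun t => r%:E * (\1_A t)%:E)%E).
  by move=> t _ /=; rewrite EFinM.
by apply: integrableZl => //; exact: integrable_indic.
Qed.

Lemma integrable_simple s x : simple_measurable s ->
  (vector_measure E x).-integrable setT (EFin \o (fun t => complex.Re (simple_fun s t))) /\
  (vector_measure E x).-integrable setT (EFin \o (fun t => complex.Im (simple_fun s t))).
Proof.
elim: s => [|p s IHs].
  by move=> _; split; apply: (@eq_integrable _ _ _ _ _ measurableT (cst 0%E)) (integrable0 _ _) => // t _;
    rewrite /= simple_fun_nil.
move=> /simple_measurable_cons[mp /IHs[iR iI]].
split.
  apply: (@eq_integrable _ _ _ _ _ measurableT (fun t => ((complex.Re p.1 * \1_(p.2) t)%R%:E + (complex.Re (simple_fun s t))%:E)%E)).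
    by move=> t _ /=; rewrite simple_fun_cons raddfD/=; case: (p.1) => ? ? /=; rewrite mulr0 subr0 EFinD.
  by apply: integrableD => //; exact: integrable_scale_indic.
apply: (@eq_integrable _ _ _ _ _ measurableT (fun t => ((complex.Im p.1 * \1_(p.2) t)%R%:E + (complex.Im (simple_fun s t))%:E)%E)).
  by move=> t _ /=; rewrite simple_fun_cons raddfD/=; case: (p.1) => ? ? /=; rewrite mulr0 add0r EFinD.
by apply: integrableD => //; exact: integrable_scale_indic.
Qed.

Lemma Rintegral_indic A (r : R) x : measurable A ->
  \int[vector_measure E x]_t (r * \1_A t) = r * vnorm (E A x) ^+ 2.
Proof.
move=> mA; rewrite RintegralZl//.
  by rewrite /Rintegral integral_indic// setIT [X in fine X]vector_measureE.
by have := integrable_scale_indic 1 x mA; under eq_fun do rewrite mul1r.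
Qed.

Lemma inner_simple s x : simple_measurable s -> inner x (simple_op s x) =
  (\int[vector_measure E x]_t complex.Re (simple_fun s t)) +i*
  (\int[vector_measure E x]_t complex.Im (simple_fun s t)).
Proof.
elim: s => [|p s IHs].
  move=> _; rewrite simple_op_nil inner0r; under eq_Rintegral do rewrite simple_fun_nil.
  by under [X in _ +i* X]eq_Rintegral do rewrite simple_fun_nil; rewrite Rintegral_cst//= mul0r.
move=> /simple_measurable_cons[mp ms]; rewrite simple_op_cons innerDr IHs//.
rewrite innerZr -[E _ _]spectral_idem// -spectral_sym// inner_vnorm.
have [iR iI] := integrable_simple x ms.
have -> : \int[vector_measure E x]_t complex.Re (simple_fun (p :: s) t) =
    complex.Re p.1 * vnorm (E p.2 x) ^+ 2 + \int[vector_measure E x]_t complex.Re (simple_fun s t).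
  rewrite -Rintegral_indic// -RintegralD//; last exact: integrable_scale_indic.
  apply: eq_Rintegral => t _; rewrite simple_fun_cons raddfD/=.
  by case: (p.1) => ? ? /=; rewrite mulr0 subr0.
have -> : \int[vector_measure E x]_t complex.Im (simple_fun (p :: s) t) =
    complex.Im p.1 * vnorm (E p.2 x) ^+ 2 + \int[vector_measure E x]_t complex.Im (simple_fun s t).
  rewrite -Rintegral_indic// -RintegralD//; last exact: integrable_scale_indic.
  apply: eq_Rintegral => t _; rewrite simple_fun_cons raddfD/=.
  by case: (p.1) => ? ? /=; rewrite mulr0 add0r.
by case: (p.1) => ? ?; apply/eqP; rewrite eq_complex/= !mulr0 subr0 add0r !eqxx.
Qed.

Definition sqint x f : \bar R := (\int[vector_measure E x]_t (normc (f t) ^+ 2)%:E)%E.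

Lemma sqint_ge0 x f : (0 <= sqint x f)%E.
Proof. by apply: integral_ge0 => t _; rewrite lee_fin sqr_ge0. Qed.

Lemma measurable_sq f : borel_measurable f ->
  measurable_fun setT (fun t => (normc (f t) ^+ 2)%:E).
Proof. by move=> /measurable_normc2/measurable_EFinP. Qed.

(** The isometry behind the whole construction: |J_s x|^2 = <x, J_{conj(s) s} x>, and conj(s) s is
    again simple, equal to |s|^2. *)
Lemma sqint_simple s x : simple_measurable s ->
  sqint x (simple_fun s) = (vnorm (simple_op s x) ^+ 2)%:E.
Proof.
move=> ms; have mc := simple_measurable_conj ms.
have mm := simple_measurable_mul mc ms.
have := inner_vnorm (simple_op s x).
rewrite simple_op_conj// -simple_op_mul// inner_simple// => /(congr1 (@complex.Re R))/= <-.
have := (integrable_simple x mm).1 => im.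
rewrite /Rintegral fineK; last exact: integrable_fin_num.
apply: eq_integral => t _; rewrite simple_fun_mul simple_fun_conj.
by rewrite (mulJc (simple_fun s t)).
Qed.

Lemma normc_sqD (z w : R[i]) : normc (z + w) ^+ 2 <= 2 * normc z ^+ 2 + 2 * normc w ^+ 2.
Proof.
rewrite !sqr_normcE; case: z => a b; case: w => a' b' /=.
have := sqr_ge0 (a - a'); have := sqr_ge0 (b - b'); nra.
Qed.

Lemma sqint_le x f g : borel_measurable f -> borel_measurable g ->
  (forall t, normc (f t) <= normc (g t)) -> (sqint x f <= sqint x g)%E.
Proof.
move=> mf mg fg; apply: ge0_le_integral => //; try exact: measurable_sq.
by move=> t _; rewrite lee_fin sqr_ge0.
by move=> t _; rewrite lee_fin lerXn2r ?nnegrE ?normc_ge0.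
Qed.

Lemma sqintD x f g : borel_measurable f -> borel_measurable g ->
  (sqint x (fun t => f t + g t)%R <= 2%:E * sqint x f + 2%:E * sqint x g)%E.
Proof.
move=> mf mg; have f2 := measurable_sq mf; have g2 := measurable_sq mg.
have p0 h : forall t : S, setT t -> (0 <= (normc (h t : R[i]) ^+ 2)%:E)%E.
  by move=> t _; rewrite lee_fin sqr_ge0.
rewrite -!ge0_integralZl_EFin//; try exact: p0.
rewrite -ge0_integralD//; first last.
- by apply: measurable_funeM.
- by move=> t _; rewrite mule_ge0// p0.
- by apply: measurable_funeM.
- by move=> t _; rewrite mule_ge0// p0.
apply: ge0_le_integral => //; first exact: p0.
- by apply: measurable_sq; exact: borel_measurableD.
- by apply: emeasurable_funD; apply: measurable_funeM.
- by move=> t _; rewrite -!EFinM -EFinD lee_fin normc_sqD.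
Qed.

Lemma sqint_scale x f (a : R[i]) : borel_measurable f ->
  sqint x (fun t => a * f t) = ((normc a ^+ 2)%:E * sqint x f)%E.
Proof.
move=> mf; rewrite /sqint -ge0_integralZl_EFin ?sqr_ge0//.
- by apply: eq_integral => t _; rewrite normcM exprMn EFinM.
- by move=> t _; rewrite lee_fin sqr_ge0.
- exact: measurable_sq.
Qed.

Lemma simple_diff s s' x g (e e' : R) : simple_measurable s -> simple_measurable s' ->
  borel_measurable g ->
  (sqint x (fun t => (simple_fun s t - g t)%R) < e%:E)%E ->
  (sqint x (fun t => (simple_fun s' t - g t)%R) < e'%:E)%E ->
  vnorm (simple_op s x - simple_op s' x) ^+ 2 < 2 * e + 2 * e'.
Proof.
move=> ms ms' mg h h'.
have -> : simple_op s x - simple_op s' x = simple_op (s ++ simple_scale (-1) s') x.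
  by rewrite simple_op_cat simple_op_scale scaleN1r.
have mf := borel_measurable_simple ms; have mf' := borel_measurable_simple ms'.
rewrite -lte_fin -sqint_simple; last first.
  by apply: simple_measurable_cat => //; exact: simple_measurable_scale.
have -> : simple_fun (s ++ simple_scale (-1) s') =
    (fun t => (simple_fun s t - g t) + (-1) * (simple_fun s' t - g t)).
  apply/funext => t; rewrite simple_fun_cat simple_fun_scale; ring.
have mB := borel_measurableB mf mg; have mB' := borel_measurableB mf' mg.
apply: le_lt_trans (sqintD _ _ _) _ => //.
  by apply: borel_measurableM => //; exact: borel_measurable_cst.
rewrite sqint_scale// normcN normc1 expr1n mul1e.
have -> : (2 * e + 2 * e')%:E = (2%:E * e%:E + 2%:E * e'%:E)%E by rewrite -!EFinM.
by apply: lteD; rewrite lte_pmul2l.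
Qed.

(** Convergence to [g] in L^2 of the vector measure of [x]; by the isometry the vectors [simple_op]
    then form a Cauchy sequence. *)
Definition approximates x (s_ : nat -> seq (R[i] * set S)) g : Prop :=
  (forall n, simple_measurable (s_ n)) /\
  sqint x (fun t => simple_fun (s_ n) t - g t) @[n --> \oo] --> 0%E.

Lemma approximates_lt x u_ g (e : R) : approximates x u_ g -> 0 < e ->
  \forall n \near \oo, (sqint x (fun t => simple_fun (u_ n) t - g t)%R < e%:E)%E.
Proof.
move=> [ms sg] e0; have /fine_cvgP[fn fc] := sg.
move/cvgrPdist_lt : fc => /(_ _ e0); apply: filterS2 fn => n fn.
rewrite sub0r normrN /= ger0_norm; last by rewrite fine_ge0// sqint_ge0.
by rewrite -lte_fin fineK.
Qed.

Lemma approximates_diff x u_ v_ g : borel_measurable g ->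
  approximates x u_ g -> approximates x v_ g ->
  simple_op (u_ n) x - simple_op (v_ n) x @[n --> \oo] --> (0 : H).
Proof.
move=> mg sg sg'; apply/hcvgP/cvgrPdist_lt => e e0.
have e2 : 0 < e ^+ 2 / 4 by rewrite divr_gt0// exprn_gt0.
apply: filterS2 (approximates_lt sg e2) (approximates_lt sg' e2) => n h h'.
rewrite subr0 sub0r normrN ger0_norm ?vnorm_ge0//.
rewrite -(@ltr_pXn2r _ 2) ?nnegrE ?vnorm_ge0 ?ltW//.
have -> : e ^+ 2 = 2 * (e ^+ 2 / 4) + 2 * (e ^+ 2 / 4) by field.
by apply: simple_diff (mg) h h'; [case: sg|case: sg'].
Qed.

Lemma approximates_cvg x u_ g : borel_measurable g -> approximates x u_ g ->
  exists v : H, simple_op (u_ n) x @[n --> \oo] --> v.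
Proof.
move=> mg sg; apply: hcauchy_cvg => e e0.
have e2 : 0 < e ^+ 2 / 4 by rewrite divr_gt0// exprn_gt0.
have [N _ NP] := approximates_lt sg e2.
exists N => m n Nm Nn; rewrite -(@ltr_pXn2r _ 2) ?nnegrE ?vnorm_ge0 ?ltW//.
have -> : e ^+ 2 = 2 * (e ^+ 2 / 4) + 2 * (e ^+ 2 / 4) by field.
apply: simple_diff (mg) _ _; [by case: sg|by case: sg|exact: NP|exact: NP].
Qed.

Definition complex_seq : nat -> seq (R[i] * set (complexB R)) :=
  sval (cid (@complex_approx R)).

Definition simple_seq g n : seq (R[i] * set S) := simple_comp g (complex_seq n).

Lemma complex_seq_measurable n : simple_measurable (complex_seq n).
Proof. by rewrite /complex_seq; case: cid => s sP /=; case: (sP n). Qed.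

Lemma simple_seq_measurable g n : borel_measurable g -> simple_measurable (simple_seq g n).
Proof.
by move=> mg; apply: simple_measurable_comp => //; exact: complex_seq_measurable.
Qed.

Lemma simple_seq_le g n t : normc (simple_fun (simple_seq g n) t) <= normc (g t).
Proof.
rewrite /simple_seq simple_fun_comp /complex_seq; case: cid => s sP /=.
by have [_ /(_ (g t))[]] := sP n.
Qed.

Lemma simple_seq_cvg g t :
  normc (simple_fun (simple_seq g n) t - g t) @[n --> \oo] --> (0 : R).
Proof.
rewrite /simple_seq; under eq_fun do rewrite simple_fun_comp.
by rewrite /complex_seq; case: cid => s sP /=; have [_ /(_ (g t))[]] := sP 0%N.
Qed.

Lemma simple_seq_cvg2 g t :
  (normc (simple_fun (simple_seq g n) t) ^+ 2)%:E @[n --> \oo] --> (normc (g t) ^+ 2)%:E.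
Proof.
apply: cvg_EFin; first by apply: nearW.
have ct : normc (simple_fun (simple_seq g n) t) @[n --> \oo] --> normc (g t).
  apply/cvgrPdist_lt => e e0; have /cvgrPdist_lt/(_ _ e0) := simple_seq_cvg g t.
  apply: filterS => n; rewrite sub0r normrN ger0_norm ?normc_ge0//; apply: le_lt_trans.
  have := le_normcD (simple_fun (simple_seq g n) t - g t) (g t).
  have := le_normcD (g t - simple_fun (simple_seq g n) t) (simple_fun (simple_seq g n) t).
  rewrite !subrK -[g t - _]opprB normcN => ? ?; rewrite ler_norml; apply/andP; split; lra.
rewrite (_ : fine \o _ = fun n => normc (simple_fun (simple_seq g n) t) *
    normc (simple_fun (simple_seq g n) t)); last by apply/funext => n /=; rewrite expr2.
by rewrite /= expr2; apply: cvgM.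
Qed.

Lemma simple_seq_approximates g x : borel_measurable g -> (sqint x g < +oo)%E ->
  approximates x (simple_seq g) g.
Proof.
move=> mg gx; have ms n : simple_measurable (simple_seq g n) by exact: simple_seq_measurable; split=> //.
have m2 n : measurable_fun setT (fun t => (normc (simple_fun (simple_seq g n) t - g t) ^+ 2)%:E).
  by apply: measurable_sq; apply: borel_measurableB => //; exact: borel_measurable_simple.
(* Dominating function: |s_n - g|^2 <= 2|s_n|^2 + 2|g|^2 <= 4|g|^2. *)
have ig : (vector_measure E x).-integrable setT (fun t => 4%:E * (normc (g t) ^+ 2)%:E)%E.
  apply: integrableZl => //; apply/integrableP; split; first exact: measurable_sq.
  by under eq_integral do rewrite gee0_abs ?lee_fin ?sqr_ge0//.
have [|||_ _] := @dominated_convergence _ _ _ (vector_measure E x) setT measurableT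
  (fun n t => (normc (simple_fun (simple_seq g n) t - g t) ^+ 2)%:E) (cst 0%E) _ m2 _ _ ig.
- exact: measurable_cst.
- apply: aeW => t _ /=; apply: cvg_EFin; first by apply: nearW.
  rewrite (_ : fine \o _ = fun n => normc (simple_fun (simple_seq g n) t - g t) *
      normc (simple_fun (simple_seq g n) t - g t)); last by apply/funext => n /=; rewrite expr2.
  by rewrite -[X in _ --> X](mulr0 0); apply: cvgM; exact: simple_seq_cvg.
- apply: aeW => t n _; rewrite gee0_abs; last by rewrite lee_fin sqr_ge0.
  rewrite -EFinM lee_fin.
  apply: le_trans (normc_sqD _ _) _; rewrite normcN.
  have : normc (simple_fun (simple_seq g n) t) ^+ 2 <= normc (g t) ^+ 2.
    by rewrite lerXn2r ?nnegrE ?normc_ge0// simple_seq_le.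
  lra.
by rewrite integral0.
Qed.

(** The value J_g x; meaningful when [sqint x g] is finite, a junk limit otherwise. *)
Definition sint g x : H := lim (simple_op (simple_seq g n) x @[n --> \oo]).

Lemma sint_simple_seq g x : borel_measurable g -> (sqint x g < +oo)%E ->
  simple_op (simple_seq g n) x @[n --> \oo] --> sint g x.
Proof.
move=> mg gx; have [v sv] := approximates_cvg mg (simple_seq_approximates mg gx).
by rewrite /sint (cvg_lim _ sv)//; exact: norm_hausdorff.
Qed.

(** The limit does not depend on the approximating sequence, so integrals of sums and of products
    with indicators can be computed along sequences adapted to them. *)
Lemma sint_cvg g x u_ : borel_measurable g -> (sqint x g < +oo)%E -> approximates x u_ g ->
  simple_op (u_ n) x @[n --> \oo] --> sint g x.
Proof.
move=> mg gx sg; rewrite -[sint g x]add0r.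
rewrite (_ : (fun n => simple_op (u_ n) x) = fun n =>
  (simple_op (u_ n) x - simple_op (simple_seq g n) x) + simple_op (simple_seq g n) x); last first.
  by apply/funext => n; rewrite subrK.
apply: cvgD; last exact: sint_simple_seq.
by apply: approximates_diff sg _ => //; exact: simple_seq_approximates.
Qed.

Lemma sint_norm g x : borel_measurable g -> (sqint x g < +oo)%E ->
  sqint x g = (vnorm (sint g x) ^+ 2)%:E.
Proof.
move=> mg gx; have ms n : simple_measurable (simple_seq g n) by exact: simple_seq_measurable.
have m2 n : measurable_fun setT (fun t => (normc (simple_fun (simple_seq g n) t) ^+ 2)%:E).
  by apply: measurable_sq; exact: borel_measurable_simple.
have ig : (vector_measure E x).-integrable setT (fun t => (normc (g t) ^+ 2)%:E)%E.
  apply/integrableP; split; first exact: measurable_sq.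
  by under eq_integral do rewrite gee0_abs ?lee_fin ?sqr_ge0//.
have [|||_ _ h] := @dominated_convergence _ _ _ (vector_measure E x) setT measurableT
  (fun n t => (normc (simple_fun (simple_seq g n) t) ^+ 2)%:E)
  (fun t => (normc (g t) ^+ 2)%:E) _ m2 _ _ ig.
- exact: measurable_sq.
- by apply: aeW => t _; exact: simple_seq_cvg2.
- apply: aeW => t n _; rewrite gee0_abs ?lee_fin ?sqr_ge0//.
  by rewrite lerXn2r ?nnegrE ?normc_ge0// simple_seq_le.
apply: (cvg_unique _ h); first exact: ereal_hausdorff.
rewrite (_ : (fun n => _) = (fun n => (vnorm (simple_op (simple_seq g n) x) ^+ 2)%:E)).
  apply: cvg_EFin; first by apply: nearW.
  rewrite (_ : fine \o _ = fun n => vnorm (simple_op (simple_seq g n) x) *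
      vnorm (simple_op (simple_seq g n) x)); last by apply/funext => n /=; rewrite expr2.
  by rewrite expr2; apply: cvgM; apply: vnorm_cvg; exact: sint_simple_seq.
by apply/funext => n; rewrite -sqint_simple.
Qed.

(** Treats the real and the imaginary part at once, as two instances of [phi]. *)
Lemma Rintegral_simple_seq g x (phi : {additive R[i] -> R}) :
  measurable_fun setT (phi : complexB R -> R) ->
  (forall z, `|phi z| <= normc z) -> borel_measurable g -> (sqint x g < +oo)%E ->
  \int[vector_measure E x]_t phi (simple_fun (simple_seq g n) t) @[n --> \oo] -->
  \int[vector_measure E x]_t phi (g t).
Proof.
move=> mphi phile mg gx; have ms n : simple_measurable (simple_seq g n) by exact: simple_seq_measurable.
have mf (f : S -> R[i]) : borel_measurable f -> measurable_fun setT (fun t => (phi (f t))%:E).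
  by move=> mf; apply/measurable_EFinP; exact: (measurableT_comp mphi mf).
have m2 n : measurable_fun setT (fun t => (phi (simple_fun (simple_seq g n) t))%:E).
  by apply: mf; exact: borel_measurable_simple.
(* Only |g|^2 is known to be integrable; the measure being finite, 1 + |g|^2 is integrable too and
   dominates |g|. *)
have ig : (vector_measure E x).-integrable setT (fun t => 1%:E + (normc (g t) ^+ 2)%:E)%E.
  apply: integrableD => //; first exact: finite_measure_integrable_cst.
  apply/integrableP; split; first exact: measurable_sq.
  by under eq_integral do rewrite gee0_abs ?lee_fin ?sqr_ge0//.
have [|||ip _ h] := @dominated_convergence _ _ _ (vector_measure E x) setT measurableT
  (fun n t => (phi (simple_fun (simple_seq g n) t))%:E)
  (fun t => (phi (g t))%:E) _ m2 _ _ ig.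
- exact: mf.
- apply: aeW => t _ /=; apply: cvg_EFin; first by apply: nearW.
  apply/cvgrPdist_lt => e e0; have /cvgrPdist_lt/(_ _ e0) := simple_seq_cvg g t.
  apply: filterS => n; rewrite sub0r normrN ger0_norm ?normc_ge0//; apply: le_lt_trans.
  by rewrite -raddfB -normrN -raddfN opprB; exact: phile.
- apply: aeW => t n _ /=; rewrite lee_fin.
  apply: le_trans (phile _) _; apply: le_trans (simple_seq_le _ _ _) _.
  have := sqr_ge0 (normc (g t) - 1); nra.
apply: fine_cvg; rewrite fineK//; exact: integrable_fin_num.
Qed.

Lemma sint_inner g x : borel_measurable g -> (sqint x g < +oo)%E ->
  inner x (sint g x) = (\int[vector_measure E x]_t complex.Re (g t)) +i*
                       (\int[vector_measure E x]_t complex.Im (g t)).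
Proof.
move=> mg gx; have ms n : simple_measurable (simple_seq g n) by exact: simple_seq_measurable.
have cs := sint_simple_seq mg gx.
have hR := Rintegral_simple_seq (phi := @complex.Re R) measurable_Re (@Re_le_normc R) mg gx.
have hI := Rintegral_simple_seq (phi := @complex.Im R) measurable_Im (@Im_le_normc R) mg gx.
have cR := cvg_Re_inner (x := x) cs.
(* Convergence is available for real parts; pairing with the multiple of [x] by the imaginary unit
   turns the imaginary part of <x, y> into a real part. *)
have cI := cvg_Re_inner (x := 'i *: x) cs.
have eR : complex.Re (inner x (sint g x)) = \int[vector_measure E x]_t complex.Re (g t).
  apply: (cvg_unique _ _ hR); first exact: Rhausdorff.
  rewrite -Re_inner_sym; apply: cvg_trans cR; apply: near_eq_cvg; apply: nearW => n.
  by rewrite Re_inner_sym inner_simple.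
have eI : complex.Im (inner x (sint g x)) = \int[vector_measure E x]_t complex.Im (g t).
  apply: (cvg_unique _ _ hI); first exact: Rhausdorff.
  have ReIm y : complex.Re (inner y ('i *: x)) = complex.Im (inner x y).
    by rewrite innerZr inner_conj; case: (inner x y) => a b /=; ring.
  rewrite -ReIm; apply: cvg_trans cI; apply: near_eq_cvg; apply: nearW => n.
  by rewrite ReIm inner_simple.
by rewrite -eR -eI; case: (inner _ _).
Qed.

End SpectralIntegral.

Lemma dense_cvg (T : topologicalType) (D : set T) :
  (forall x : T, exists2 u : nat -> T, (forall n, D (u n)) & u n @[n --> \oo] --> x) -> dense D.
Proof.
move=> Dx O [x Ox] oO; have [u Du ux] := Dx x.
have [n _ un] := ux _ (open_nbhs_nbhs (conj oO Ox)).
by exists (u n); split=> //; apply: un => /=.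
Qed.

Lemma hcvgZ (R : realType) (H : hilbertType R) (a : R[i]) (u : H^nat) (l : H) :
  u n @[n --> \oo] --> l -> a *: u n @[n --> \oo] --> a *: l.
Proof.
move=> /hcvgP ul; apply/hcvgP.
rewrite (_ : (fun n => _) = fun n => normc a * vnorm (u n - l)).
  by rewrite -(mulr0 (normc a)); apply: cvgM => //; exact: cvg_cst.
by apply/funext => n; rewrite -scalerBr vnormZ.
Qed.

(** * Calculus of spectral integrals *)

Section SpectralIntegralTheory.
Context d (S : measurableType d) (R : realType) (H : hilbertType R).
Variable E : spectral_measure S H.
Implicit Types (x y : H) (A B : set S) (f g : S -> R[i]) (Q T : operator H).

Lemma sint_linear g x y (a : R[i]) : borel_measurable g -> (sqint E x g < +oo)%E ->
  (sqint E y g < +oo)%E -> (sqint E (a *: x + y)%R g < +oo)%E ->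
  sint E g (a *: x + y) = a *: sint E g x + sint E g y.
Proof.
move=> mg gx gy gxy; apply: (cvg_unique _ (sint_simple_seq mg gxy)).
  exact: norm_hausdorff.
rewrite (_ : (fun n => _) = fun n => a *: simple_op E (simple_seq g n) x +
    simple_op E (simple_seq g n) y); last first.
  by apply/funext => n; rewrite simple_op_linear//; exact: simple_seq_measurable.
by apply: cvgD; [apply: hcvgZ|]; exact: sint_simple_seq.
Qed.

Lemma sqint_linear x f g (a : R[i]) : borel_measurable f -> borel_measurable g ->
  (sqint E x f < +oo)%E -> (sqint E x g < +oo)%E ->
  (sqint E x (fun t => (a * f t + g t)%R) < +oo)%E.
Proof.
move=> mf mg fx gx; apply: le_lt_trans (sqintD _ _ _ _) _ => //.
  by apply: borel_measurableM => //; exact: borel_measurable_cst.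
rewrite sqint_scale//; apply: lte_add_pinfty; last by rewrite lte_mul_pinfty// lee_fin.
by rewrite lte_mul_pinfty// lte_mul_pinfty// ?lee_fin ?sqr_ge0.
Qed.

Lemma sint_fun_linear x f g (a : R[i]) : borel_measurable f -> borel_measurable g ->
  (sqint E x f < +oo)%E -> (sqint E x g < +oo)%E ->
  sint E (fun t => a * f t + g t) x = a *: sint E f x + sint E g x.
Proof.
move=> mf mg fx gx.
have mc : borel_measurable (cst a : S -> R[i]) by exact: borel_measurable_cst.
have maf : borel_measurable (fun t => a * f t) by exact: borel_measurableM.
have m : borel_measurable (fun t => a * f t + g t) by exact: borel_measurableD.
have sf n : simple_measurable (simple_seq f n) by exact: simple_seq_measurable.
have sg n : simple_measurable (simple_seq g n) by exact: simple_seq_measurable.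
(* The combination of the two canonical sequences is not the canonical sequence of a f + g;
   independence of the sequence makes it usable. *)
pose u n := simple_scale a (simple_seq f n) ++ simple_seq g n.
have [_ cf] := simple_seq_approximates mf fx; have [_ cg] := simple_seq_approximates mg gx.
have mdf n : borel_measurable (fun t => simple_fun (simple_seq f n) t - f t).
  by apply: borel_measurableB => //; exact: borel_measurable_simple.
have mdg n : borel_measurable (fun t => simple_fun (simple_seq g n) t - g t).
  by apply: borel_measurableB => //; exact: borel_measurable_simple.
have au : approximates E x u (fun t => a * f t + g t).
  split=> [n|]; first by apply: simple_measurable_cat => //; exact: simple_measurable_scale.
  pose b n := (2%:E * ((normc a ^+ 2)%:E * sqint E x (fun t => (simple_fun (simple_seq f n) t - f t)%R))
    + 2%:E * sqint E x (fun t => (simple_fun (simple_seq g n) t - g t)%R))%E.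
  apply: (@squeeze_cvge _ _ _ _ (cst 0%E) _ b).
  - apply: nearW => n; rewrite sqint_ge0/=.
    rewrite (_ : (fun t => _) = (fun t => a * (simple_fun (simple_seq f n) t - f t) +
        (simple_fun (simple_seq g n) t - g t))); last first.
      by apply/funext => t; rewrite simple_fun_cat simple_fun_scale; ring.
    apply: le_trans (sqintD _ _ _ _) _ => //; first exact: borel_measurableM.
    by rewrite sqint_scale.
  - exact: cvg_cst.
  - rewrite -[X in _ --> X](_ : (2%:E * ((normc a ^+ 2)%:E * 0) + 2%:E * 0 = 0)%E); last by rewrite !mule0 adde0.
    apply: cvgeD; first by rewrite !mule0.
      by apply: cvgeZl => //; apply: cvgeZl.
    by apply: cvgeZl.
apply: (cvg_unique _ (sint_cvg m _ au)); first exact: norm_hausdorff.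
- exact: sqint_linear.
- rewrite (_ : (fun n => _) = fun n => a *: simple_op E (simple_seq f n) x +
      simple_op E (simple_seq g n) x); last first.
    by apply/funext => n; rewrite simple_op_cat simple_op_scale.
  by apply: cvgD; [apply: hcvgZ|]; exact: sint_simple_seq.
Qed.

(** Fatou's lemma: a uniform bound on the approximating vectors puts [y] in the domain of J_g. This
    is how membership in a domain is obtained when no domination is at hand. *)
Lemma sqint_bound y g (C : R) : borel_measurable g ->
  (forall n, vnorm (simple_op E (simple_seq g n) y) ^+ 2 <= C) ->
  (sqint E y g <= C%:E)%E.
Proof.
move=> mg hC; have ms n : simple_measurable (simple_seq g n) by exact: simple_seq_measurable.
have m2 n : measurable_fun setT (fun t => (normc (simple_fun (simple_seq g n) t) ^+ 2)%:E).
  by apply: measurable_sq; exact: borel_measurable_simple.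
have := @fatou _ _ _ (vector_measure E y) setT measurableT _ m2.
have p0 : forall n t, setT t -> (0 <= (normc (simple_fun (simple_seq g n) t) ^+ 2)%:E)%E.
  by move=> n t _; rewrite lee_fin sqr_ge0.
move=> /(_ p0); rewrite [X in (X <= _)%E -> _](_ : _ = sqint E y g); last first.
  apply: eq_integral => t _.
  have ct : (normc (simple_fun (simple_seq g n) t) ^+ 2)%:E @[n --> \oo] --> (normc (g t) ^+ 2)%:E.
    exact: simple_seq_cvg2.
  by rewrite is_cvg_limn_einfE ?(cvg_lim _ ct)//; apply/cvg_ex; eexists; exact: ct.
move=> /le_trans; apply; rewrite limn_einf_lim; apply: lime_le; first exact: is_cvg_einfs.
apply: nearW => n; apply: le_trans (ereal_inf_lbound _) _; first by exists n => //=.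
by rewrite [X in (X <= _)%E]sqint_simple// lee_fin.
Qed.

(** Commutation is asked only for preimages under [g], so the condition also makes sense relative to
    a sub-sigma-algebra for which [g] is measurable. *)
Definition commutes_with_sets (Q : operator H) g : Prop :=
  forall B : set (complexB R), measurable B -> forall x, Q (E (g @^-1` B) x) = E (g @^-1` B) (Q x).

Lemma bounded_sum Q (s : seq (R[i] * set S)) x : bounded_operator Q ->
  (forall p, p \in s -> Q (E p.2 x) = E p.2 (Q x)) ->
  Q (simple_op E s x) = simple_op E s (Q x).
Proof.
move=> bQ; have dQ := bounded_domE bQ.
elim: s => [|p s IHs] h; first by rewrite !simple_op_nil app0.
rewrite !simple_op_cons appD// appZ// h ?inE ?eqxx// IHs// => q qs.
by apply: h; rewrite inE qs orbT.
Qed.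

Lemma simple_seq_commute Q g n x : bounded_operator Q -> commutes_with_sets Q g ->
  Q (simple_op E (simple_seq g n) x) = simple_op E (simple_seq g n) (Q x).
Proof.
move=> bQ cQ; apply: bounded_sum => // _ /mapP[p pc ->] /=; apply: cQ.
exact: complex_seq_measurable pc.
Qed.

(** Q commutes with each approximant, since its sets are preimages under [g]. The approximants at Q
    x are thus bounded by M times those at x, Fatou puts Q x in the domain, and the limit gives the
    equality. *)
Lemma sint_commute Q g x : bounded_operator Q -> borel_measurable g -> commutes_with_sets Q g ->
  (sqint E x g < +oo)%E -> (sqint E (Q x) g < +oo)%E /\ sint E g (Q x) = Q (sint E g x).
Proof.
move=> bQ mg cQ gx; have [M M0 QM] := bounded_vnorm bQ.
have fgx : sqint E x g \is a fin_num by rewrite ge0_fin_numE// sqint_ge0.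
have gQx : (sqint E (Q x) g < +oo)%E.
  apply: le_lt_trans (ltry (M ^+ 2 * fine (sqint E x g))).
  apply: sqint_bound => // n; rewrite -simple_seq_commute//.
  apply: le_trans (_ : (M * vnorm (simple_op E (simple_seq g n) x)) ^+ 2 <= _).
    by rewrite lerXn2r ?nnegrE ?mulr_ge0 ?vnorm_ge0.
  rewrite exprMn ler_wpM2l ?sqr_ge0// -lee_fin fineK// -sqint_simple; last exact: simple_seq_measurable.
  apply: sqint_le => //; last exact: simple_seq_le.
  by apply: borel_measurable_simple; exact: simple_seq_measurable.
split=> //; apply: (cvg_unique _ (sint_simple_seq mg gQx)); first exact: norm_hausdorff.
rewrite (_ : (fun n => _) = fun n => Q (simple_op E (simple_seq g n) x)).
  by apply: bounded_cvg => //; exact: sint_simple_seq.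
by apply/funext => n; rewrite simple_seq_commute.
Qed.

Lemma sint_spectral A g x : measurable A -> borel_measurable g -> (sqint E x g < +oo)%E ->
  (sqint E (E A x) g < +oo)%E /\ sint E g (E A x) = E A (sint E g x).
Proof.
move=> mA mg gx; apply: sint_commute => //; first exact: spectral_bounded.
move=> B mB y; apply: spectral_comm => //.
by rewrite -[X in measurable X]setTI; exact: mg.
Qed.

Lemma borel_measurable_indicM A g : measurable A -> borel_measurable g ->
  borel_measurable (fun t => (\1_A t)%:C * g t).
Proof.
move=> mA mg; apply: borel_measurableM => //.
by apply: borel_measurable_real; exact: measurable_indic.
Qed.

Lemma normc_indicM A z (t : S) : normc ((\1_A t)%:C * z : R[i]) <= normc z.
Proof.
by rewrite normcM normc_real indicE ger0_norm ?ler0n// ler_piMl ?normc_ge0//; case: (_ \in _).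
Qed.

Lemma sint_indicM A g x : measurable A -> borel_measurable g -> (sqint E x g < +oo)%E ->
  (sqint E x (fun t => (\1_A t)%:C * g t)%R < +oo)%E /\
  sint E (fun t => (\1_A t)%:C * g t) x = E A (sint E g x).
Proof.
move=> mA mg gx; have mAg := borel_measurable_indicM mA mg.
have Agx : (sqint E x (fun t => (\1_A t)%:C * g t)%R < +oo)%E.
  by apply: le_lt_trans (sqint_le _ _ _ _ _) gx => // t; exact: normc_indicM.
split=> //.
have sg n : simple_measurable (simple_seq g n) by exact: simple_seq_measurable.
have sA : simple_measurable [:: (1 : R[i], A)] by move=> p; rewrite inE => /eqP ->.
have au : approximates E x (fun n => simple_mul [:: (1, A)] (simple_seq g n))
    (fun t => (\1_A t)%:C * g t).
  split=> [n|]; first exact: simple_measurable_mul.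
  have [_ cg] := simple_seq_approximates mg gx.
  apply: (@squeeze_cvge _ _ _ _ (cst 0%E) _
    (fun n => sqint E x (fun t => (simple_fun (simple_seq g n) t - g t)%R))) => //.
    apply: nearW => n; rewrite sqint_ge0/=.
    rewrite (_ : (fun t => _) = fun t => (\1_A t)%:C * (simple_fun (simple_seq g n) t - g t)).
      apply: sqint_le => [||t]; last exact: normc_indicM.
        apply: borel_measurable_indicM => //.
        by apply: borel_measurableB => //; exact: borel_measurable_simple.
      by apply: borel_measurableB => //; exact: borel_measurable_simple.
    apply/funext => t; rewrite simple_fun_mul simple_fun_cons simple_fun_nil mul1r addr0.
    by rewrite mulrBr.
  exact: cvg_cst.
apply: (cvg_unique _ (sint_cvg mAg _ au)) => //.
rewrite (_ : (fun n => _) = fun n => E A (simple_op E (simple_seq g n) x)).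
  by apply: bounded_cvg; [exact: spectral_bounded|exact: sint_simple_seq].
apply/funext => n; rewrite simple_op_mul// simple_op_cons simple_op_nil addr0.
by rewrite scale1r.
Qed.

Lemma sint1 x : (sqint E x (cst 1%R) < +oo)%E /\ sint E (cst 1) x = x.
Proof.
have s1 : simple_measurable [:: (1 : R[i], setT : set S)].
  by move=> p; rewrite inE => /eqP ->; exact: measurableT.
have f1 : simple_fun [:: (1 : R[i], setT : set S)] = cst 1.
  by apply/funext => t; rewrite simple_fun_cons simple_fun_nil indicT/= mul1r addr0.
have o1 : simple_op E [:: (1 : R[i], setT : set S)] x = x.
  by rewrite simple_op_cons simple_op_nil spectral_setT scale1r addr0.
have q1 : (sqint E x (cst 1%R) < +oo)%E by rewrite -f1 sqint_simple// o1 ltry.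
split=> //.
apply: (cvg_unique _ (@sint_cvg _ _ _ _ _ _ _ (fun=> [:: (1, setT)]) (borel_measurable_cst _) q1 _)); first exact: norm_hausdorff.
  split=> //; rewrite [X in X @ _](_ : _ = cst 0%E); first exact: cvg_cst.
  apply/funext => n; rewrite f1 /sqint; under eq_integral do rewrite subrr normc0 expr0n.
  by rewrite integral0.
by rewrite o1; exact: cvg_cst.
Qed.

(** The vector measure of E A x is that of [x] restricted to [A]. *)
Lemma ge0_integral_spectral A x (f : S -> \bar R) : measurable A -> measurable_fun setT f ->
  (forall t, 0 <= f t)%E ->
  (\int[vector_measure E (E A x)]_t f t = \int[vector_measure E x]_(t in A) f t)%E.
Proof.
move=> mA mf f0; rewrite (@ge0_negligible_integral _ _ _ _ _ (~` A)) //=.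
- rewrite setTD setCK; apply: eq_measure_integral => B mB BA.
  rewrite /= vector_measure_spectral//; congr vector_measure; exact: setIidr.
- exact: measurableC.
- rewrite vector_measure_spectral//; last exact: measurableC.
  by rewrite setICr measure0.
Qed.

Lemma sqint_spectral A g x : measurable A -> borel_measurable g ->
  sqint E (E A x) g = (\int[vector_measure E x]_(t in A) (normc (g t) ^+ 2)%:E)%E.
Proof.
move=> mA mg; apply: ge0_integral_spectral => //; first exact: measurable_sq.
by move=> t; rewrite lee_fin sqr_ge0.
Qed.

Lemma sqint_le_cst A g x (r : R) : measurable A -> borel_measurable g -> 0 <= r ->
  (forall t, A t -> normc (g t) <= r) ->
  (sqint E (E A x) g <= (r ^+ 2 * vnorm (E A x) ^+ 2)%:E)%E.
Proof.
move=> mA mg r0 gr; rewrite sqint_spectral//.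
apply: le_trans (_ : (\int[vector_measure E x]_(t in A) (cst (r ^+ 2)%:E t) <= _)%E).
  apply: ge0_le_integral => //.
  - by move=> t _; rewrite lee_fin sqr_ge0.
  - by apply: measurable_funTS; exact: measurable_sq.
  - by move=> t At; rewrite lee_fin lerXn2r ?nnegrE ?normc_ge0// gr.
by rewrite integral_cst// [X in (_ * X)%E]vector_measureE.
Qed.

Lemma sqint_ge_cst A g x (r : R) : measurable A -> borel_measurable g -> 0 <= r ->
  (forall t, A t -> r <= normc (g t)) ->
  ((r ^+ 2 * vnorm (E A x) ^+ 2)%:E <= sqint E (E A x) g)%E.
Proof.
move=> mA mg r0 gr; rewrite sqint_spectral//.
apply: le_trans (_ : (_ <= \int[vector_measure E x]_(t in A) (cst (r ^+ 2)%:E t))%E) _.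
  by rewrite integral_cst// [X in (_ * X)%E]vector_measureE.
apply: ge0_le_integral => //.
- by move=> t _; rewrite lee_fin sqr_ge0.
- by apply: measurable_funTS; exact: measurable_sq.
- by move=> t At; rewrite lee_fin lerXn2r ?nnegrE ?normc_ge0// gr.
Qed.

Lemma sqint_sup (F : (set S)^nat) g x (C : R) : borel_measurable g ->
  (forall n, measurable (F n)) -> nondecreasing_seq F -> \bigcup_n F n = setT ->
  (forall n, (sqint E (E (F n) x) g <= C%:E)%E) -> (sqint E x g <= C%:E)%E.
Proof.
move=> mg mF ndF FT hC.
have := @ge0_nondecreasing_set_cvg_integral _ _ _ F (fun t => (normc (g t) ^+ 2)%:E)
  (vector_measure E x) ndF mF.
rewrite FT => h; apply: (@cvge_le _ _ _ _ _ _ _ _ (h _ _)) => //.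
- by apply: nearW => n; rewrite -sqint_spectral.
- by move=> i; apply: measurable_funTS; exact: measurable_sq.
- by move=> i t _; rewrite lee_fin sqr_ge0.
Qed.

(** Truncation sets: vectors E (level g n) x lie in the domain of J_g and tend to [x]. *)
Definition level g n : set S := [set t | normc (g t) <= n%:R].

Lemma measurable_le_normc g (c : R[i]) (r : R) : borel_measurable g ->
  measurable [set t | normc (g t - c) <= r].
Proof.
move=> mg; have [r0|r0] := ltP r 0.
  rewrite (_ : [set _ | _] = set0)//; apply/seteqP; split=> t //=.
  by have := normc_ge0 (g t - c) => ? ?; lra.
have := measurable_normc2 (borel_measurableB mg (borel_measurable_cst c)).
move=> /(_ measurableT `]-oo, r ^+ 2]%classic (measurable_itv _)); rewrite setTI.
congr measurable; apply/seteqP; split=> t; rewrite /= in_itv/= ler_pXn2r ?nnegrE ?normc_ge0//.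
Qed.

Lemma measurable_level g n : borel_measurable g -> measurable (level g n).
Proof.
move=> mg; have := measurable_le_normc 0 n%:R mg.
by congr measurable; apply/seteqP; split=> t; rewrite /level /= subr0.
Qed.

Lemma level_nd g : nondecreasing_seq (level g).
Proof.
by move=> m n mn; apply/subsetPset => t /= /le_trans; apply; rewrite ler_nat.
Qed.

Lemma level_cup g : \bigcup_n level g n = setT.
Proof.
apply/seteqP; split=> // t _; exists (Num.bound (normc (g t))) => //.
by rewrite /level/= ltW// archi_boundP// normc_ge0.
Qed.

Lemma level_cvg g x : borel_measurable g -> E (level g n) x @[n --> \oo] --> x.
Proof.
move=> mg; rewrite -[X in _ --> X](spectral_setT E) -(level_cup g).
by apply: spectral_cvg; [move=> n; exact: measurable_level|exact: level_nd].
Qed.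

Lemma sqint_level g x n : borel_measurable g -> (sqint E (E (level g n) x) g < +oo)%E.
Proof.
move=> mg; apply: le_lt_trans (@sqint_le_cst _ _ _ n%:R _ mg _ _) (ltry _) => //.
exact: measurable_level.
Qed.

Lemma sqint_dense g : borel_measurable g -> dense [set x | (sqint E x g < +oo)%E].
Proof.
move=> mg; apply: dense_cvg => x; exists (fun n => E (level g n) x).
  by move=> n; exact: sqint_level.
exact: level_cvg.
Qed.

(** Working form of [is_spectral_integral] for an everywhere defined Borel [g]: the values are given
    as limits instead of through the quadratic form. *)
Definition is_sint g T : Prop :=
  dom T = [set x | (sqint E x g < +oo)%E] /\ forall x, dom T x -> T x = sint E g x.

(** Polarization on a dense domain: expanding the form of T - T' at a y + x for a = 1 and for a the
    imaginary unit annihilates both mixed terms. *)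
Lemma quadratic_form_eq0 T T' : dom T = dom T' -> dense (dom T) ->
  (forall x, dom T x -> inner x (T x) = inner x (T' x)) -> forall x, dom T x -> T x = T' x.
Proof.
move=> DD dT h; pose D x := T x - T' x.
have D0 x : dom T x -> inner x (D x) = 0 by move=> Tx; rewrite innerBr h// subrr.
have Dlin x y (a : R[i]) : dom T x -> dom T y -> D (a *: y + x) = a *: D y + D x.
  move=> Tx Ty; have T'x : dom T' x by rewrite -DD. have T'y : dom T' y by rewrite -DD.
  by rewrite /D !app_linear// opprD scalerBr addrACA.
have pol x y : dom T x -> dom T y -> inner y (D x) = 0.
  move=> Tx Ty.
  have k (a : R[i]) : a * inner x (D y) + a^* * inner y (D x) = 0.
    have := D0 _ (dom_linear a Ty Tx); rewrite Dlin//.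
    rewrite innerDr !innerDl !innerZr !innerZl !D0// !mulr0 add0r addr0.
    by [].
  have := k 1; rewrite rmorph1 !mul1r => k1.
  have := k 'i; rewrite conjCi => ki.
  have : 'i * (inner x (D y) + inner y (D x)) + ('i * inner x (D y) + - 'i * inner y (D x)) = 
     2 * 'i * inner x (D y) by ring.
  rewrite k1 ki mulr0 addr0 => /esym/eqP; rewrite !mulf_eq0 pnatr_eq0/=.
  rewrite -[_ == 0 :> R[i]]/(_ == _) => h0.
  have xy0 : inner x (D y) = 0.
    by move: h0; rewrite orbC => /orP[/eqP//|]; rewrite eq_complex/= oner_eq0 andbF.
  by move: k1; rewrite xy0 add0r.
move=> x Tx; apply/eqP; rewrite -subr_eq0; apply/eqP.
apply: (@inner_all0 _ _ (D x) _ dT) => y Ty.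
by rewrite inner_conj pol// rmorph0.
Qed.

Lemma is_sintP g T : borel_measurable g ->
  is_spectral_integral E (fun t => Some (g t)) T <-> is_sint g T.
Proof.
move=> mg; have qE x : (\int[vector_measure E x]_s (normc (Defs.total (fun t => Some (g t)) s) ^+ 2)%:E)%E = sqint E x g by [].
split=> [[dT hT]|[dT hT]]; last first.
  by split=> // x Tx; rewrite hT// sint_inner//; move: Tx; rewrite dT.
have dT' : dom T = [set x | (sqint E x g < +oo)%E] by [].
split=> //.
have out x : exists y, (dom T x -> y = sint E g x) /\ (~ dom T x -> y = 0).
  by case: (pselect (dom T x)) => Tx; [exists (sint E g x)|exists 0].
have [F FP] := choice out.
have Flin (a : R[i]) x y : dom T x -> dom T y -> F (a *: x + y) = a *: F x + F y.
  move=> Tx Ty; have Txy := dom_linear a Tx Ty.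
  rewrite (FP _).1// (FP x).1// (FP y).1// sint_linear//; [move: Tx|move: Ty|move: Txy]; by rewrite dT'.
(* The values [sint E g x] are packaged as an operator on [dom T], so that polarization can compare
   it with [T]. *)
pose T' := @Operator _ H (dom T) F (dom0 T) (@dom_linear _ _ T) Flin (fun x => (FP x).2).
move=> x Tx; rewrite -(FP x).1//.
apply: (@quadratic_form_eq0 T T') => //; first by rewrite dT'; exact: sqint_dense.
move=> y Ty; rewrite /= (FP y).1// hT// sint_inner//.
by move: Ty; rewrite dT'.
Qed.

Import HBNNSimple.

(** The functions are not assumed measurable. The integral is a supremum over simple functions
    below; multiplying such a function by the indicator of the complement of [N] keeps its integral
    and puts it below [g]. *)
Lemma ge0_integral_off_null x N (f g : S -> \bar R) : measurable N ->
  vector_measure E x N = 0%E -> (forall t, 0 <= f t)%E -> (forall t, 0 <= g t)%E ->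
  (forall t, ~ N t -> f t = g t) ->
  (\int[vector_measure E x]_t f t <= \int[vector_measure E x]_t g t)%E.
Proof.
move=> mN N0 f0 g0 fg; rewrite !ge0_integralTE//; apply: ge_ereal_sup => _ [h hf <-].
have mNc := measurableC mN.
pose h' := proj_nnsfun h mNc.
have h'E t : h' t = h t * \1_(~` N) t by [].
apply: (@le_trans _ _ (sintegral (vector_measure E x) h')); last first.
  apply: ereal_sup_ubound; exists h' => // t; rewrite h'E indicE.
  case: (boolP (t \in ~` N)) => [/set_mem Nt|_]; last by rewrite mulr0.
  by rewrite mulr1 -fg.
rewrite -!integralT_nnsfun.
have -> // : (\int[vector_measure E x]_t (h t)%:E = \int[vector_measure E x]_t (h' t)%:E)%E.
apply: ae_eq_integral => //; [exact/measurable_EFinP|exact/measurable_EFinP|].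
exists N; split=> // t /= nt; apply: contrapT => Nt; apply: nt => _.
by congr EFin; change (h t = h t * \1_(~` N) t); rewrite indicE mem_set// mulr1.
Qed.

Lemma integral_off_null x N (f g : S -> \bar R) : measurable N ->
  vector_measure E x N = 0%E -> (forall t, ~ N t -> f t = g t) ->
  (\int[vector_measure E x]_t f t = \int[vector_measure E x]_t g t)%E.
Proof.
move=> mN N0 fg; rewrite [LHS]integralE [RHS]integralE.
by congr (_ - _)%E; apply/eqP; rewrite eq_le; apply/andP; split;
  apply: (ge0_integral_off_null mN N0) => // t Nt; rewrite ?funeposE ?funenegE fg.
Qed.

Lemma is_spectral_integral_off_null (f f' : S -> option R[i]) N T : E_null E N ->
  (forall t, ~ N t -> f t = f' t) ->
  is_spectral_integral E f T -> is_spectral_integral E f' T.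
Proof.
move=> [mN N0] ff' [dT hT].
have Nx x : vector_measure E x N = 0%E by apply/vector_measure_eq0.
have eq (phi : R[i] -> \bar R) x : (\int[vector_measure E x]_t phi (Defs.total f t) =
    \int[vector_measure E x]_t phi (Defs.total f' t))%E.
  by apply: (integral_off_null mN (Nx x)) => t Nt; rewrite /Defs.total ff'.
split=> [|x Tx]; first by rewrite dT; apply/funext => x; rewrite /= (eq (fun z => (normc z ^+ 2)%:E)).
rewrite hT//; congr (_ +i* _); rewrite /Rintegral.
  by rewrite (eq (fun z => (complex.Re z)%:E)).
by rewrite (eq (fun z => (complex.Im z)%:E)).
Qed.

Lemma E_measurable_is_sint (f : S -> option R[i]) g N T : borel_measurable g ->
  E_null E N -> (forall t, ~ N t -> f t = Some (g t)) ->
  is_spectral_integral E f T <-> is_sint g T.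
Proof.
move=> mg N0 fg; rewrite -is_sintP//.
by split; apply: is_spectral_integral_off_null N0 _ => t /fg.
Qed.

End SpectralIntegralTheory.

Lemma geometric_eq0 (R : realType) (a r rho C : R) : 0 <= a -> 0 <= r < rho ->
  (forall n, rho ^+ n * a <= C * r ^+ n) -> a = 0.
Proof.
move=> a0 /andP[r0 rr] h; have rho0 : 0 < rho by exact: le_lt_trans rr.
have h' n : a <= C * (r / rho) ^+ n.
  rewrite expr_div_n mulrA ler_pdivlMr ?exprn_gt0// mulrC; exact: h.
apply/eqP; rewrite eq_le a0 andbT.
have c : C * (r / rho) ^+ n @[n --> \oo] --> (0 : R).
  rewrite -(mulr0 C); apply: cvgM; first exact: cvg_cst.
  by apply: cvg_expr; rewrite ger0_norm ?ltr_pdivrMr ?mul1r// divr_ge0// ltW.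
by apply: (@ler_cvg_to _ _ _ _ (cst a) _ _ _ (cvg_cst _) c); apply: nearW.
Qed.

(** * Fuglede's theorem *)

Section Fuglede.
Context d (S : measurableType d) (R : realType) (H : hilbertType R).
Variable E : spectral_measure S H.
Implicit Types (x y : H) (A B : set S) (f g : S -> R[i]) (Q T : operator H).

Lemma sqint_shift g T (c : R[i]) u : borel_measurable g -> is_sint E g T -> dom T u ->
  sqint E u (fun t => g t - c)%R = (vnorm (T u - c *: u) ^+ 2)%:E.
Proof.
move=> mg [dT hT] Tu; have [q1 s1] := sint1 E u.
have gu : (sqint E u g < +oo)%E by move: Tu; rewrite dT.
have m1 : borel_measurable (cst 1 : S -> R[i]) by exact: borel_measurable_cst.
have -> : (fun t => g t - c) = (fun t => - c * (cst 1 t) + g t).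
  by apply/funext => t; rewrite /cst mulr1 addrC.
rewrite sint_norm; last exact: sqint_linear.
  by rewrite sint_fun_linear// s1 hT// scaleNr addrC.
apply: borel_measurableD => //; apply: borel_measurableM => //.
exact: borel_measurable_cst.
Qed.

Definition range_invariant Q A : Prop := forall x, E A x = x -> E A (Q x) = Q x.

Lemma disc_range_invariant g T Q (c : R[i]) (r : R) : borel_measurable g -> is_sint E g T ->
  bounded_operator Q -> commutes T Q -> 0 <= r ->
  range_invariant Q [set t | normc (g t - c) <= r].
Proof.
move=> mg iT bQ cTQ r0; set A := [set t | _]; move=> x Ax.
have [dT hT] := iT; have [M M0 QM] := bounded_vnorm bQ.
have mA : measurable A by exact: measurable_le_normc.
have mgc : borel_measurable (fun t => g t - c).
  by apply: borel_measurableB => //; exact: borel_measurable_cst.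
(* On the disc |g| <= r + |c|, so the range of E A lies in the domain of T and all iterates of T - c
   are defined on it. *)
have domA u : E A u = u -> dom T u.
  move=> Au; rewrite dT/= -Au.
  apply: le_lt_trans (@sqint_le_cst _ _ _ _ _ _ _ _ (r + normc c) mA mg _ _) (ltry _).
    by rewrite addr_ge0 ?normc_ge0.
  move=> t At; rewrite -[g t](subrK c); apply: le_trans (le_normcD _ _) _.
  by rewrite lerD2r.
pose X n := iter n (fun u => T u - c *: u) x.
have AX n : E A (X n) = X n.
  elim: n => //= n IH; rewrite spectralB// spectralZ// IH; congr (_ - _).
  have Xd := domA _ IH; rewrite hT//.
  by rewrite -[in RHS]IH (sint_spectral _ _ _).2//; move: Xd; rewrite dT.
have dX n : dom T (X n) by exact: domA.
have nX n : vnorm (X n) <= r ^+ n * vnorm x.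
  elim: n => [|n IH]; first by rewrite mul1r.
  apply: le_trans (_ : r * vnorm (X n) <= _); last first.
    by rewrite exprS -mulrA ler_wpM2l.
  rewrite -(@ler_pXn2r _ 2) ?nnegrE ?mulr_ge0 ?vnorm_ge0// exprMn -lee_fin.
  rewrite -(sqint_shift c mg iT (dX n)) -[in X in sqint _ X](AX n) -[in leRHS](AX n).
  exact: sqint_le_cst.
have dY n : dom T (Q (X n)) by have [] := cTQ _ (dX n).
have Y1 n : Q (X n.+1) = T (Q (X n)) - c *: Q (X n).
  have [_ e] := cTQ _ (dX n); rewrite -e /= appB ?appZ//; exact: bounded_domE.
(* Where |g - c| exceeds rho > r, T - c expands norms by at least rho, whereas (T - c)^n (Q x) = Q
   ((T - c)^n x) is bounded by M r^n |x|; the component there must vanish. *)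
have outer (k : nat) : E (~` [set t | normc (g t - c) <= r + k.+1%:R^-1]) (Q x) = 0.
  set rho := r + _; set B := ~` _.
  have rr : r < rho by rewrite ltrDl invr_gt0.
  have mB : measurable B by apply: measurableC; exact: measurable_le_normc.
  have step n : rho * vnorm (E B (Q (X n))) <= vnorm (E B (Q (X n.+1))).
    have gY : (sqint E (Q (X n)) g < +oo)%E by have := dY n; rewrite dT.
    have [gB sB] := sint_spectral mB mg gY.
    have dB : dom T (E B (Q (X n))) by rewrite dT.
    rewrite -(@ler_pXn2r _ 2) ?nnegrE ?mulr_ge0 ?vnorm_ge0//; last by rewrite (le_trans r0)// ltW.
    rewrite exprMn -lee_fin.
    have -> : E B (Q (X n.+1)) = T (E B (Q (X n))) - c *: E B (Q (X n)).
      by rewrite Y1 spectralB// spectralZ// [T (E B _)]hT// sB hT.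
    rewrite -(sqint_shift c mg iT dB); apply: sqint_ge_cst => //.
      by rewrite (le_trans r0)// ltW.
    by move=> t /= /negP; rewrite -ltNge => /ltW.
  apply: vnorm0_eq0; apply: (@geometric_eq0 _ _ r rho (M * vnorm x)); rewrite ?vnorm_ge0 ?r0//.
  move=> n; apply: le_trans (_ : vnorm (E B (Q (X n))) <= _).
    elim: n => [|n IH]; first by rewrite mul1r.
    apply: le_trans (step n); rewrite exprS -mulrA ler_wpM2l//.
    by rewrite (le_trans r0)// ltW.
  apply: le_trans (spectral_contract _ _ mB) _; apply: le_trans (QM _) _.
  by rewrite -mulrA [_ * r ^+ n]mulrC ler_wpM2l.
have mF (k : nat) : measurable (~` [set t | normc (g t - c) <= r + k.+1%:R^-1]).
  by apply: measurableC; exact: measurable_le_normc.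
have : E (~` A) (Q x) = 0.
  rewrite (_ : ~` A = \bigcup_k (~` [set t | normc (g t - c) <= r + k.+1%:R^-1])); last first.
    apply/seteqP; split=> t /=; last first.
      by move=> [k _ /= h] At; apply: h; apply: le_trans At _; rewrite lerDl invr_ge0.
    move=> /negP; rewrite -ltNge => h.
    have h0 : 0 < normc (g t - c) - r by rewrite subr_gt0.
    have [k _ /(_ k (leqnn k))/= hk] := near_infty_natSinv_lt (PosNum h0).
    by exists k => //=; apply/negP; rewrite -ltNge -ltrBrDl.
  have ndF : nondecreasing_seq (fun k : nat => ~` [set t | normc (g t - c) <= r + k.+1%:R^-1]).
    move=> m n mn; apply/subsetPset => t /= h1 h2; apply: h1; apply: le_trans h2 _.
    by rewrite lerD2l lef_pV2 ?posrE// ler_nat.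
  apply: (cvg_unique _ (@spectral_cvg _ _ _ _ E _ (Q x) mF ndF)); first exact: norm_hausdorff.
  rewrite /= (_ : (fun n => _) = cst 0); first exact: cvg_cst.
  by apply/funext => n; exact: outer.
by rewrite spectralC// => /eqP; rewrite subr_eq0 => /eqP.
Qed.

Lemma range_invariantU Q A B : bounded_operator Q -> measurable A -> measurable B ->
  range_invariant Q A -> range_invariant Q B -> range_invariant Q (A `|` B).
Proof.
move=> bQ mA mB iA iB x ABx; have dQ := bounded_domE bQ.
have mU : measurable (A `|` B) by exact: measurableU.
have mD : measurable (B `\` A) by exact: measurableD.
have xE : x = E A x + E (B `\` A) x.
  rewrite -spectralU//; first by rewrite setUDr setDv setD0.
  by apply/seteqP; split=> // t [At [_ nAt]]; exact: nAt.
rewrite {}xE appD// spectralD//; congr (_ + _).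
  by rewrite -(iA (E A x)) ?spectral_idem// spectral_subr//; exact: subsetUl.
have := iB (E (B `\` A) x); rewrite spectral_subr// => /(_ erefl) <-.
by rewrite spectral_subr//; exact: subsetUr.
Qed.

Lemma range_invariant_bigcup Q (F : (set S)^nat) : bounded_operator Q ->
  (forall n, measurable (F n)) -> (forall n, range_invariant Q (F n)) ->
  range_invariant Q (\bigcup_n F n).
Proof.
move=> bQ mF iF x Fx; pose G n := \big[setU/set0]_(i < n) F i.
have mG n : measurable (G n) by exact: bigsetU_measurable.
have iG n : range_invariant Q (G n).
  elim: n => [|n IH].
    by rewrite /G big_ord0 => u; rewrite spectral_val0 => <-; rewrite app0 spectral_val0.
  by rewrite /G big_ord_recr/=; apply: range_invariantU => //; exact: mG.
have GU : \bigcup_n F n = \bigcup_n G n.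
  rewrite -bigcup_bigsetU_bigcup; apply/seteqP; split=> t [n _ h]; first by exists n.+1.
  by exists n => //; rewrite /= big_ord_recr/=; left.
have mU : measurable (\bigcup_n G n) by exact: bigcupT_measurable.
have ndG : nondecreasing_seq G by move=> m n mn; apply/subsetPset; exact: subset_bigsetU.
rewrite GU in Fx *.
have cx : E (G n) x @[n --> \oo] --> x by rewrite -[X in _ --> X]Fx; exact: spectral_cvg.
have cQx := bounded_cvg bQ cx.
apply: (cvg_unique _ (bounded_cvg (spectral_bounded E mU) cQx)); first exact: norm_hausdorff.
rewrite (_ : (fun n => _) = fun n => Q (E (G n) x))//.
apply/funext => n; rewrite -[in RHS](iG n) ?spectral_idem// -(iG n) ?spectral_idem//.
by rewrite spectral_subr// => t Gt; exists n.
Qed.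

(** The discs used have rational centre and positive rational radius s, with centre farther than r +
    s from c. Codes of no such disc contribute the empty set. *)
Lemma disc_compl g (c : R[i]) (r : R) : exists F : nat -> set S,
  (forall n, F n = set0 \/ exists c' r', 0 <= r' /\ F n = [set t | normc (g t - c') <= r']) /\
  ~` [set t | normc (g t - c) <= r] = \bigcup_n F n.
Proof.
pose D (w : rat * rat * rat) : set S :=
  [set t | r + ratr w.2 < normc (ratr w.1.1 +i* ratr w.1.2 - c) /\ 0 < ratr w.2 :> R /\
     normc (g t - (ratr w.1.1 +i* ratr w.1.2)) <= ratr w.2].
exists (fun n => oapp D set0 (choice.unpickle n)); split.
  move=> n; case: choice.unpickle => [w|] /=; last by left.
  case: (pselect (r + ratr w.2 < normc (ratr w.1.1 +i* ratr w.1.2 - c) /\ 0 < ratr w.2 :> R)) => [[h1 h2]|h].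
    right; exists (ratr w.1.1 +i* ratr w.1.2), (ratr w.2); split; first exact: ltW.
    by apply/seteqP; split=> t; rewrite /D/=; [case=> ? []|].
  by left; apply/seteqP; split=> t // [? [? ?]]; apply: h.
apply/seteqP; split=> t /=.
  move=> /negP; rewrite -ltNge => h; have e0 : 0 < normc (g t - c) - r by rewrite subr_gt0.
  (* With s below half the gap |g t - c| - r, a centre within s of [g t] is still farther than r + s
     from c. *)
  have [s] := @rat_in_itvoo _ 0 ((normc (g t - c) - r) / 2) (divr_gt0 e0 (ltr0n R 2)).
  rewrite in_itv/= => /andP[s0 se].
  have s2 : 0 < ratr s / 2 :> R by rewrite divr_gt0.
  have [p] := @rat_in_itvoo _ (complex.Re (g t)) (complex.Re (g t) + ratr s / 2) ltac:(by rewrite ltrDl).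
  rewrite in_itv/= => /andP[p1 p2].
  have [q] := @rat_in_itvoo _ (complex.Im (g t)) (complex.Im (g t) + ratr s / 2) ltac:(by rewrite ltrDl).
  rewrite in_itv/= => /andP[q1 q2].
  have close : normc (g t - (ratr p +i* ratr q)) <= ratr s.
    apply: le_trans (normc_le_ReIm _) _; rewrite !raddfB/= !ler0_norm; lra.
  exists (choice.pickle (p, q, s)); first exact: I.
  rewrite choice.pickleK; split; last by split.
  have := le_normcD (g t - (ratr p +i* ratr q)) (ratr p +i* ratr q - c).
  rewrite addrA subrK /=; lra.
move=> [n _]; case: choice.unpickle => //= w [h1 [h2 h3]] h4.
have := le_normcD (ratr w.1.1 +i* ratr w.1.2 - g t) (g t - c).
rewrite addrA subrK -[_ - g t]opprB normcN; lra.
Qed.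

(* Fuglede's theorem: commutation with T^* is not needed, because the range of
   E(|g-c|<=r) consists of the vectors on which (T-c)^n grows at most like r^n,
   and the complement of a disc is a countable union of discs. *)
Lemma fuglede g T Q (c : R[i]) (r : R) x : borel_measurable g -> is_sint E g T ->
  bounded_operator Q -> commutes T Q -> 0 <= r ->
  Q (E [set t | normc (g t - c) <= r] x) = E [set t | normc (g t - c) <= r] (Q x).
Proof.
move=> mg iT bQ cTQ r0; set A := [set t | _].
have iA : range_invariant Q A by exact: disc_range_invariant cTQ r0.
have mA : measurable A by exact: measurable_le_normc.
(* Invariance of the range of E A and of the range of its complement together amount to commutation
   with E A. *)
have iAc : range_invariant Q (~` A).
  have [F [hF ->]] := disc_compl g c r.
  apply: range_invariant_bigcup => // n; case: (hF n) => [->|[c' [r' [r'0 ->]]]] //.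
  - exact: measurable_le_normc.
  - by move=> u; rewrite spectral_val0 => <-; rewrite app0 spectral_val0.
  - exact: disc_range_invariant cTQ _.
have dQ := bounded_domE bQ; have mAc := measurableC mA.
have -> : Q x = Q (E A x) + Q (E (~` A) x).
  by rewrite -appD// spectralC// addrC subrK.
rewrite spectralD// -(iAc (E (~` A) x)) ?spectral_idem//.
rewrite [E A (E (~` A) _)]spectralI// setICr spectral_val0 addr0.
by rewrite iA// spectral_idem.
Qed.

End Fuglede.

(** * Separating families of Borel sets in Polish spaces *)

Section Regularity.
Context (R : realType) (M : metricType R) d (S : measurableType d) (rho : S -> M).
Variable mu : {finite_measure set S -> \bar R}.
Local Notation borelM := (<<s @open M >>).
(** Sets of the metric space are measured through their preimages under [rho], so the finite measure
    lives on [S] and its image measure is never formed. *)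
Hypothesis mrho : forall B, borelM B -> measurable (rho @^-1` B).
Implicit Types A B F U K : set M.

Lemma open_mball (x : M) (e : R) : open (ball x e).
Proof.
rewrite openE => z; rewrite ballEmdist/= => xz.
apply/nbhs_ballP; exists (e - mdist x z); first by rewrite /= subr_gt0.
move=> y; rewrite !ballEmdist/= => zy.
by apply: le_lt_trans (metric_triangle x z y) _; rewrite -ltrBrDl.
Qed.

Lemma borel_open U : open U -> borelM U.
Proof. by move=> oU; exact: sub_sigma_algebra. Qed.

Lemma borelC A : borelM A -> borelM (~` A).
Proof. by move=> bA; rewrite -setTD; exact: sigma_algebraCD. Qed.

Lemma borel_closed F : closed F -> borelM F.
Proof. by move=> cF; rewrite -[F]setCK; apply: borelC; apply: borel_open; exact: closed_openC. Qed.

Lemma borel_bigcup (A : (set M)^nat) : (forall n, borelM (A n)) -> borelM (\bigcup_n A n).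
Proof. by move=> bA; exact: sigma_algebra_bigcup. Qed.

Lemma borelU A B : borelM A -> borelM B -> borelM (A `|` B).
Proof.
move=> bA bB; rewrite -bigcup2E; apply: borel_bigcup => -[|[|n]] //=.
exact: sigma_algebra0.
Qed.

Lemma borelI A B : borelM A -> borelM B -> borelM (A `&` B).
Proof.
by move=> bA bB; rewrite -[_ `&` _]setCK setCI; apply: borelC; apply: borelU; exact: borelC.
Qed.

Lemma borelD A B : borelM A -> borelM B -> borelM (A `\` B).
Proof. by move=> bA bB; rewrite setDE; apply: borelI => //; exact: borelC. Qed.

Lemma borel_bigcap (A : (set M)^nat) : (forall n, borelM (A n)) -> borelM (\bigcap_n A n).
Proof.
by move=> bA; rewrite -[X in borelM X]setCK setC_bigcap; apply: borelC; apply: borel_bigcup => n; exact: borelC.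
Qed.

Lemma mu_le (A B : set S) : measurable A -> measurable B -> A `<=` B -> (mu A <= mu B)%E.
Proof. by move=> mA mB AB; apply: le_measure => //; exact: mem_set. Qed.

Lemma small_tail (G : (set M)^nat) (e : R) : (forall n, borelM (G n)) ->
  (forall m n, (m <= n)%N -> G n `<=` G m) -> \bigcap_n G n = set0 -> 0 < e ->
  exists n, (mu (rho @^-1` (G n)) <= e%:E)%E.
Proof.
move=> bG nG G0 e0; have mG n : measurable (rho @^-1` (G n)) by exact: mrho.
have I0 : \bigcap_n (rho @^-1` (G n)) = set0.
  by rewrite -preimage_bigcap G0 preimage_set0.
have := @nonincreasing_cvg_mu _ _ _ mu (fun n => rho @^-1` (G n)).
have fin : (mu (rho @^-1` G 0%N) < +oo)%E by rewrite ltey_eq fin_num_measure.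
rewrite I0 measure0 => /(_ fin mG measurable0) h.
have {h} : mu (rho @^-1` (G n)) @[n --> \oo] --> 0%E.
  by apply: h => m n mn; apply/subsetPset => t; exact: nG mn _.
move=> /fine_cvgP[fn /cvgrPdist_lt/(_ _ e0) h].
have [n [fnn hn]] := filter_ex (filterI fn h).
exists n; move: hn; rewrite /= sub0r normrN => /(le_lt_trans (ler_norm _)) /ltW.
by rewrite -lee_fin fineK.
Qed.

Lemma small_bigcup (F : (set S)^nat) (e : R) : (forall n, measurable (F n)) -> 0 <= e ->
  (forall n, (mu (F n) <= (e / (2 ^ n.+1)%:R)%:E)%E) -> (mu (\bigcup_n F n) <= e%:E)%E.
Proof.
move=> mF e0 h; have mU : measurable (\bigcup_n F n) by exact: bigcupT_measurable.
apply: le_trans (measure_sigma_subadditive mu mF mU (fun _ h => h)) _.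
apply: le_trans (epsilon_trick0 xpredT e0).
by apply: lee_nneseries => n _ //; exact: h.
Qed.

Definition regular B : Prop := forall e : R, 0 < e -> exists F U,
  [/\ closed F, open U, F `<=` B, B `<=` U & (mu (rho @^-1` (U `\` F)) <= e%:E)%E].

Lemma regular_open U : open U -> regular U.
Proof.
(* [F n] consists of the points at distance at least 1/(n+1) from the complement of [U]. *)
move=> oU e e0; pose F (n : nat) := ~` \bigcup_(y in ~` U) ball y (n.+1%:R^-1 : R).
have cF n : closed (F n).
  by apply: open_closedC; apply: bigcup_open => y _; exact: open_mball.
have ball_le (y z : M) m n : (m <= n)%N -> ball y (n.+1%:R^-1 : R) z -> ball y (m.+1%:R^-1 : R) z.
  by move=> mn; apply: le_ball; rewrite lef_pV2 ?posrE// ler_nat.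
have [n hn] : exists n, (mu (rho @^-1` (U `\` F n)) <= e%:E)%E.
  apply: (@small_tail (fun n => U `\` F n)) => //.
  - by move=> n; apply: borelD; [exact: borel_open|exact: borel_closed].
  - move=> m n mn z [Uz /contrapT[y Uy yz]]; split=> // h; apply: h.
    by exists y => //; exact: ball_le mn _.
  - apply/seteqP; split=> // z h; have [Uz _] := h 0%N I.
    have [r /= r0 rU] := (nbhs_ballP _ _).1 (open_nbhs_nbhs (conj oU Uz)).
    have [n _ /(_ n (leqnn n))/= hn] := near_infty_natSinv_lt (PosNum r0).
    have [_ /contrapT[y Uy yz]] := h n I.
    by apply: Uy; apply: rU; apply: ball_sym; apply: le_ball yz; exact: ltW.
exists (F n), U; split=> // z Fz; apply: contrapT => Uz; apply: Fz.
by exists z => //; exact: ballxx.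
Qed.

Lemma regularC B : regular B -> regular (~` B).
Proof.
move=> rB e e0; have [F [U [cF oU FB BU h]]] := rB e e0.
exists (~` U), (~` F); split; [exact: open_closedC|exact: closed_openC|exact: subsetC|exact: subsetC|].
by rewrite setDE setCK setIC -setDE.
Qed.

Lemma regular_bigcup (B : (set M)^nat) : (forall n, regular (B n)) -> regular (\bigcup_n B n).
Proof.
move=> rB e e0; have e2 : 0 < e / 2 by rewrite divr_gt0.
have en n : 0 < e / 2 / (2 ^ n.+1)%:R by rewrite divr_gt0// ltr0n expn_gt0.
have /choice[F hF] := fun n => rB n _ (en n).
have /choice[U hU] := hF.
have cF n : closed (F n) by case: (hU n).
have oU n : open (U n) by case: (hU n).
(* A countable union of closed sets need not be closed: finitely many [F i] are kept. The discarded
   tail costs e/2, the sets U n minus F n together another e/2. *)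
pose G n := \big[setU/set0]_(i < n) F i.
have cG n : closed (G n) by apply: closed_bigsetU => i _; exact: cF.
have GF n : G n `<=` \bigcup_n F n.
  by move=> z; rewrite /G -bigcup_mkord => -[k _ Fk]; exists k.
have bF : borelM (\bigcup_n F n) by apply: borel_bigcup => n; exact: borel_closed.
have [N hN] : exists n, (mu (rho @^-1` (\bigcup_n F n `\` G n)) <= (e / 2)%:E)%E.
  apply: (@small_tail (fun n => \bigcup_n F n `\` G n)) => //.
  - by move=> n; apply: borelD => //; exact: borel_closed.
  - by move=> m n mn z [Fz Gz]; split=> // h; apply: Gz; apply: subset_bigsetU mn _ h.
  - apply/seteqP; split=> // z h; have [[k _ Fk] _] := h 0%N I.
    by have [_] := h k.+1 I; apply; rewrite /G big_ord_recr/=; right.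
exists (G N), (\bigcup_n U n); split=> //.
- by apply: bigcup_open => n _.
- by move=> z /GF[k _ Fk]; exists k => //; case: (hU k) => _ _ + _ _; apply.
- by move=> z [k _ Bk]; exists k => //; case: (hU k) => _ _ _ + _; apply.
have mUF n : measurable (rho @^-1` (U n `\` F n)).
  by apply: mrho; apply: borelD; [exact: borel_open|exact: borel_closed].
have mFG : measurable (rho @^-1` (\bigcup_n F n `\` G N)).
  by apply: mrho; apply: borelD => //; exact: borel_closed.
have h1 : (mu (\bigcup_n (rho @^-1` (U n `\` F n))) <= (e / 2)%:E)%E.
  by apply: small_bigcup => //; [exact: ltW|move=> n; case: (hU n)].
have mm : measurable (\bigcup_n (rho @^-1` (U n `\` F n))) by exact: bigcupT_measurable.
rewrite [e]splitr EFinD; apply: le_trans (leeD h1 hN).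
apply: le_trans (measureU2 mu mm mFG).
apply: mu_le; first 2 last.
- move=> t [[k _ Uk] Gt]; case: (pselect ((\bigcup_n F n) (rho t))) => [Ft|Ft]; first by right.
  by left; exists k => //; split=> // Fk; apply: Ft; exists k.
- apply: mrho; apply: borelD; last exact: borel_closed.
  by apply: borel_open; apply: bigcup_open => n _.
- exact: measurableU.
Qed.

Lemma borel_regular B : borelM B -> regular B.
Proof.
move: B; apply: smallest_sub; last exact: regular_open.
split.
- exact: regular_open open0.
- by move=> A rA; rewrite setTD; exact: regularC.
- exact: regular_bigcup.
Qed.

Lemma inner_closed B (e : R) : borelM B -> 0 < e -> exists F,
  [/\ closed F, F `<=` B & (mu (rho @^-1` (B `\` F)) <= e%:E)%E].
Proof.
move=> bB e0; have [F [U [cF oU FB BU h]]] := borel_regular bB e0.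
exists F; split=> //; apply: le_trans h; apply: mu_le.
- by apply: mrho; apply: borelD => //; exact: borel_closed.
- by apply: mrho; apply: borelD; [exact: borel_open|exact: borel_closed].
- by move=> t [Bt Ft]; split=> //; exact: BU.
Qed.

Hypothesis M_complete : forall F : set_system M, ProperFilter F -> cauchy F -> exists x : M, F --> x.
Hypothesis M_separable : separable M.

Lemma ultra_bigsetU (F : set_system M) (A : (set M)^nat) n : UltraFilter F ->
  F (\big[setU/set0]_(i < n) A i) -> exists i, F (A i).
Proof.
move=> UF; elim: n => [|n IH].
  by rewrite big_ord0 => /filter_ex[].
rewrite big_ord_recr/= => FU; have [/IH//|FC] := in_ultra_setVsetC (\big[setU/set0]_(i < n) A i) UF.
by exists n; apply: filterS (filterI FU FC) => z [[]].
Qed.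

(** Ulam's theorem. At each scale 1/(n+1) finitely many balls cover all but a small mass; an
    ultrafilter on the intersection contains one ball of every scale, hence is Cauchy and converges
    by completeness. *)
Lemma tight (p : M) (e : R) : 0 < e ->
  exists K, compact K /\ closed K /\ (mu (rho @^-1` (~` K)) <= e%:E)%E.
Proof.
move=> e0; have e2 : 0 < e / 2 by rewrite divr_gt0.
have [D cD dD] := M_separable.
have D0 : D !=set0.
  by have [||x [_ Dx]] := dD setT; [exists p|exact: openT|exists x].
have [q qD] : exists q : nat -> M, forall x, D x -> exists n, q n = x.
  have /pfcard_geP[D00|[q]] := cD; first by move: D0; rewrite D00 => -[].
  exists q => x Dx; have [n _ <-] := 'surj_q Dx; by exists n.
have en n : 0 < e / 2 / (2 ^ n.+1)%:R by rewrite divr_gt0// ltr0n expn_gt0.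
pose V n i : set M := ball (q i) (n.+1%:R^-1 : R).
have oV n m : open (\big[setU/set0]_(i < m) V n i).
  by rewrite -bigcup_mkord; apply: bigcup_open => i _; exact: open_mball.
have /choice[N hN] : forall n, exists m,
    (mu (rho @^-1` (~` \big[setU/set0]_(i < m) V n i)) <= (e / 2 / (2 ^ n.+1)%:R)%:E)%E.
  move=> n; apply: (@small_tail (fun m => ~` \big[setU/set0]_(i < m) V n i)) => //.
  - by move=> m; apply: borelC; exact: borel_open.
  - by move=> m k mk; apply: subsetC; exact: subset_bigsetU.
  - apply/seteqP; split=> // z h.
    have [||x [zx Dx]] := dD (ball z (n.+1%:R^-1 : R)); first by exists z; exact: ballxx.
      exact: open_mball.
    have [i qi] := qD _ Dx; apply: (h i.+1 I).
    by rewrite big_ord_recr/=; right; rewrite /V qi; exact: ball_sym.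
pose K0 := \bigcap_n \big[setU/set0]_(i < N n) V n i.
have bK0 : borelM K0 by apply: borel_bigcap => n; exact: borel_open.
(* [K0] is an intersection of open sets and need not be closed; a closed subset of almost full
   measure replaces it. *)
have [F [cF FK h]] := inner_closed bK0 e2.
exists F; split; last split=> //.
  rewrite compact_ultra => G UG GF.
  have cG : cauchy G.
    apply/cauchy_ballP => r r0.
    have r2 : 0 < r / 2 by rewrite divr_gt0.
    have [n _ /(_ n (leqnn n))/= hn] := near_infty_natSinv_lt (PosNum r2).
    have : G (\big[setU/set0]_(i < N n) V n i) by apply: filterS GF => z /FK; apply.
    move=> /ultra_bigsetU[i Gi]; exists (V n i, V n i) => // -[z1 z2] [/= h1 h2].
    apply: (@le_ball _ _ z1 (n.+1%:R^-1 + n.+1%:R^-1)); first by rewrite [r]splitr lerD ?ltW.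
    by apply: ball_triangle h2; exact: ball_sym.
  have [x Gx] := M_complete _ cG.
  by exists x; split=> //; apply: (@closed_cvg _ _ G _ id F cF) => //; exact: GF.
rewrite [e]splitr EFinD.
have mK : measurable (rho @^-1` (~` K0)) by apply: mrho; exact: borelC.
have mKF : measurable (rho @^-1` (K0 `\` F)) by apply: mrho; apply: borelD => //; exact: borel_closed.
apply: le_trans (_ : _ <= mu (rho @^-1` (~` K0)) + mu (rho @^-1` (K0 `\` F)))%E _; last first.
  apply: leeD => //; rewrite setC_bigcap preimage_bigcup.
  apply: small_bigcup => //; last exact: ltW.
  by move=> n; apply: mrho; apply: borelC; exact: borel_open.
apply: le_trans (measureU2 mu mK mKF); apply: mu_le.
- by apply: mrho; apply: borelC; exact: borel_closed.
- exact: measurableU.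
- by move=> t nF; case: (pselect (K0 (rho t))) => [k|k]; [right|left].
Qed.

Variable C : nat -> set M.

(** Union of the atoms of the algebra generated by C 0, ..., C (n-1) that meet [P]. *)
Definition saturation n (P : set M) : set M :=
  [set y | exists2 x, P x & forall k, (k < n)%N -> C k x <-> C k y].

(** [P] is an arbitrary set: there are finitely many atoms, each a Boolean combination of the sets
    [C k], and the induction splits them by one more [C n]. *)
Lemma saturation_borel (G : set (set M)) : sigma_algebra setT G ->
  (forall k, G (C k)) -> forall n P, G (saturation n P).
Proof.
move=> [G0 GC GU] hC.
have GCC A : G A -> G (~` A) by move=> /GC; rewrite setTD.
have GUU A B : G A -> G B -> G (A `|` B).
  by move=> gA gB; rewrite -bigcup2E; apply: (GU) => -[|[|n]].
have GI A B : G A -> G B -> G (A `&` B).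
  by move=> gA gB; rewrite -[_ `&` _]setCK setCI; apply: (GCC); apply: (GUU); exact: (GCC).
elim=> [|n IH] P.
  have [[x Px]|nP] := pselect (exists x, P x).
    rewrite (_ : saturation 0 P = ~` set0); first exact: (GCC).
    by apply/seteqP; split=> y; [move=> _ []|move=> _; exists x].
  rewrite (_ : saturation 0 P = set0)//.
  by apply/seteqP; split=> y // [x Px _]; apply: nP; exists x.
rewrite (_ : saturation n.+1 P = (C n `&` saturation n (P `&` C n)) `|`
    (~` C n `&` saturation n (P `\` C n))).
  by apply: (GUU); apply: (GI) => //; exact: (GCC).
apply/seteqP; split=> y.
  move=> [x Px h]; have hn := h n (ltnSn n).
  have [Cy|Cy] := pselect (C n y); [left|right]; (split=> //; exists x; [split=> //|]).
  - exact/hn.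
  - by move=> k kn; apply: h; exact: ltnW.
  - by move=> /hn.
  - by move=> k kn; apply: h; exact: ltnW.
move=> [[Cy [x [Px Cx] h]]|[Cy [x [Px Cx] h]]]; exists x => // k;
  rewrite ltnS leq_eqVlt => /orP[/eqP ->|/h//]; by split.
Qed.

(** On a compact [K] avoiding [N] every [C k] is relatively clopen. If y in K lies in every
    saturation of A and K, points of A and K sharing more and more memberships with y have a cluster
    point sharing all of them; by separation it is y, so y is in A. The quantifier over [G] records
    that A' arises from the [C k] by countable operations, for use with any sigma-algebra. *)
Lemma separated_approx (N A : set M) (p : M) (e : R) :
  borelM N -> mu (rho @^-1` N) = 0%E -> (forall k, borelM (C k)) ->
  (forall x y, ~ N x -> ~ N y -> (forall k, C k x <-> C k y) -> x = y) ->
  closed A -> 0 < e -> exists Z A', [/\ borelM Z, (mu (rho @^-1` Z) <= e%:E)%E,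
    A `\` Z = A' `\` Z & forall G, sigma_algebra setT G -> (forall k, G (C k)) -> G A'].
Proof.
move=> bN N0 bC sep cA e0; have e2 : 0 < e / 2 by rewrite divr_gt0.
have e4 : 0 < e / 2 / 2 by rewrite divr_gt0.
have [K0 [kK0 [cK0 hK0]]] := tight p e4.
have [L [cL LN hL]] := inner_closed (borelC bN) e4.
(* The half e/2 left after [K0] and [L] is spread over n, and each share is halved again between
   [C n] and its complement. *)
have en n : 0 < e / 2 / (2 ^ n.+1)%:R / 2 by rewrite !divr_gt0// ltr0n expn_gt0.
have /choice[F hF] := fun n => inner_closed (bC n) (en n).
have /choice[F' hF'] := fun n => inner_closed (borelC (bC n)) (en n).
have cF n : closed (F n) by case: (hF n). have cF' n : closed (F' n) by case: (hF' n).
have FC n : F n `<=` C n by case: (hF n). have FC' n : F' n `<=` ~` C n by case: (hF' n).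
pose K := K0 `&` L `&` \bigcap_n (F n `|` F' n).
have cK : closed K.
  apply: closedI; first exact: closedI.
  by apply: closed_bigI => n _; exact: closedU.
have kAK : compact (A `&` K).
  by apply: subclosed_compact kK0 _; [exact: closedI|move=> z [_ [[]]]].
exists (~` K), (\bigcap_n saturation n (A `&` K)); split.
- by apply: borelC; exact: borel_closed.
- have m1 : measurable (rho @^-1` (~` K0)) by apply: mrho; apply: borelC; exact: borel_closed.
  have m2 : measurable (rho @^-1` (~` N `\` L)).
    by apply: mrho; apply: borelD; [exact: borelC|exact: borel_closed].
  have m2' : measurable (rho @^-1` N) by exact: mrho.
  have m3 n : measurable (rho @^-1` (C n `\` F n)).
    by apply: mrho; apply: borelD => //; exact: borel_closed.
  have m4 n : measurable (rho @^-1` (~` C n `\` F' n)).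
    by apply: mrho; apply: borelD; [exact: borelC|exact: borel_closed].
  have m5 : measurable (\bigcup_n (rho @^-1` (C n `\` F n) `|` rho @^-1` (~` C n `\` F' n))).
    by apply: bigcupT_measurable => n; exact: measurableU.
  have m12 : measurable (rho @^-1` (~` K0) `|` (rho @^-1` (~` N `\` L) `|` rho @^-1` N)).
    by apply: measurableU => //; exact: measurableU.
  have h5 : (mu (\bigcup_n (rho @^-1` (C n `\` F n) `|` rho @^-1` (~` C n `\` F' n))) <= (e / 2)%:E)%E.
    apply: small_bigcup; [by move=> n; exact: measurableU|exact: ltW|move=> n].
    apply: le_trans (measureU2 mu (m3 n) (m4 n)) _.
    by rewrite [leRHS](_ : _ = (e / 2 / (2 ^ n.+1)%:R / 2)%:E + (e / 2 / (2 ^ n.+1)%:R / 2)%:E)%E;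
      [apply: leeD; [case: (hF n)|case: (hF' n)]|rewrite -EFinD -splitr].
  have h12 : (mu (rho @^-1` (~` K0) `|` (rho @^-1` (~` N `\` L) `|` rho @^-1` N)) <= (e / 2)%:E)%E.
    apply: le_trans (measureU2 mu m1 (measurableU _ _ m2 m2')) _.
    rewrite [leRHS](_ : _ = (e / 2 / 2)%:E + (e / 2 / 2)%:E)%E; last by rewrite -EFinD -splitr.
    apply: leeD => //; apply: le_trans (measureU2 mu m2 m2') _.
    by rewrite [X in (_ + X)%E]N0 adde0.
  rewrite [e]splitr EFinD; apply: le_trans (leeD h12 h5); apply: le_trans (measureU2 mu m12 m5).
  apply: mu_le; [|exact: measurableU|].
    by apply: mrho; apply: borelC; exact: borel_closed.
  move=> t /= nK; apply: contrapT => h; apply: nK; split; first split.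
  - by apply: contrapT => k; apply: h; left; left.
  - apply: contrapT => k; apply: h; left; right.
    by have [n|n] := pselect (N (rho t)); [right|left].
  - move=> n _; apply: contrapT => k; apply: h; right; exists n => //.
    have [Ct|Ct] := pselect (C n (rho t)); [left|right]; split=> // ?; apply: k; by [left|right].
- apply/seteqP; split=> y [h /contrapT Ky]; split=> //.
    by move=> n _; exists y.
  have /choice[u hu] : forall n, exists x, (A `&` K) x /\ forall k, (k < n)%N -> C k x <-> C k y.
    by move=> n; have [x ? ?] := h n I; exists x.
  have AKu n : (A `&` K) (u n) by case: (hu n).
  have AKn : (u @ \oo) (A `&` K) by exists 0%N => // n _; exact: AKu.
  have [z [[Az Kz] clz]] := kAK _ _ AKn.
  have [_ FK] := Kz; have [[_ Lz] _] := Kz; have [[_ Ly] FKy] := Ky.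
  suff -> : y = z by [].
  (* A closed set containing almost all [u n] contains the cluster point; applied to the closed
     halves [F k] and [F' k], it transfers each membership in [C k]. *)
  have cl (B : set M) : closed B -> (\forall n \near \oo, B (u n)) -> B z.
    move=> cB Bu; apply: cB => U Uz; have [w [Bw Uw]] := clz _ _ Bu Uz; by exists w.
  apply: sep; [exact: LN|exact: LN|move=> k].
  have ev : \forall n \near \oo, C k (u n) <-> C k y.
    by exists k.+1 => // n /= kn; case: (hu n) => _; apply.
  split=> Cz.
    apply: (FC k); apply: cl => //; apply: filterS ev => n hn.
    have [_ [_ /(_ k I)[//|/FC']]] := AKu n; by move=> /(_ (hn.2 Cz)).
  apply: contrapT => nCy; suff : (~` C k) z by [].
  apply: (FC' k); apply: cl => //; apply: filterS ev => n hn.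
  have [_ [_ /(_ k I)[/FC /hn.1 //|//]]] := AKu n.
- move=> G sG GC; have [G0 GD GU] := sG.
  rewrite -[X in G X]setCK setC_bigcap -setTD; apply: (GD); apply: (GU) => n.
  by rewrite -setTD; apply: (GD); exact: saturation_borel.
Qed.

End Regularity.

(** * Commutation with a separating sequence of projections *)

Section CommutantOfSpectral.
Context d (S : measurableType d) (R : realType) (H : hilbertType R).
Variable E : spectral_measure S H.
Implicit Types (x y : H) (A B : set S) (f g : S -> R[i]) (Q T : operator H).

Definition commuting_sets Q : set (set S) :=
  [set A | measurable A /\ forall x, Q (E A x) = E A (Q x)].

Lemma commuting_sets_sigma_algebra Q : bounded_operator Q ->
  sigma_algebra setT (commuting_sets Q).
Proof.
move=> bQ; have dQ := bounded_domE bQ.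
have CC A : commuting_sets Q A -> commuting_sets Q (~` A).
  move=> [mA cA]; split=> [|x]; first exact: measurableC.
  by rewrite !spectralC// appB// cA.
have CI A B : commuting_sets Q A -> commuting_sets Q B -> commuting_sets Q (A `&` B).
  move=> [mA cA] [mB cB]; split=> [|x]; first exact: measurableI.
  by rewrite -!spectralI// cA cB.
have C0 : commuting_sets Q set0.
  by split=> [|x]; [exact: measurable0|rewrite !spectral_val0 app0].
have CU A B : commuting_sets Q A -> commuting_sets Q B -> commuting_sets Q (A `|` B).
  by move=> cA cB; rewrite -[_ `|` _]setCK setCU; apply: (CC); apply: (CI); exact: (CC).
split=> // [A cA|F cF]; first by rewrite setTD; exact: CC.
have mF n : measurable (F n) by case: (cF n).
split=> [|x]; first exact: bigcupT_measurable.
pose G n := \big[setU/set0]_(i < n.+1) F i.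
have cG n : commuting_sets Q (G n).
  rewrite /G; elim: n => [|n IH]; rewrite big_ord_recr/=; apply: CU => //.
  by rewrite big_ord0.
have mG n : measurable (G n) by case: (cG n).
have ndG : nondecreasing_seq G.
  by move=> m n mn; apply/subsetPset; exact: subset_bigsetU.
rewrite -bigcup_bigsetU_bigcup.
have c1 := bounded_cvg bQ (@spectral_cvg _ _ _ _ E _ x mG ndG).
have c2 := @spectral_cvg _ _ _ _ E _ (Q x) mG ndG.
apply: (cvg_unique _ c1); first exact: norm_hausdorff.
rewrite (_ : (fun n => _) = fun n => E (G n) (Q x))//.
by apply/funext => n; case: (cG n).
Qed.

Lemma spectral_off_null A B N x : E_null E N -> measurable A -> measurable B ->
  A `\` N = B `\` N -> E A x = E B x.
Proof.
move=> [mN N0] mA mB AB.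
have off C : measurable C -> E C x = E (C `\` N) x.
  move=> mC; rewrite setDE -spectralI//; last exact: measurableC.
  by rewrite spectralC// N0 subr0.
by rewrite off// AB -off.
Qed.

Lemma commuting_sets_null Q A B N : E_null E N -> measurable A -> commuting_sets Q B ->
  A `\` N = B `\` N -> commuting_sets Q A.
Proof.
move=> N0 mA [mB cB] AB; split=> // x.
by rewrite !(spectral_off_null _ N0 mA mB AB) cB.
Qed.

Section SumMeasure.
Variables x y : H.

(** One finite measure controlling [E A x] and [E A y] together, so that a single small exceptional
    set serves both x and Q x. *)
Definition vector_measure2 := measure_add (vector_measure E x) (vector_measure E y).

HB.instance Definition _ := Measure.on vector_measure2.

Let vector_measure2_fin : fin_num_fun vector_measure2.
Proof.
by move=> A mA; rewrite /vector_measure2 measure_addE fin_numD !fin_num_measure.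
Qed.

HB.instance Definition _ := Measure_isFinite.Build d S R vector_measure2 vector_measure2_fin.

Lemma vector_measure2_le A (e : R) : measurable A -> 0 <= e ->
  (vector_measure2 A <= (e ^+ 2)%:E)%E -> vnorm (E A x) <= e /\ vnorm (E A y) <= e.
Proof.
move=> mA e0; rewrite /vector_measure2 measure_addE /= !vector_measureE// -EFinD lee_fin => h.
by split; rewrite -(@ler_pXn2r _ 2) ?nnegrE ?vnorm_ge0//; apply: le_trans h;
  rewrite ?lerDl ?lerDr sqr_ge0.
Qed.

End SumMeasure.

Lemma spectral_approx A B Z x : measurable A -> measurable B -> measurable Z ->
  A `\` Z = B `\` Z -> vnorm (E A x - E B x) <= 2 * vnorm (E Z x).
Proof.
move=> mA mB mZ AB; have mZc := measurableC mZ.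
have sp C : measurable C -> E C x = E (C `\` Z) x + E C (E Z x).
  by move=> mC; rewrite setDE -spectralI// -spectralD// spectralC// subrK.
rewrite (sp A)// (sp B)// AB opprD addrACA subrr add0r.
apply: le_trans (vnormD _ _) _; rewrite vnormN mulrDl mul1r.
by apply: lerD; exact: spectral_contract.
Qed.

(** The sets whose projection commutes with Q form a sigma-algebra containing the [C k], hence all
    approximants A' of closed sets. The commutator of Q with the projection of a closed set is then
    bounded, at each x, by the mass of an arbitrarily small exceptional set. *)
Lemma standard_commuting_sets Q (C : nat -> set S) N : standard_spectral_measure E ->
  bounded_operator Q -> (forall k, commuting_sets Q (C k)) -> E_null E N ->
  (forall s t, ~ N s -> ~ N t -> (forall k, C k s <-> C k t) -> s = t) ->
  forall A, measurable A -> commuting_sets Q A.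
Proof.
move=> [S' [mS' S'0 [c [Mc Ms GE]]]] bQ cC N0 sep.
have dQ := bounded_domE bQ; have [b b0 Qb] := bounded_vnorm bQ.
(* If [S'] is empty, its complement is all of S and is null, so the Hilbert space is zero. *)
have [[p0 Sp0]|nS'] := pselect (exists p, S' p); last first.
  move=> A mA; have [_ E0] := S'0.
  have z x : x = 0.
    rewrite -(E0 x) (_ : ~` S' = setT) ?spectral_setT//.
    by apply/seteqP; split=> s // _ Ss; apply: nS'; exists s.
  by split=> // x; rewrite (z x) (z (Q _)) (z (E _ _)).
pose M : metricType R := Metric.Pack c.
pose iota : M -> S := @set_val S S'.
have iota_in z : S' (iota z) by exact: set_valP.
(* [rho] inverts the inclusion on [S'] and sends the null remainder to one point, so Borel sets of
   [M] pull back to measurable sets of S. *)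
have /choice[rho rhoP] : forall s, exists z : M,
    (S' s -> iota z = s) /\ (~ S' s -> iota z = p0).
  move=> s.
  have [Ss|nS] := pselect (S' s); last by exists (exist _ p0 (mem_set Sp0)).
  by exists (exist _ s (mem_set Ss)).
have rhoK s : S' s -> iota (rho s) = s by case: (rhoP s).
have borelP (B : set M) : <<s @open M >> B <-> exists2 A, measurable A & B = iota @^-1` A.
  have := GE; rewrite /M => <-; split=> [[A mA <-]|[A mA ->]]; exists A => //; by rewrite setTI.
have rho_iota (A : set S) : rho @^-1` (iota @^-1` A) `\` ~` S' = A `\` ~` S'.
  by apply/seteqP; split=> s [h /contrapT Ss]; split=> //; move: h; rewrite /preimage/= rhoK.
have mN : measurable N by case: N0.
have mrho (B : set M) : <<s @open M >> B -> measurable (rho @^-1` B).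
  move=> /borelP[A mA ->].
  rewrite (_ : _ @^-1` _ = (A `&` S') `|` (if `[< A p0 >] then ~` S' else set0)).
    apply: measurableU; first exact: measurableI.
    by case: ifP => _; [exact: measurableC|exact: measurable0].
  apply/seteqP; split=> s; rewrite /preimage/=.
    have [Ss|nS] := pselect (S' s); first by rewrite rhoK//; left.
    by rewrite (rhoP s).2// => Ap; right; rewrite asboolT.
  move=> [[As Ss]|]; first by rewrite rhoK.
  by case: ifPn => // /asboolP Ap nS; rewrite (rhoP s).2.
pose G : set (set M) := [set B | commuting_sets Q (rho @^-1` B)].
have [Q0 QC QU] := commuting_sets_sigma_algebra bQ.
have sG : sigma_algebra setT G.
  split; first by rewrite /G/= preimage_set0.
    by move=> B cB; rewrite /G/= setTD preimage_setC -setTD; exact: QC.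
  by move=> B cB; rewrite /G/= preimage_bigcup; exact: QU.
have GC k : G (iota @^-1` (C k)).
  apply: (commuting_sets_null S'0 _ (cC k)) => //.
  by apply: mrho; apply/borelP; exists (C k) => //; case: (cC k).
have Gclosed (F : set M) : closed F -> G F.
  move=> cF; have mF : measurable (rho @^-1` F) by apply: mrho; exact: borel_closed.
  split=> // x; apply/eqP; rewrite -subr_eq0; apply/eqP/vnorm0_eq0/eqP.
  rewrite eq_le vnorm_ge0 andbT; apply/ler_addgt0Pl => t t0; rewrite addr0.
  have b1 : 0 < 2 * b + 2 by rewrite ltr_wpDl// mulr_ge0.
  (* Chosen so that the error b (2 e) at x, after applying Q, plus the error 2 e at Q x, equals
     t. *)
  pose e := t / (2 * b + 2); have e0 : 0 < e by rewrite divr_gt0.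
  have bN : <<s @open M >> (iota @^-1` N) by apply/borelP; exists N.
  have muN : vector_measure2 x (Q x) (rho @^-1` (iota @^-1` N)) = 0%E.
    have mI := mrho _ bN.
    rewrite /vector_measure2 measure_addE /= !vector_measureE//.
    have e1 y : E (rho @^-1` (iota @^-1` N)) y = 0.
      by rewrite (spectral_off_null _ S'0 (mrho _ bN) mN)//; case: N0.
    by rewrite !e1 vnorm0 expr0n adde0.
  have bC k : <<s @open M >> (iota @^-1` (C k)) by apply/borelP; exists (C k) => //; case: (cC k).
  have sepM u v : ~ (iota @^-1` N) u -> ~ (iota @^-1` N) v ->
      (forall k, (iota @^-1` (C k)) u <-> (iota @^-1` (C k)) v) -> u = v.
    by move=> Nu Nv h; apply: val_inj; exact: sep.
  have [Z [A' [bZ muZ FA GA]]] := @separated_approx _ M _ _ rho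
    (vector_measure2 x (Q x)) mrho Mc Ms (fun k => iota @^-1` (C k)) _ F
    (rho p0) _ bN muN bC sepM cF (exprn_gt0 2 e0).
  have mZ := mrho _ bZ.
  have [mA' cA'] : commuting_sets Q (rho @^-1` A') by exact: (GA G sG GC).
  have [Zx ZQx] := vector_measure2_le mZ (ltW e0) muZ.
  have FA' : rho @^-1` F `\` rho @^-1` Z = rho @^-1` A' `\` rho @^-1` Z.
    by have := congr1 (fun U => rho @^-1` U) FA.
  have h1 := spectral_approx x mF mA' mZ FA'.
  have h2 := spectral_approx (Q x) mF mA' mZ FA'.
  have -> : Q (E (rho @^-1` F) x) - E (rho @^-1` F) (Q x) =
      Q (E (rho @^-1` F) x - E (rho @^-1` A') x) -
      (E (rho @^-1` F) (Q x) - E (rho @^-1` A') (Q x)).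
    by rewrite appB// cA' opprB addrA subrK.
  apply: le_trans (vnormD _ _) _; rewrite vnormN.
  have -> : t = b * (2 * e) + 2 * e by rewrite /e; field; rewrite gt_eqF.
  apply: lerD; last by apply: le_trans h2 _; rewrite ler_pM2l.
  apply: le_trans (Qb _) _; apply: ler_wpM2l => //.
  by apply: le_trans h1 _; rewrite ler_pM2l.
have Gopen : @open M `<=` G.
  move=> U oU; have := Gclosed _ (open_closedC oU).
  by have [_ + _] := sG => /[apply]; rewrite setTD setCK.
move=> A mA; have GA : G (iota @^-1` A).
  by apply: (smallest_sub sG Gopen); apply/borelP; exists A.
by apply: (commuting_sets_null S'0 mA GA); rewrite rho_iota.
Qed.

(* Only the separation of points by the countably many sets {|g_i - c| <= r}
   with rational c and r enters. *)
Lemma commutes_separating_spectral Q (I : Type) (g : I -> S -> R[i]) (T : I -> operator H) N :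
  standard_spectral_measure E -> countable [set: I] -> bounded_operator Q ->
  (forall i, borel_measurable (g i)) -> (forall i, is_sint E (g i) (T i)) ->
  (forall i, commutes (T i) Q) -> E_null E N ->
  (forall s t, ~ N s -> ~ N t -> (forall i, g i s = g i t) -> s = t) ->
  forall A, measurable A -> commuting_sets Q A.
Proof.
move=> sE cI bQ mg iT cT N0 sep.
pose D (i : I) (w : rat * rat * rat) : set S :=
  [set t | normc (g i t - (ratr w.1.1 +i* ratr w.1.2)) <= ratr w.2].
have cD i w : commuting_sets Q (D i w).
  have [w0|w0] := leP 0 (ratr w.2 : R).
    by split=> [|x]; [exact: measurable_le_normc|exact: fuglede (iT i) bQ (cT i) w0].
  rewrite (_ : D i w = set0); first by case: (commuting_sets_sigma_algebra bQ).
  apply/seteqP; split=> t //=; rewrite /D/=.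
  by have := normc_ge0 (g i t - (ratr w.1.1 +i* ratr w.1.2)) => ? ?; lra.
(* For an empty family separation means that at most one point lies outside [N]; a constant sequence
   of empty sets then separates as well. *)
have [i0|nI] := pselect (inhabited I); last first.
  apply: (@standard_commuting_sets Q (fun=> set0) N) => //.
    by move=> _; case: (commuting_sets_sigma_algebra bQ).
  by move=> s t Ns Nt _; apply: sep => // i; case: nI.
have [e eP] : exists e : nat -> I, forall i, exists n, e n = i.
  have /pfcard_geP[I0|[e]] := cI.
    by case: i0 => i; have : [set: I] i by []; rewrite I0.
  by exists e => i; have [n _ <-] := 'surj_e (Logic.I : [set: I] i); exists n.
(* All pairs of a member of the family and a rational disc, in one sequence; numbers that code
   nothing give the empty set. *)
pose C n := oapp (fun v : nat * (rat * rat * rat) => D (e v.1) v.2) set0 (choice.unpickle n).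
apply: (@standard_commuting_sets Q C N) => //.
  move=> n; rewrite /C; case: choice.unpickle => [v|] /=; first exact: cD.
  by case: (commuting_sets_sigma_algebra bQ).
move=> s t Ns Nt h; apply: sep => // i; apply: contrapT => gst.
have [m em] := eP i.
have d0 : 0 < normc (g i s - g i t).
  rewrite lt_def normc_ge0 andbT; apply/eqP => /eq0_normc/eqP.
  by rewrite subr_eq0 => /eqP.
(* A disc of radius below half the distance of the two values cannot contain both. *)
have [r] := @rat_in_itvoo _ 0 (normc (g i s - g i t) / 2) (divr_gt0 d0 (ltr0n R 2)).
rewrite in_itv/= => /andP[r0 re].
have r2 : 0 < ratr r / 2 :> R by rewrite divr_gt0.
have [p] := @rat_in_itvoo _ (complex.Re (g i s)) (complex.Re (g i s) + ratr r / 2) ltac:(by rewrite ltrDl).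
rewrite in_itv/= => /andP[p1 p2].
have [q] := @rat_in_itvoo _ (complex.Im (g i s)) (complex.Im (g i s) + ratr r / 2) ltac:(by rewrite ltrDl).
rewrite in_itv/= => /andP[q1 q2].
have close : normc (g i s - (ratr p +i* ratr q)) <= ratr r.
  apply: le_trans (normc_le_ReIm _) _; rewrite !raddfB/= !ler0_norm; lra.
have := h (choice.pickle (m, (p, q, r))); rewrite /C choice.pickleK.
change (D (e m) (p, q, r) s <-> D (e m) (p, q, r) t -> False).
rewrite em => -[/(_ close) ct _]; move: ct; rewrite /D => ct.
have := le_normcD (g i s - (ratr p +i* ratr q)) ((ratr p +i* ratr q) - g i t).
rewrite addrA subrK -(opprB (g i t) (ratr p +i* ratr q)) normcN.
have {}ct : normc (g i t - (ratr p +i* ratr q)) <= ratr r by exact: ct.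
lra.
Qed.

End CommutantOfSpectral.

(** * Graph projections and double commutants *)

Section Affiliation.
Context {R : realType} {H : hilbertType R}.
Implicit Types (x y z w a b : H) (T Q : operator H) (Y Z : set (operator H)).

(** Adjoints enter [adjoints X] only through a relation, so the union of X and its adjoints must
    first be shown to contain one for each T. The domain collects the y whose functional <y, T w>
    has a representing vector, unique by density. *)
Lemma adjoint_exists T : densely_defined T -> exists T', is_adjoint T T'.
Proof.
move=> dT.
pose adj y z := forall w, dom T w -> inner y (T w) = inner z w.
have adj_uniq y z z' : adj y z -> adj y z' -> z = z'.
  move=> h h'; apply/eqP; rewrite -subr_eq0; apply/eqP.
  by apply: (inner_all0 dT) => w Tw; rewrite innerBl -h// -h'// subrr.
have /choice[F FP] : forall y, exists z, ((exists z', adj y z') -> adj y z) /\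
    ((~ exists z', adj y z') -> z = 0).
  move=> y; have [[z h]|n] := pselect (exists z', adj y z').
    by exists z; split=> // n; case: n; exists z.
  by exists 0; split=> // h; case: n.
pose D := [set y | exists z, adj y z].
have D0 : D 0 by exists 0 => w _; rewrite !inner0l.
have adj_lin (c : R[i]) y y' z z' : adj y z -> adj y' z' -> adj (c *: y + y') (c *: z + z').
  by move=> h h' w Tw; rewrite !innerDl !innerZl h// h'.
have Dlin (c : R[i]) y y' : D y -> D y' -> D (c *: y + y').
  by move=> [z h] [z' h']; exists (c *: z + z'); exact: adj_lin.
have Flin (c : R[i]) y y' : D y -> D y' -> F (c *: y + y') = c *: F y + F y'.
  move=> Dy Dy'; apply: (@adj_uniq (c *: y + y')).
    by apply: (FP _).1; exact: Dlin.
  by apply: adj_lin; exact: (FP _).1.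
exists (@Operator _ H D F D0 Dlin Flin (fun y => (FP y).2)) => y z; split.
  by move=> [/= Dy <-]; exact: (FP y).1.
move=> h; have Dy : D y by exists z.
by split=> //=; apply: adj_uniq h; exact: (FP y).1.
Qed.

(** The projection of H x H onto the graph as a block matrix: [P], [P'] give the first component z,
    [W], [W'] the second component T z. Uniqueness of the projected point makes the blocks
    linear. *)
Lemma graph_operators T : seq_closed T -> exists P P' W W' : operator H,
  [/\ bounded_operator P, bounded_operator P', bounded_operator W & bounded_operator W'] /\
  forall a b, let z := P a + P' b in [/\ dom T z, T z = W a + W' b &
    forall w, dom T w -> inner (a - z) w + inner (b - T z) (T w) = 0].
Proof.
move=> cT.
pose proj a b z := dom T z /\ forall w, dom T w -> inner (a - z) w + inner (b - T z) (T w) = 0.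
(* Testing orthogonality with w = z gives |z|^2 + |T z|^2 = Re <a, z> + Re <b, T z>, and the right
   side is at most half the sum of all four squares. *)
have proj_bound a b z : proj a b z -> vnorm z ^+ 2 + vnorm (T z) ^+ 2 <= vnorm a ^+ 2 + vnorm b ^+ 2.
  move=> [Tz h]; have := h z Tz; rewrite !innerBl !inner_vnorm => /(congr1 (@complex.Re R)).
  have : complex.Re (inner a z) <= (vnorm a ^+ 2 + vnorm z ^+ 2) / 2.
    have := Re_cauchy_schwarz a z; rewrite ler_norml => /andP[_].
    have := sqr_ge0 (vnorm a - vnorm z); nra.
  have : complex.Re (inner b (T z)) <= (vnorm b ^+ 2 + vnorm (T z) ^+ 2) / 2.
    have := Re_cauchy_schwarz b (T z); rewrite ler_norml => /andP[_].
    have := sqr_ge0 (vnorm b - vnorm (T z)); nra.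
  case: (inner a z) (inner b (T z)) => [r r'] [s s'] /=; lra.
have proj_lin (c : R[i]) a b a' b' z z' : proj a b z -> proj a' b' z' ->
    proj (c *: a + a') (c *: b + b') (c *: z + z').
  move=> [Tz h] [Tz' h']; split=> [|w Tw]; first exact: dom_linear.
  have e (u u' v v' : H) : c *: u + u' - (c *: v + v') = c *: (u - v) + (u' - v').
    by rewrite scalerBr opprD addrACA.
  rewrite app_linear// !e (innerDl w) innerZl (innerDl (T w)) innerZl.
  by rewrite addrACA -mulrDr h// h'// mulr0 addr0.
have proj_uniq a b z z' : proj a b z -> proj a b z' -> z = z'.
  move=> p p'; apply/eqP; rewrite -subr_eq0; apply/eqP; apply: vnorm0_eq0.
  have := proj_bound _ _ _ (proj_lin (-1) _ _ _ _ _ _ p' p).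
  rewrite !scaleN1r !addNr vnorm0 expr0n addr0 /= => h.
  apply/eqP; rewrite -sqrf_eq0 eq_le sqr_ge0 andbT -[z - z']addrC.
  have := sqr_ge0 (vnorm (T (- z' + z))); lra.
have /choice[F FP] : forall ab : H * H, exists z, proj ab.1 ab.2 z.
  by move=> [a b]; have [z Tz h] := graph_projection cT a b; exists z.
have Flin (c : R[i]) a b a' b' : F (c *: a + a', c *: b + b') = c *: F (a, b) + F (a', b').
  by apply: proj_uniq (FP (_, _)) _; apply: proj_lin; exact: (FP (_, _)).
have le1 (s t C D : R) : 0 <= s -> 0 <= C -> D = 0 -> s ^+ 2 + t ^+ 2 <= C ^+ 2 + D ^+ 2 -> s <= 1 * C.
  move=> s0 C0 -> h; rewrite mul1r -(@ler_pXn2r _ 2) ?nnegrE//.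
  have := sqr_ge0 t; rewrite expr0n addr0 in h; lra.
have bF a b := proj_bound _ _ _ (FP (a, b)).
have [|P bP PE] := @bounded_operatorE _ _ (fun a => F (a, 0)) 1.
  split=> [c x y|x]; first by rewrite -Flin scaler0 addr0.
  by apply: le1 (bF x 0); rewrite ?vnorm_ge0 ?vnorm0.
have [|P' bP' PE'] := @bounded_operatorE _ _ (fun b => F (0, b)) 1.
  split=> [c x y|x]; first by rewrite -Flin scaler0 addr0.
  by have := bF 0 x; rewrite [leRHS]addrC; apply: le1; rewrite ?vnorm_ge0 ?vnorm0.
have [|W bW WE] := @bounded_operatorE _ _ (fun a => T (F (a, 0))) 1.
  split=> [c x y|x].
    rewrite -app_linear; first by rewrite -Flin scaler0 addr0.
      by case: (FP (x, 0)). by case: (FP (y, 0)).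
  by have := bF x 0; rewrite [leLHS]addrC; apply: le1; rewrite ?vnorm_ge0 ?vnorm0.
have [|W' bW' WE'] := @bounded_operatorE _ _ (fun b => T (F (0, b))) 1.
  split=> [c x y|x].
    rewrite -app_linear; first by rewrite -Flin scaler0 addr0.
      by case: (FP (0, x)). by case: (FP (0, y)).
  by have := bF 0 x; rewrite [leLHS]addrC [leRHS]addrC; apply: le1; rewrite ?vnorm_ge0 ?vnorm0.
exists P, P', W, W'; split=> // a b z.
have zE : z = F (a, b).
  rewrite /z PE PE' -[F (a, 0)]scale1r -Flin; congr F.
  by rewrite !scale1r addr0 add0r.
have [Tz h] := FP (a, b); rewrite zE; split=> //.
rewrite WE WE' -appD; [|by case: (FP (a, 0))|by case: (FP (0, b))].
by congr (T _); rewrite -zE /z PE PE'.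
Qed.

Lemma commutant_bounded Y Q : commutant Y Q -> bounded_operator Q.
Proof. by case. Qed.

Lemma commutantE Y Q T x : commutant Y Q -> Y T -> dom T x -> dom T (Q x) /\ Q (T x) = T (Q x).
Proof. by move=> [_ h] /h; exact. Qed.

Lemma commutant2 Y Q : (forall T, Y T -> bounded_operator T) -> Y Q -> commutant (commutant Y) Q.
Proof.
move=> bY YQ; split; first exact: bY.
move=> T [bT h] x _; split; first exact: bounded_domE.
by have [_ ->] := h Q YQ x (bounded_domE (bY _ YQ) x).
Qed.

Section ClosedOperator.
Variables (Y : set (operator H)) (T T' : operator H).
Hypotheses (cT : seq_closed T) (YT : Y T) (YT' : Y T') (TT' : is_adjoint T T').

Lemma graph_unique a b z z' : dom T z -> dom T z' ->
  (forall w, dom T w -> inner (a - z) w + inner (b - T z) (T w) = 0) ->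
  (forall w, dom T w -> inner (a - z') w + inner (b - T z') (T w) = 0) -> z = z'.
Proof.
move=> Tz Tz' hz hz'.
apply/eqP; rewrite -subr_eq0; apply/eqP; apply: vnorm0_eq0.
have Td := domB Tz Tz'; have := hz' _ Td; have := hz _ Td.
have e1 u v c : inner (c - u) (z - z') - inner (c - v) (z - z') = inner (v - u) (z - z').
  by rewrite -innerBl opprB addrC addrA subrK.
have e2 u v c : inner (c - u) (T (z - z')) - inner (c - v) (T (z - z')) = inner (v - u) (T (z - z')).
  by rewrite -innerBl opprB addrC addrA subrK.
move=> k1 k2; have : inner (z' - z) (z - z') + inner (T z' - T z) (T (z - z')) = 0.
  by rewrite -(e1 _ _ a) -(e2 _ _ b) addrACA -opprD k1 k2 subrr.
rewrite -[z' - z]opprB -[T z' - T z]opprB -appB// !innerNl -opprD => /eqP.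
rewrite oppr_eq0 !inner_vnorm -rmorphD/= => /eqP/(congr1 (@complex.Re R))/= k.
apply/eqP; rewrite -sqrf_eq0 eq_le sqr_ge0 andbT.
have := sqr_ge0 (vnorm (T (z - z'))); lra.
Qed.

(* [P], [P'], [W], [W'] are the entries of the projection onto the graph of [T]. *)
Lemma graph_operators_commutant2 : exists P P' W W' : operator H,
  [/\ commutant (commutant Y) P, commutant (commutant Y) P', commutant (commutant Y) W
    & commutant (commutant Y) W'] /\
  forall a b, let z := P a + P' b in [/\ dom T z, T z = W a + W' b &
    forall w, dom T w -> inner (a - z) w + inner (b - T z) (T w) = 0].
Proof.
have [P [P' [W [W' [[bP bP' bW bW'] h]]]]] := graph_operators cT.
have cY V : commutant Y V -> forall a b, P (V a) + P' (V b) = V (P a + P' b) /\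
    W (V a) + W' (V b) = V (W a + W' b).
  move=> YV a b; have [bV _] := YV; have dV := bounded_domE bV.
  have [Tz Tze hz] := h a b; set z := P a + P' b in Tz Tze hz *.
  have [TVz VTz] := commutantE YV YT Tz.
  (* Orthogonality of (a - z, b - T z) to the graph says that b - T z is in the domain of the
     adjoint, with value z - a. As V commutes with T and with its adjoint, (V a - V z, V b - T (V
     z)) is again orthogonal to the graph, so V z is the solution for (V a, V b). *)
  have [T'y T'yE] : dom T' (b - T z) /\ T' (b - T z) = z - a.
    apply/TT' => w Tw; have := hz w Tw => /eqP; rewrite addrC addr_eq0 => /eqP ->.
    by rewrite -innerNl opprB.
  have [T'Vy VT'y] := commutantE YV YT' T'y.
  have [_ /(_ _)] := TT' (V (b - T z)) (V (z - a)).
  have hV : forall x, dom T x -> inner (V (b - T z)) (T x) = inner (V (z - a)) x.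
    by apply/TT'; split=> //; rewrite -VT'y T'yE.
  move=> _; have e : V z = P (V a) + P' (V b).
    have [Tz2 _ hz2] := h (V a) (V b); apply: graph_unique TVz Tz2 _ hz2 => w Tw.
    have := hV w Tw; rewrite appB// VTz => ->.
    by rewrite -innerDl -!appB// -appD// addrC addrA subrK subrr app0 inner0l.
  split=> //; have [_ <- _] := h (V a) (V b); rewrite -e -VTz; congr (V _).
  exact: Tze.
have c2 V : commutant Y V -> commutes V P /\ commutes V P' /\ commutes V W /\ commutes V W'.
  move=> YV; have [bV _] := YV; have dV := bounded_domE bV.
  have c := cY V YV.
  have [V0 [P0 [W0 [P0' W0']]]] : V 0 = 0 /\ P 0 = 0 /\ W 0 = 0 /\ P' 0 = 0 /\ W' 0 = 0.
    by rewrite !app0.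
  split; [|split; [|split]] => x _; split; try exact: dV.
  - by have [+ _] := c x 0; rewrite V0 P0' !addr0.
  - by have [+ _] := c 0 x; rewrite V0 P0 !add0r.
  - by have [_ +] := c x 0; rewrite V0 W0' !addr0.
  - by have [_ +] := c 0 x; rewrite V0 W0 !add0r.
have PYY : commutant (commutant Y) P by split=> // V /c2[].
have PYY' : commutant (commutant Y) P' by split=> // V /c2[_ []].
have WYY : commutant (commutant Y) W by split=> // V /c2[_ [_ []]].
have WYY' : commutant (commutant Y) W' by split=> // V /c2[_ [_ []]].
by exists P, P', W, W'.
Qed.

(** A pair (w, T w) is fixed by the graph projection. Since Q commutes with the four blocks, (Q w, Q
    (T w)) is fixed too, hence lies on the graph. *)
Lemma commutant3_closed Q : commutant (commutant (commutant Y)) Q -> commutes T Q.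
Proof.
move=> YQ; have bQ := commutant_bounded YQ; have dQ := bounded_domE bQ.
have [P [P' [W [W' [[PYY PYY' WYY WYY'] h]]]]] := graph_operators_commutant2.
have [[bP _] [bP' _] [bW _] [bW' _]] := And4 PYY PYY' WYY WYY'.
move=> w Tw.
have wE : w = P w + P' (T w).
  have [Tz _ hz] := h w (T w); apply: graph_unique Tw Tz _ hz => v Tv.
  by rewrite !subrr !inner0l addr0.
have [_ TwE _] := h w (T w); rewrite -wE in TwE.
have [TQ TQE _] := h (Q w) (Q (T w)).
have QwE : Q w = P (Q w) + P' (Q (T w)).
  rewrite {1}wE appD//.
  have [_ ->] := commutantE YQ PYY (bounded_domE bP w).
  by have [_ ->] := commutantE YQ PYY' (bounded_domE bP' (T w)).
rewrite -QwE in TQ TQE; split=> //.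
rewrite TQE {1}TwE appD//.
have [_ ->] := commutantE YQ WYY (bounded_domE bW w).
by have [_ ->] := commutantE YQ WYY' (bounded_domE bW' (T w)).
Qed.

(** The block [P] is the inverse of 1 + T^* T. If P a = 0, the orthogonality relation for (a, 0)
    says that a is orthogonal to [dom T]. *)
Lemma resolvent_in_commutant2 : densely_defined T -> exists P, [/\ commutant (commutant Y) P,
  forall a, dom T (P a) & forall a, P a = 0 -> a = 0].
Proof.
move=> dT; have [P [P' [W [W' [[PYY PYY' WYY WYY'] h]]]]] := graph_operators_commutant2.
exists P; split=> // a; first by have [+ _ _] := h a 0; rewrite app0 addr0.
move=> Pa; apply: (inner_all0 dT) => w Tw.
have [_ _ /(_ w Tw)] := h a 0; rewrite app0 Pa addr0 app0 !subr0 inner0l addr0.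
by [].
Qed.

End ClosedOperator.

End Affiliation.

(** * Cyclic and separating vectors *)

Section CyclicSubspaces.
Context d (S : measurableType d) (R : realType) (H : hilbertType R).
Variable E : spectral_measure S H.
Implicit Types (x y z u v w : H) (A B : set S) (D : set H).

Definition cyclic_orthogonal D u : Prop :=
  forall y A, D y -> measurable A -> inner u (E A y) = 0.

(** Closed linear span of the vectors E A y with y in [D], encoded as a double orthogonal
    complement: closedness and invariance under E are then immediate. *)
Definition cyclic_span D : set H :=
  [set v | forall u, cyclic_orthogonal D u -> inner u v = 0].

Lemma cyclic_orthogonal_spectral D u B : measurable B -> cyclic_orthogonal D u ->
  cyclic_orthogonal D (E B u).
Proof.
move=> mB h y A Dy mA; rewrite spectral_sym// spectralI//; apply: h => //.
exact: measurableI.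
Qed.

Lemma cyclic_span_subspace D : subspace (cyclic_span D).
Proof.
split=> [u _|a x y hx hy u hu|u x hu ux w hw]; first by rewrite inner0r.
  by rewrite innerDr innerZr hx// hy// mulr0 addr0.
rewrite inner_conj (inner_cvg ux) ?rmorph0// => n.
by rewrite inner_conj hu// rmorph0.
Qed.

Lemma cyclic_span_spectral D v B : measurable B -> cyclic_span D v -> cyclic_span D (E B v).
Proof.
move=> mB h u hu; rewrite -spectral_sym//; apply: h; exact: cyclic_orthogonal_spectral.
Qed.

Lemma cyclic_span_mem D y : D y -> cyclic_span D y.
Proof. by move=> Dy u hu; rewrite -(spectral_setT E y); exact: hu. Qed.

Lemma cyclic_span_mono D D' : D `<=` D' -> cyclic_span D `<=` cyclic_span D'.
Proof. by move=> DD' v h u hu; apply: h => y A /DD'; exact: hu. Qed.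

Lemma cyclic_span_null D v A : measurable A -> (forall y, D y -> E A y = 0) ->
  cyclic_span D v -> E A v = 0.
Proof.
move=> mA h hv; apply: inner_eq0; rewrite -spectral_sym// spectral_idem//; apply: hv => y B Dy mB.
by rewrite spectral_sym// spectral_comm// h// -(subrr y) spectralB// subrr inner0r.
Qed.

Lemma cyclic_projection D : exists q : operator H, [/\ bounded_operator q,
  forall x, cyclic_span D (q x), forall x, cyclic_orthogonal D (x - q x),
  forall x, cyclic_span D x -> q x = x &
  forall x B, measurable B -> q (E B x) = E B (q x)].
Proof.
have sK := cyclic_span_subspace D; have [_ Klin _] := sK.
have [q [bq Kq oq]] := projection_on sK; exists q.
have KB v w : cyclic_span D v -> cyclic_span D w -> cyclic_span D (v - w).
  by move=> hv hw; rewrite -scaleN1r addrC; exact: Klin.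
have q_uniq x v : cyclic_span D v -> (forall w, cyclic_span D w -> inner (x - v) w = 0) ->
    q x = v.
  move=> Kv h; apply/eqP; rewrite -subr_eq0; apply/eqP; apply: inner_eq0.
  have Kd : cyclic_span D (q x - v) by exact: KB.
  have e : q x - v = (x - v) - (x - q x) by rewrite opprB [RHS]addrC addrA subrK.
  by rewrite [X in inner X _]e innerBl h// oq// subrr.
split=> // [x y A Dy mA|x Kx|x B mB].
- by apply: oq; apply: cyclic_span_spectral => //; exact: cyclic_span_mem.
- by apply: q_uniq => // w _; rewrite subrr inner0l.
- apply: q_uniq => [|w Kw]; first exact: cyclic_span_spectral.
  by rewrite -spectralB// spectral_sym// oq//; exact: cyclic_span_spectral.
Qed.

(** Gram-Schmidt with cyclic subspaces in place of lines: [x n] is the part of [e n] orthogonal to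
    the cyclic span of the earlier vectors, so the cyclic spans of the [x n] are mutually
    orthogonal. If E A kills z, the sum of the c n x n, it kills every [x n], and by induction every
    [e n]. *)
Lemma separating_vector : separable H ->
  exists z, forall A, measurable A -> E A z = 0 -> forall x, E A x = 0.
Proof.
move=> [D /countable_injP[f finj] dD].
(* Enumeration of [D] along the injection [f]; indices outside its range give 0. *)
pose e n := xget 0 [set x | D x /\ f x = n].
have eD y : D y -> e (f y) = y.
  move=> Dy; rewrite /e; case: xgetP => [x _ [Dx fx]|/(_ y)[]//].
  by apply: finj => //; exact: mem_set.
pose below n : set H := [set y | exists2 k, (k < n)%N & y = e k].
have /choice[q qP] : forall n, exists q : operator H, [/\ bounded_operator q,
    forall x, cyclic_span (below n) (q x), forall x, cyclic_orthogonal (below n) (x - q x),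
    forall x, cyclic_span (below n) x -> q x = x &
    forall x B, measurable B -> q (E B x) = E B (q x)].
  by move=> n; exact: cyclic_projection.
pose x n := e n - q n (e n).
have Kx n m : (n < m)%N -> cyclic_span (below m) (x n).
  move=> nm; have [_ Klin _] := cyclic_span_subspace (below m).
  rewrite /x -scaleN1r addrC; apply: Klin.
    apply: (@cyclic_span_mono (below n)); last by have [_ h _ _ _] := qP n; exact: h.
    by move=> _ [k kn ->]; exists k => //; exact: ltn_trans nm.
  by apply: cyclic_span_mem; exists n.
have xx n m A : measurable A -> n <> m -> inner (x m) (E A (x n)) = 0.
  move=> mA /eqP; rewrite neq_ltn => /orP[nm|mn].
    have K := cyclic_span_spectral mA (Kx _ _ nm).
    by apply: K; have [_ _ h _ _] := qP m; exact: h.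
  have K := cyclic_span_spectral mA (Kx _ _ mn).
  by rewrite -spectral_sym// inner_conj K ?rmorph0//; have [_ _ h _ _] := qP n; exact: h.
(* Positive, so that no [x n] is lost in the sum, and small enough that the n-th term has norm at
   most 2^-n. *)
pose c n : R := (2 ^- n) / (1 + vnorm (x n)).
have c0 n : 0 < c n.
  by rewrite /c divr_gt0// ?invr_gt0 ?exprn_gt0// ltr_pwDl// vnorm_ge0.
pose s n := \sum_(0 <= k < n) (c k)%:C *: x k.
have cx n : vnorm ((c n)%:C *: x n) <= 2 ^- n.
  rewrite vnormZ normc_real ger0_norm ?(ltW (c0 n))// /c mulrAC ler_pdivrMr ?ltr_pwDl ?vnorm_ge0//.
  by rewrite ler_pM2l ?invr_gt0 ?exprn_gt0// lerDr.
have s_le n k : vnorm (s (n + k)%N - s n) <= 2 * (2 ^- n - 2 ^- (n + k)).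
  elim: k => [|k IH]; first by rewrite addn0 !subrr vnorm0 mulr0.
  rewrite addnS /s big_nat_recr ?leq_addr//= -/(s _) addrAC.
  apply: le_trans (vnormD _ _) _; apply: le_trans (lerD IH (cx _)) _.
  by rewrite (exprS _ (n + k)) invfM; lra.
have [z sz] : exists z, s n @[n --> \oo] --> z.
  apply: hcauchy_cvg => r r0.
  have [N _ hN] : \forall n \near \oo, 4 * 2 ^- n < r.
    have : (fun n => 4 * (2^-1 : R) ^+ n) @ \oo --> (4 * 0 : R).
      by apply: cvgMr; apply: cvg_expr; rewrite ger0_norm ?invr_ge0// invf_lt1// ltr1n.
    rewrite mulr0 => /cvgrPdist_lt/(_ _ r0); apply: filterS => n.
    rewrite sub0r normrN ger0_norm ?mulr_ge0 ?exprn_ge0 ?invr_ge0//.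
    by rewrite exprVn.
  have sN n : (N <= n)%N -> vnorm (s n - s N) <= 2 * 2 ^- N.
    move=> Nn; rewrite -(subnKC Nn); apply: le_trans (s_le _ _) _.
    by rewrite ler_pM2l// gerBl invr_ge0 exprn_ge0.
  exists N => m n Nm Nn; rewrite -(subrK (s N) (s m)) -addrA -[s N - s n]opprB.
  apply: le_lt_trans (vnormD _ _) _; rewrite vnormN.
  apply: le_lt_trans (lerD (sN _ Nm) (sN _ Nn)) _.
  apply: le_lt_trans (hN N (leqnn N)); lra.
exists z => A mA Az.
have zx n : inner z (E A (x n)) = (c n)%:C * inner (x n) (E A (x n)).
  have <- : inner ((c n)%:C *: x n) (E A (x n)) = (c n)%:C * inner (x n) (E A (x n)).
    by rewrite innerZl; congr (_ * _); exact: conjc_real.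
  apply/eqP; rewrite -subr_eq0 -innerBl; apply/eqP.
  have : s (n.+1 + k)%N - (c n)%:C *: x n @[k --> \oo] --> z - (c n)%:C *: x n.
    by apply: cvgB; [exact: (cvg_comp _ _ (cvg_addnl n.+1) sz)|exact: cvg_cst].
  move=> /inner_cvg; apply; elim => [|k IH].
    rewrite addn0 /s big_nat_recr//= addrK inner_suml big_nat big1// => k /andP[_ kn].
    by rewrite innerZl xx ?mulr0// => nk; rewrite nk ltnn in kn.
  rewrite addnS /s big_nat_recr//= -/(s _) addrAC innerDl IH innerZl xx ?mulr0 ?addr0//.
  by rewrite addSn => nk; have := leq_addr k n; rewrite -ltnS -nk ltnn.
have Ax n : E A (x n) = 0.
  apply: inner_eq0; rewrite spectral_sym// spectral_idem//.
  have := zx n; rewrite -spectral_sym// Az inner0l => /esym/eqP.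
  rewrite mulf_eq0 => /orP[/eqP[cn]|/eqP//].
  by have := c0 n; rewrite cn ltxx.
have Ae n : E A (e n) = 0.
  have [m] := ubnP n; elim: m n => // m IH n; rewrite ltnS => nm.
  have := Ax n; rewrite spectralB// => /eqP; rewrite subr_eq0 => /eqP ->.
  have [_ Kq _ _ _] := qP n; apply: cyclic_span_null (Kq _) => // _ [k kn ->].
  by apply: IH; exact: leq_trans nm.
move=> y; apply: (inner_all0 dD) => w Dw.
by rewrite spectral_sym// -(eD _ Dw) Ae inner0r.
Qed.

End CyclicSubspaces.

(** * Spectral densities and affiliated operators *)

Section CyclicVectors.
Context d (S : measurableType d) (R : realType) (H : hilbertType R).
Variable E : spectral_measure S H.
Implicit Types (x y z u v w : H) (A B : set S) (D : set H) (f g G : S -> R[i]) (Q T : operator H).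

Definition commutes_with_spectral Q : Prop :=
  forall A x, measurable A -> Q (E A x) = E A (Q x).

Lemma commutes_with_spectral_sets Q g : borel_measurable g -> commutes_with_spectral Q ->
  commutes_with_sets E Q g.
Proof.
by move=> mg cQ B mB x; apply: cQ; have := mg measurableT B mB; rewrite setTI.
Qed.

Lemma integral_spectral A x (f : S -> \bar R) : measurable A -> measurable_fun setT f ->
  (\int[vector_measure E (E A x)]_t f t = \int[vector_measure E x]_(t in A) f t)%E.
Proof.
move=> mA mf; rewrite [LHS]integralE [RHS]integralE !ge0_integral_spectral//.
- exact: measurable_funeneg.
- exact: measurable_funepos.
Qed.

Lemma vector_density x z : (forall A, measurable A -> E A z = 0 -> E A x = 0) ->
  exists h : S -> R, [/\ measurable_fun setT h, forall t, 0 <= h t,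
    (vector_measure E z).-integrable setT (EFin \o h) &
    forall A, measurable A ->
      ((vnorm (E A x) ^+ 2)%:E = \int[vector_measure E z]_(t in A) (h t)%:E)%E].
Proof.
move=> zx.
have dom_xz : vector_measure E x `<< vector_measure E z.
  apply/null_content_dominatesP => A mA; rewrite !(vector_measure_eq0 E _ mA).
  exact: zx.
have [f [f0 ffin fint fE]] := radon_nikodym_sigma_finite dom_xz.
have fK : EFin \o (fine \o f) = f by apply/funext => t /=; rewrite fineK.
exists (fine \o f); rewrite fK; split=> //.
- by apply/measurable_EFinP; rewrite fK; exact: measurable_int fint.
- by move=> t /=; rewrite fine_ge0.
- move=> A mA; rewrite -vector_measureE// -[LHS]/((vector_measure E x : set S -> \bar R) A) fE//.
  by apply: eq_integral => t _; rewrite -[in LHS]fK.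
Qed.

(** Polarization, Re <E A z, v> = (|E A (z + v)|^2 - |E A (z - v)|^2) / 4, reduces the signed
    density to two nonnegative Radon-Nikodym derivatives. *)
Lemma real_density v z : (forall A, measurable A -> E A z = 0 -> E A v = 0) ->
  exists k : S -> R, measurable_fun setT k /\
    forall A, measurable A ->
      complex.Re (inner (E A z) v) = \int[vector_measure E z]_(t in A) k t.
Proof.
move=> zv.
have [|h1 [mh1 h10 ih1 h1E]] := @vector_density (z + v) z.
  by move=> A mA Az; rewrite spectralD// Az zv// addr0.
have [|h2 [mh2 h20 ih2 h2E]] := @vector_density (z - v) z.
  by move=> A mA Az; rewrite spectralB// Az zv// subr0.
exists (fun t => 4^-1 * (h1 t - h2 t)); split.
  by apply: measurable_funM => //; exact: measurable_funB.
move=> A mA.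
have i1 : (vector_measure E z).-integrable A (EFin \o h1) by exact: integrableS ih1.
have i2 : (vector_measure E z).-integrable A (EFin \o h2) by exact: integrableS ih2.
rewrite RintegralZl//; last exact: (integrableB mA i1 i2).
rewrite RintegralB// /Rintegral -h1E// -h2E//=.
rewrite spectralD// spectralB// vnorm_sqrD vnorm_sqrD vnormN innerNr raddfN/=.
rewrite spectral_sym//.
have -> : inner z (E A v) = inner (E A z) (E A v).
  by rewrite spectral_sym// spectral_idem.
by field.
Qed.

Lemma inner_sint A B g z : measurable A -> measurable B -> borel_measurable g ->
  (sqint E (E A z) g < +oo)%E ->
  inner (E B z) (sint E g (E A z)) =
    (\int[vector_measure E z]_(t in B `&` A) complex.Re (g t)) +i*
    (\int[vector_measure E z]_(t in B `&` A) complex.Im (g t)).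
Proof.
move=> mA mB mg gA; have mBA : measurable (B `&` A) by exact: measurableI.
have [gBA sBA] := sint_spectral mB mg gA.
have -> : inner (E B z) (sint E g (E A z)) = inner (E (B `&` A) z) (sint E g (E (B `&` A) z)).
  have AW : E A (sint E g (E A z)) = sint E g (E A z).
    by have [_ <-] := sint_spectral mA mg gA; rewrite spectral_idem.
  rewrite -spectralI// sBA; move: AW; set W := sint _ _ _ => AW.
  rewrite spectral_sym// [RHS]spectral_sym// spectral_idem// [RHS]spectral_sym//.
  by rewrite [in RHS]spectral_comm// AW.
rewrite sint_inner//; last by rewrite -spectralI.
have /borel_measurableP[m1 m2] := mg.
by rewrite /Rintegral !integral_spectral//; apply/measurable_EFinP.
Qed.

Lemma spectral_exhaust_inj (F : (set S)^nat) x y : (forall n, measurable (F n)) ->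
  nondecreasing_seq F -> \bigcup_n F n = setT -> (forall n, E (F n) x = E (F n) y) -> x = y.
Proof.
move=> mF ndF FT xy; have c u : E (F n) u @[n --> \oo] --> u.
  by rewrite -[X in _ --> X](spectral_setT E) -FT; exact: spectral_cvg.
have cx := c x; rewrite (_ : (fun n => _) = (fun n => E (F n) y)) in cx; last exact/funext.
by have := cvg_unique _ cx (c y); apply; exact: norm_hausdorff.
Qed.

(** [g] is the density of the complex measure <E A z, v> with respect to the vector measure of z.
    Its square integrability is not known in advance: the identity is proved on the sets |g| <= n,
    where the norms are bounded by |v|, and monotone convergence removes the truncation. *)
Lemma cyclic_vector v z : cyclic_span E [set z] v ->
  exists g, [/\ borel_measurable g, (sqint E z g < +oo)%E & v = sint E g z].
Proof.
move=> Kv.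
have [q [bq Kq oq qK qE]] := cyclic_projection E [set z].
have zv A : measurable A -> E A z = 0 -> E A v = 0.
  by move=> mA Az; apply: cyclic_span_null Kv => // _ ->.
have [k1 [mk1 k1E]] := real_density zv.
(* Multiplying v by minus the imaginary unit turns Im <u, v> into a real part. *)
have [|k2 [mk2 k2E]] := @real_density (- 'i *: v) z.
  by move=> A mA Az; rewrite spectralZ// zv// scaler0.
pose g t := k1 t +i* k2 t.
have mg : borel_measurable g by apply/borel_measurableP.
have mF n : measurable (level g n) by exact: measurable_level.
have gF n : (sqint E (E (level g n) z) g < +oo)%E by exact: sqint_level.
have zin : cyclic_span E [set z] z by exact: cyclic_span_mem.
(* The difference of the two sides lies in the cyclic span of z and is orthogonal to every E B z, so
   it vanishes. *)
have vF n : sint E g (E (level g n) z) = E (level g n) v.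
  set w := sint _ _ _.
  have Kw : cyclic_span E [set z] w.
    have Kz := cyclic_span_spectral (mF n) zin.
    have cq : commutes_with_spectral q by move=> A x mA; exact: qE.
    have [_ ws] := sint_commute bq mg (commutes_with_spectral_sets mg cq) (gF n).
    by rewrite qK// in ws; rewrite /w ws; exact: Kq.
  have [_ Klin _] := cyclic_span_subspace E [set z].
  have Kd : cyclic_span E [set z] (w - E (level g n) v).
    by rewrite -scaleN1r addrC; apply: Klin => //; exact: cyclic_span_spectral.
  apply/eqP; rewrite -subr_eq0; apply/eqP; apply: inner_eq0.
  apply: (Kd) => _ B -> mB; rewrite inner_conj innerBr.
  rewrite /w inner_sint// -spectral_sym// spectral_comm// spectralI//.
  have mBF : measurable (B `&` level g n) by exact: measurableI.
  rewrite -k1E// -k2E// innerZr.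
  have e (c : R[i]) : complex.Re c +i* complex.Re (- 'i * c) = c.
    by case: c => r s /=; congr (_ +i* _); ring.
  by rewrite e subrr rmorph0.
have gz : (sqint E z g < +oo)%E.
  apply: (@le_lt_trans _ _ (vnorm v ^+ 2)%:E); last exact: ltry.
  apply: (sqint_sup mg mF (@level_nd _ _ _ g) (@level_cup _ _ _ g)) => n.
  rewrite sint_norm// vF lee_fin lerXn2r ?nnegrE ?vnorm_ge0//.
  exact: spectral_contract.
exists g; split=> //.
apply: (spectral_exhaust_inj mF (@level_nd _ _ _ g) (@level_cup _ _ _ g)) => n.
by rewrite -vF; exact: (sint_spectral (mF n) mg gz).2.
Qed.

Definition separating z : Prop :=
  forall A, measurable A -> E A z = 0 -> forall x, E A x = 0.

Section Dominated.
Variables (y z : H) (C : R).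
Hypotheses (C0 : 0 <= C)
  (yz : forall A, measurable A -> vnorm (E A y) ^+ 2 <= C * vnorm (E A z) ^+ 2).

Lemma sqint_dominated g : borel_measurable g -> (sqint E y g <= C%:E * sqint E z g)%E.
Proof.
move=> mg; pose k : {nonneg R} := NngNum C0.
have -> : (C%:E * sqint E z g = \int[mscale k (vector_measure E z)]_t (normc (g t) ^+ 2)%:E)%E.
  rewrite ge0_integral_mscale//; first exact: measurable_sq.
  by move=> t _; rewrite lee_fin sqr_ge0.
apply: ge0_le_measure_integral => //; last exact: measurable_sq.
- move=> A mA; rewrite [leLHS](vector_measureE E y mA).
  rewrite /mscale [X in (_ <= _ * X)%E](vector_measureE E z mA) lee_fin.
  exact: yz.
- by move=> t; rewrite lee_fin sqr_ge0.
Qed.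

(* The operator sends [sint G z] to [sint G y] and kills the orthogonal
   complement of the cyclic span of [z]. *)
Lemma dominated_intertwiner : exists Q,
  [/\ bounded_operator Q, commutes_with_spectral Q & Q z = y].
Proof.
have [q [bq Kq oq qK qE]] := cyclic_projection E [set z].
(* [G x] is some function representing the projection of x; [uniq] makes the integral at y
   independent of this choice, whence linearity and commutation with E. *)
have /choice[G GP] : forall x, exists g,
    [/\ borel_measurable g, (sqint E z g < +oo)%E & q x = sint E g z].
  by move=> x; exact: cyclic_vector.
have y_fin g : borel_measurable g -> (sqint E z g < +oo)%E -> (sqint E y g < +oo)%E.
  move=> mg gz; apply: le_lt_trans (sqint_dominated mg) _.
  by rewrite sint_norm// -EFinM ltry.
have le g : borel_measurable g -> (sqint E z g < +oo)%E ->
    vnorm (sint E g y) ^+ 2 <= C * vnorm (sint E g z) ^+ 2.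
  move=> mg gz; have := sqint_dominated mg.
  by rewrite (sint_norm mg gz) (sint_norm mg (y_fin _ mg gz)) -EFinM lee_fin.
have uniq g g' : borel_measurable g -> (sqint E z g < +oo)%E ->
    borel_measurable g' -> (sqint E z g' < +oo)%E ->
    sint E g z = sint E g' z -> sint E g y = sint E g' y.
  move=> mg gz mg' gz' e; pose h t := -1 * g' t + g t.
  have mh : borel_measurable h.
    by apply: borel_measurableD => //; apply: borel_measurableM => //; exact: borel_measurable_cst.
  have hz : (sqint E z h < +oo)%E by exact: sqint_linear.
  have hE x : (sqint E x g < +oo)%E -> (sqint E x g' < +oo)%E ->
      sint E h x = sint E g x - sint E g' x.
    by move=> gx gx'; rewrite sint_fun_linear// scaleN1r addrC.
  have := le h mh hz; rewrite !hE ?y_fin// e subrr vnorm0 expr0n mulr0 => h0.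
  apply/eqP; rewrite -subr_eq0; apply/eqP; apply: vnorm0_eq0; apply/eqP.
  by rewrite -sqrf_eq0 eq_le sqr_ge0 andbT.
have [M M0 qM] := bounded_vnorm bq.
have [|Q bQ QE] := @bounded_operatorE _ _ (fun x => sint E (G x) y) (Num.sqrt C * M).
  split=> [a x x'|x].
    have [mG Gz e] := GP (a *: x + x'); have [m1 z1 e1] := GP x; have [m2 z2 e2] := GP x'.
    rewrite -sint_fun_linear ?y_fin//; apply: uniq => //.
    - by apply: borel_measurableD => //; apply: borel_measurableM => //; exact: borel_measurable_cst.
    - exact: sqint_linear.
    - by rewrite -e sint_fun_linear// -e1 -e2 app_linear//; exact: bounded_domE.
  have [mG Gz e] := GP x; have := le _ mG Gz; rewrite -e => h.
  rewrite -(@ler_pXn2r _ 2) ?nnegrE ?vnorm_ge0// ?mulr_ge0 ?sqrtr_ge0 ?vnorm_ge0//.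
  apply: le_trans h _; rewrite !exprMn sqr_sqrtr// -mulrA ler_wpM2l// -exprMn.
  by rewrite lerXn2r ?nnegrE ?vnorm_ge0// ?mulr_ge0 ?vnorm_ge0.
exists Q; split=> // [A x mA|].
  rewrite !QE; have [m1 z1 e1] := GP x; have [m2 z2 e2] := GP (E A x).
  have [f1 <-] := sint_indicM mA m1 (y_fin _ m1 z1).
  have [f2 e3] := sint_indicM mA m1 z1.
  apply: uniq => //; first exact: borel_measurable_indicM.
  by rewrite -e2 e3 qE// e1.
have [f1 e1] := sint1 E z; have [f2 e2] := sint1 E y.
rewrite QE -[RHS]e2; have [m z' e] := GP z; apply: uniq => //.
  exact: borel_measurable_cst.
by rewrite e1 -e qK//; exact: cyclic_span_mem.
Qed.

End Dominated.

(** On truncated vectors T and J_f agree, both being computed from T z = J_f z through an operator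
    commuting with E. For y in [dom T] the bound |T y| puts y in the domain of J_f; the reverse
    inclusion of domains is where closedness of T acts. *)
Lemma affiliated_is_sint T z : separating z -> seq_closed T -> dom T z ->
  (forall Q, bounded_operator Q -> commutes_with_spectral Q -> commutes T Q) ->
  exists2 f, borel_measurable f & is_sint E f T.
Proof.
move=> sz cT Tz TQ.
have cE A : measurable A -> commutes T (E A).
  move=> mA; apply: TQ => [|B x mB]; first exact: spectral_bounded.
  by rewrite spectral_comm.
have [q [bq Kq oq qK qE]] := cyclic_projection E [set z].
(* The projection q onto the cyclic span of z commutes with E, hence with T: T z = T (q z) = q (T z)
   lies in that span. *)
have [|f [mf fz Tzf]] := @cyclic_vector (T z) z.
  have [_ h] := TQ q bq (fun A x mA => qE x A mA) z Tz.
  by rewrite -[z in T z]qK -?h//; exact: cyclic_span_mem.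
have level_spec y : exists F : (set S)^nat, [/\ forall n, measurable (F n), nondecreasing_seq F,
    \bigcup_n F n = setT & forall n, [/\ dom T (E (F n) y), (sqint E (E (F n) y) f < +oo)%E
      & T (E (F n) y) = sint E f (E (F n) y)]].
  have [h [mh h0 ih hE]] := @vector_density y z (fun A mA Az => sz A mA Az y).
  (* Where the density h of the measure of y against that of z is at most n, the measure of E (F n)
     y is dominated by n times that of z; this provides Q with Q z = E (F n) y. *)
  pose F n := [set t | h t <= n%:R].
  have mF n : measurable (F n).
    have := mh measurableT _ (measurable_itv `]-oo, n%:R]); rewrite setTI.
    by congr measurable; apply/seteqP; split=> t /=; rewrite in_itv.
  exists F; split=> //.
  - by move=> m n mn; apply/subsetPset => t /= /le_trans; apply; rewrite ler_nat.
  - apply/seteqP; split=> // t _; exists (Num.bound (h t)) => //=.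
    by apply: le_trans (ltW (archi_boundP (h0 t))).
  move=> n; have [|A mA|Q [bQ cQ Qz]] := @dominated_intertwiner (E (F n) y) z n%:R.
  - by [].
  - rewrite spectralI//; have mAF : measurable (A `&` F n) by exact: measurableI.
    rewrite -lee_fin hE//.
    apply: (@le_trans _ _ (\int[vector_measure E z]_(t in A `&` F n) (cst n%:R%:E t))%E).
      apply: ge0_le_integral => //.
      - by move=> t _; rewrite lee_fin.
      - by apply: measurable_funTS; exact/measurable_EFinP.
      - by move=> t [_ Ft]; rewrite lee_fin.
    rewrite integral_cst// [X in (_ * X)%E](vector_measureE E z mAF) -EFinM lee_fin ler_wpM2l//.
    rewrite lerXn2r ?nnegrE ?vnorm_ge0// -spectralI// spectral_comm//.
    exact: spectral_contract.
  have [dTy Qy] := TQ Q bQ cQ z Tz; rewrite -Qz; split=> //.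
    by have [] := sint_commute bQ mf (commutes_with_spectral_sets mf cQ) fz.
  by rewrite -Qy Tzf; have [_ ->] := sint_commute bQ mf (commutes_with_spectral_sets mf cQ) fz.
have domT y : dom T y -> (sqint E y f < +oo)%E /\ T y = sint E f y.
  move=> Ty; have [F [mF ndF FT hF]] := level_spec y.
  have fy : (sqint E y f < +oo)%E.
    apply: (@le_lt_trans _ _ (vnorm (T y) ^+ 2)%:E); last exact: ltry.
    apply: (sqint_sup mf mF ndF FT) => n; have [_ fn Tn] := hF n.
    rewrite sint_norm// -Tn lee_fin lerXn2r ?nnegrE ?vnorm_ge0//.
    by have [_ <-] := cE _ (mF n) y Ty; exact: spectral_contract.
  split=> //; apply: (spectral_exhaust_inj mF ndF FT) => n; have [_ fn Tn] := hF n.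
  have [_ ->] := cE _ (mF n) y Ty; rewrite Tn; exact: (sint_spectral (mF n) mf fy).2.
exists f => //; split=> [|y /domT[]//]; apply/seteqP; split=> [y /domT[]//|y /= fy].
have [F [mF ndF FT hF]] := level_spec y.
have c u : E (F n) u @[n --> \oo] --> u.
  by rewrite -[X in _ --> X](spectral_setT E) -FT; exact: spectral_cvg.
have [] // := cT (fun n => E (F n) y) y (sint E f y) _ (c y); first by move=> n; have [] := hF n.
rewrite (_ : (fun n => _) = (fun n => E (F n) (sint E f y))); first exact: c.
by apply/funext => n; have [_ _ ->] := hF n; exact: (sint_spectral (mF n) mf fy).2.
Qed.

End CyclicVectors.

(** * The two commutants *)

Section SpectralCommutant.
Context d (S : measurableType d) (R : realType) (H : hilbertType R).
Variable E : spectral_measure S H.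
Implicit Types (x y z u v w : H) (A B : set S) (f g : S -> R[i]) (Q T : operator H).

(** Moves commutation from T and the adjoint of Q to the adjoint of T and Q; the adjoints of X are
    handled through it. *)
Lemma adjoint_commutes T T' Q Q' : is_adjoint T T' ->
  (forall x y, inner (Q' x) y = inner x (Q y)) -> commutes T Q' -> commutes T' Q.
Proof.
move=> aT QQ' cT y T'y.
have h : forall x, dom T x -> inner (Q y) (T x) = inner (Q (T' y)) x.
  move=> x Tx; have [Tx' e] := cT x Tx.
  have sym u v : inner (Q u) v = inner u (Q' v) by rewrite inner_conj -QQ' -inner_conj.
  rewrite !sym e; have [k _] := aT y (T' y).
  by rewrite k.
by have [_ k] := aT (Q y) (Q (T' y)); have [T'Q <-] := k h.
Qed.

Lemma commutes_with_spectral_adjoint Q Q' : (forall x y, inner (Q' x) y = inner x (Q y)) ->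
  commutes_with_spectral E Q -> commutes_with_spectral E Q'.
Proof.
move=> QQ' cQ A x mA; apply: inner_ext => w.
by rewrite QQ' !spectral_sym// QQ' cQ.
Qed.

Lemma is_sint_commutes g T Q : borel_measurable g -> is_sint E g T -> bounded_operator Q ->
  commutes_with_sets E Q g -> commutes T Q.
Proof.
move=> mg [dT eT] bQ cQ x Tx.
have gx : (sqint E x g < +oo)%E by move: Tx; rewrite dT.
have [gQ sQ] := sint_commute bQ mg cQ gx.
have TQ : dom T (Q x) by rewrite dT.
by split=> //; rewrite !eT.
Qed.

Lemma spectral_adjoint A T' : measurable A -> is_adjoint (E A) T' -> T' = E A.
Proof.
move=> mA aT; have h y : dom T' y /\ T' y = E A y.
  by apply/aT => x _; rewrite spectral_sym.
apply: operator_ext => [|x]; last by have [] := h x.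
have [[-> _] _ _] := spectral_proj E mA.
by apply/seteqP; split=> // x _; have [] := h x.
Qed.

Lemma commutant_spectralP Q :
  commutant (spectral_projections E `|` adjoints (spectral_projections E)) Q <->
  bounded_operator Q /\ commutes_with_spectral E Q.
Proof.
split=> [[bQ h]|[bQ cQ]]; split=> //.
  move=> A x mA; have [] := h (E A) _ x (spectral_dom E x mA) => //.
  by left; exists A.
have c A : measurable A -> commutes (E A) Q.
  by move=> mA x _; split; [exact: spectral_dom|exact: cQ].
move=> T [[A mA <-]|[_ [A mA <-] aT]]; first exact: c.
by rewrite (spectral_adjoint mA aT); exact: c.
Qed.

Lemma spectral_projections_bounded T :
  (spectral_projections E `|` adjoints (spectral_projections E)) T -> bounded_operator T.
Proof.
move=> [[A mA <-]|[_ [A mA <-] aT]]; first exact: spectral_bounded.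
by rewrite (spectral_adjoint mA aT); exact: spectral_bounded.
Qed.

Lemma E_null_bigcup (N : (set S)^nat) : (forall n, E_null E (N n)) -> E_null E (\bigcup_n N n).
Proof.
move=> h; have mN n : measurable (N n) by case: (h n).
have mU : measurable (\bigcup_n N n) by exact: bigcupT_measurable.
split=> // x; apply/vector_measure_eq0 => //.
apply: measure_negligible => //; apply: negligible_bigcup => n.
by exists (N n); split=> //; apply/vector_measure_eq0 => //; case: (h n).
Qed.

Lemma E_nullU A B : E_null E A -> E_null E B -> E_null E (A `|` B).
Proof.
move=> hA hB; rewrite -bigcup2E; apply: E_null_bigcup => -[|[|n]] //=.
by split=> [|x]; [exact: measurable0|exact: spectral_val0].
Qed.

Lemma E_null0 : E_null E set0.
Proof. by split=> [|x]; [exact: measurable0|exact: spectral_val0]. Qed.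

Lemma E_null_countable (I : Type) (N : I -> set S) : countable [set: I] ->
  (forall i, E_null E (N i)) -> E_null E (\bigcup_i N i).
Proof.
move=> /countable_injP[e einj] h.
have -> : \bigcup_i N i = \bigcup_n [set s | exists2 i, e i = n & N i s].
  apply/seteqP; split=> [s [i _ Ns]|s [n _ [i _ Ns]]]; last by exists i.
  by exists (e i) => //; exists i.
apply: E_null_bigcup => n; have [[i ei]|ne] := pselect (exists i, e i = n).
  rewrite (_ : [set _ | _] = N i)//; apply/seteqP; split=> [s [j ej Ns]|s Ns]; last by exists i.
  by have <- : j = i by apply: einj; rewrite ?in_setT// ei.
rewrite (_ : [set _ | _] = set0); first exact: E_null0.
by apply/seteqP; split=> // s [i ei _]; apply: ne; exists i.
Qed.

Section Generates.
Variable X : set (operator H).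
Hypotheses (sE : standard_spectral_measure E)
  (X_sint : forall T, X T -> exists f : S -> option R[i],
     E_measurable E f /\ is_spectral_integral E f T).

Lemma E_measurable_sint (f : S -> option R[i]) T : E_measurable E f ->
  is_spectral_integral E f T -> exists g N, [/\ borel_measurable g, E_null E N,
    forall s, ~ N s -> f s = Some (g s) & is_sint E g T].
Proof.
move=> [g mg [N N0 fg]] fT; exists g, N; split=> //.
by apply/(E_measurable_is_sint T mg N0 fg).
Qed.

Lemma commutant_subset_of_sint Q : bounded_operator Q -> commutes_with_spectral E Q ->
  commutant (X `|` adjoints X) Q.
Proof.
move=> bQ cQ; split=> //.
have c T Z : X T -> bounded_operator Z -> commutes_with_spectral E Z -> commutes T Z.
  move=> /X_sint[f [mf fT]] bZ cZ.
  have [g [N [mg N0 fg gT]]] := E_measurable_sint mf fT.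
  exact: is_sint_commutes gT bZ (commutes_with_spectral_sets mg cZ).
move=> T [XT|[T0 XT aT]]; first exact: c.
have [Q' bQ' QQ'] := bounded_adjoint bQ.
have cQ' := commutes_with_spectral_adjoint QQ' cQ.
exact: adjoint_commutes aT QQ' (c _ _ XT bQ' cQ').
Qed.

Lemma commutant_of_separating (I : Type) (f : I -> S -> option R[i]) Q :
  (forall i, E_measurable E (f i)) -> E_separating E f ->
  (forall i, exists2 T, X T & is_spectral_integral E (f i) T) ->
  commutant (X `|` adjoints X) Q -> commutes_with_spectral E Q.
Proof.
move=> mf [fdom cI [N N0 [_ sep]]] fX [bQ cQ].
have /choice[T TP] : forall i, exists T, X T /\ is_spectral_integral E (f i) T.
  by move=> i; have [T] := fX i; exists T.
have /choice[g gP] : forall i, exists g, exists N, [/\ borel_measurable g, E_null E N,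
    forall s, ~ N s -> f i s = Some (g s) & is_sint E g (T i)].
  by move=> i; apply: E_measurable_sint => //; case: (TP i).
have /choice[M MP] := gP.
(* Each f i agrees with its Borel version only off its own null set; countability of the family
   keeps the union null. *)
have M0 : E_null E (\bigcup_i M i) by apply: E_null_countable => // i; case: (MP i).
move=> A x mA.
have mg i : borel_measurable (g i) by case: (MP i).
have gT i : is_sint E (g i) (T i) by case: (MP i).
have cT i : commutes (T i) Q by apply: cQ; left; case: (TP i).
have [|_ ->//] := commutes_separating_spectral sE cI bQ mg gT cT (E_nullU N0 M0) _ mA.
move=> s t Ns Nt st.
apply: contrapT => nst.
have [i fi] := sep s t (fun h => Ns (or_introl h)) (fun h => Nt (or_introl h)) nst.
apply: fi; have [_ _ fg _] := MP i; rewrite !fg ?st//.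
  by move=> h; apply: Nt; right; exists i.
by move=> h; apply: Ns; right; exists i.
Qed.

End Generates.

End SpectralCommutant.

(** * Countable supports, countable bases and restriction to sub-sigma-algebras *)

Lemma sigma_algebra_countable_support (T J K : Type) (X : set J) (phi : J -> T -> K)
    (G : set (set T)) :
  (forall A, G A -> exists2 j, X j & forall s t, phi j s = phi j t -> A s -> A t) ->
  forall A, <<s G >> A -> exists Y, [/\ countable Y, Y `<=` X &
    forall s t, (forall j, Y j -> phi j s = phi j t) -> A s -> A t].
Proof.
move=> GX; apply: smallest_sub; last first.
  move=> A /GX[j Xj h]; exists [set j]; split=> [|k -> //|s t st].
    exact/finite_set_countable/finite_set1.
  by apply: h; exact: st.
split.
- by exists set0; split=> //; exact: countable0.
- move=> A [Y [cY YX h]]; exists Y; split=> // s t st [_ nA]; split=> // At.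
  by apply: nA; apply: h At => j /st.
move=> A /choice[Y YP]; exists (\bigcup_n Y n); split.
- by apply: bigcup_countable => [|n _]; [exact: countableP|case: (YP n)].
- by move=> j [n _]; case: (YP n) => _ + _ => /[apply].
move=> s t st [n _ As]; exists n => //; have [_ _ h] := YP n.
by apply: h As => j Yj; apply: (st); exists n.
Qed.

Section StandardBase.
Context d (S : measurableType d) (R : realType) (H : hilbertType R).
Variable E : spectral_measure S H.

(** Small balls around points of a dense set separate points. The one-sided implication suffices: a
    ball containing s of diameter below the distance of s and t excludes t. *)
Lemma standard_countable_base : standard_spectral_measure E ->
  exists (A : nat -> set S) N, [/\ forall j, measurable (A j), E_null E N &
    forall s t, ~ N s -> ~ N t -> (forall j, A j s -> A j t) -> s = t].
Proof.
move=> [S' [mS' S'0 [c [Mc [D cD dD] GE]]]].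
pose M : metricType R := Metric.Pack c.
pose iota : M -> S := @set_val S S'.
have [e einj] := countable_injP _ cD.
(* [e] is injective on [D], so this union is the ball around the point numbered j.1, or empty if
   there is none. *)
pose O (j : nat * nat) : set M :=
  \bigcup_(u in [set u : M | D u /\ e u = j.1]) (ball u (j.2.+1%:R^-1)).
have oO j : open (O j) by apply: bigcup_open => u _; exact: open_mball.
have /choice[A AP] : forall j, exists A, measurable A /\ O j = iota @^-1` A.
  move=> j; have : <<s @open M >> (O j) by exact: sub_sigma_algebra.
  by have := GE; rewrite /M => <- [A mA <-]; exists A; split=> //; rewrite setTI.
exists (fun n => oapp A set0 (choice.unpickle n)), (~` S'); split=> //.
  by move=> n; case: choice.unpickle => [j|] /=; [case: (AP j)|exact: measurable0].
move=> s t /contrapT Ss /contrapT St st.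
pose s' : M := exist _ s (mem_set Ss); pose t' : M := exist _ t (mem_set St).
suff : s' = t' by move=> /(congr1 iota).
apply: contrapT => /eqP st'; have r0 : 0 < mdist s' t' by rewrite mdist_gt0.
pose n := Num.bound (mdist s' t' / 2)^-1.
have nr : n.+1%:R^-1 < mdist s' t' / 2.
  rewrite -[ltRHS]invrK ltf_pV2 ?posrE ?invr_gt0 ?divr_gt0//.
  apply: lt_le_trans (archi_boundP _) _; first by rewrite invr_ge0 ltW// divr_gt0.
  by rewrite ler_nat.
have n0 : 0 < n.+1%:R^-1 :> R by rewrite invr_gt0.
have [u [su Du]] : (ball s' (n.+1%:R^-1) `&` D) !=set0.
  by apply: dD; [exists s'; exact: ballxx|exact: open_mball].
have [_ AO] := AP (e u, n).
have h : O (e u, n) s' -> O (e u, n) t'.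
  rewrite AO /preimage/=; have -> : iota s' = s by [].
  have -> : iota t' = t by [].
  by have := st (choice.pickle (e u, n)); rewrite choice.pickleK.
have [|v [Dv ev]] := h.
  by exists u => //; exact: ball_sym.
have -> : v = u by apply: einj ev; exact: mem_set.
move=> ut; move: su ut; rewrite !ballEmdist/= => su ut.
have := metric_triangle s' u t'; move: nr su ut.
have e2 : mdist s' t' = mdist s' t' / 2 + mdist s' t' / 2 by exact: splitr.
move=> nr su ut; apply/negP; rewrite -ltNge [ltRHS]e2.
by apply: ltrD; [exact: lt_trans su nr|exact: lt_trans ut nr].
Qed.

End StandardBase.

Section SubSigmaAlgebra.
Context d (S : measurableType d) (R : realType) (H : hilbertType R).
Variables (E : spectral_measure S H) (G : set (set S)).
Hypothesis Gm : G `<=` @measurable _ S.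

Lemma sub_measurable A : <<s G >> A -> measurable A.
Proof.
apply: smallest_sub Gm A; exact: sigma_algebra_measurable.
Qed.

Let proj (A : set (g_sigma_algebraType G)) : measurable A -> orthogonal_projection (E A).
Proof. by move=> /sub_measurable; exact: spectral_proj. Qed.

Let sadd (F : (set (g_sigma_algebraType G))^nat) :
  (forall n, measurable (F n)) -> trivIset setT F -> forall x : H,
  series (fun n => E (F n) x) @ \oo --> E (\bigcup_n F n) x.
Proof. move=> mF tF x.
exact: (@spectral_sigma_additive _ _ _ _ E F (fun n => sub_measurable (mF n)) tF x). Qed.

(** The same projections on [S] carrying the smaller sigma-algebra generated by [G]. *)
Definition sub_spectral_measure : spectral_measure (g_sigma_algebraType G) H :=
  SpectralMeasure proj sadd (spectral_setT E).

End SubSigmaAlgebra.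

Section Support.
Context d (S : measurableType d) (R : realType) (H : hilbertType R).
Variable E : spectral_measure S H.
Implicit Types (x y z u v w : H) (A B : set S) (f g : S -> R[i]) (Q T : operator H).

(** The set is where g is nonzero, the union of the sets |g| > 1/(n+1). It turns a representation of
    a projection E A as an integral into a measurable set equal to A up to a null set. *)
Lemma is_sint_support g T : borel_measurable g -> is_sint E g T ->
  exists A, [/\ measurable A, forall x, dom T x -> T x = 0 -> E A x = 0 &
    forall x, T (E (~` A) x) = 0].
Proof.
move=> mg [dT hT].
pose F n := ~` [set t | normc (g t - 0) <= n.+1%:R^-1].
have mF n : measurable (F n) by apply: measurableC; exact: measurable_le_normc.
have ndF : nondecreasing_seq F.
  move=> m n mn; apply/subsetPset => t Fm Fn; apply: Fm.
  by apply: le_trans Fn _; rewrite lef_pV2 ?posrE// ler_nat.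
have mU : measurable (\bigcup_n F n) by exact: bigcupT_measurable.
exists (\bigcup_n F n); split=> // [x Tx T0|x].
  have gx : (sqint E x g < +oo)%E by move: Tx; rewrite dT.
  have Fx n : E (F n) x = 0.
    apply: vnorm0_eq0; apply/eqP; rewrite -sqrf_eq0; apply/eqP.
    have [gF sF] := sint_spectral (mF n) mg gx.
    have r0 : 0 < n.+1%:R^-1 :> R by rewrite invr_gt0.
    have := sqint_ge_cst E x (mF n) mg (ltW r0).
    rewrite (sint_norm mg gF) sF -hT// T0 -(subrr x) spectralB// subrr vnorm0 expr0n lee_fin.
    have hF t : F n t -> n.+1%:R^-1 <= normc (g t).
      by move=> /negP; rewrite subr0 -ltNge => /ltW.
    move=> /(_ hF) h; apply/eqP; rewrite eq_le sqr_ge0 andbT.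
    by move: h; rewrite pmulr_rle0// exprn_gt0.
  have c := @spectral_cvg _ _ _ _ E F x mF ndF.
  rewrite (_ : (fun n => _) = (fun=> 0)) in c; last exact/funext.
  by have := cvg_unique _ c (cvg_cst _); apply; exact: norm_hausdorff.
have mC : measurable (~` \bigcup_n F n) by exact: measurableC.
have g0 t : (~` \bigcup_n F n) t -> normc (g t) <= 0.
  move=> nt; rewrite leNgt; apply/negP => gt0; apply: nt.
  exists (Num.bound (normc (g t))^-1) => //; apply/negP; rewrite subr0 -ltNge.
  rewrite -[ltRHS]invrK ltf_pV2 ?posrE ?invr_gt0//.
  apply: lt_le_trans (archi_boundP _) _; first by rewrite invr_ge0 ltW.
  by rewrite ler_nat.
have := sqint_le_cst E x mC mg (lexx 0) g0; rewrite expr0n mul0r => h.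
have gC : (sqint E (E (~` \bigcup_n F n) x) g < +oo)%E by apply: le_lt_trans h _; exact: ltry.
have TC : dom T (E (~` \bigcup_n F n) x) by rewrite dT.
rewrite hT//; apply: vnorm0_eq0; apply/eqP; rewrite -sqrf_eq0 eq_le sqr_ge0 andbT.
by move: h; rewrite (sint_norm mg gC) lee_fin.
Qed.

End Support.

(** * Necessity: representing and separating functions from equal double commutants *)

Section Necessity.
Context d (S : measurableType d) (R : realType) (H : hilbertType R).
Variables (E : spectral_measure S H) (X : set (operator H)).
Hypotheses (hH : separable H) (hE : standard_spectral_measure E)
  (hX : forall T, X T -> closed_operator T /\ densely_defined T)
  (hG : generated_vN X = generated_vN (spectral_projections E)).

(** Q is in the commutant of the spectral projections, hence in their triple commutant, which by
    [hG] is the triple commutant of X and its adjoints. *)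
Lemma generators_commute T Q : X T -> bounded_operator Q -> commutes_with_spectral E Q ->
  commutes T Q.
Proof.
move=> XT bQ cQ; have [cT dT] := hX XT; have [T' aT] := adjoint_exists dT.
have QP := (commutant_spectralP E Q).2 (conj bQ cQ).
have := commutant2 (@commutant_bounded _ _ _) QP.
change (commutant (generated_vN (spectral_projections E)) Q -> commutes T Q).
rewrite -hG; apply: (commutant3_closed (closed_operator_seq cT) _ _ aT); first by left.
by right; exists T.
Qed.

Lemma generators_sint T : X T -> exists2 g, borel_measurable g & is_sint E g T.
Proof.
move=> XT; have [cT dT] := hX XT; have [T' aT] := adjoint_exists dT.
have sT := closed_operator_seq cT.
have [||P [PYY TP P0]] := @resolvent_in_commutant2 _ _ (X `|` adjoints X) T T' sT _ _ aT dT.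
- by left.
- by right; exists T.
have {}PYY : commutant (commutant (spectral_projections E `|` adjoints (spectral_projections E))) P.
  by change (generated_vN (spectral_projections E) P); rewrite -hG.
have [x sx] := separating_vector E hH.
(* [P x] is separating because [P] is injective and commutes with E A: if E A kills P x, then P (E A
   x) = 0, so E A x = 0. *)
apply: (@affiliated_is_sint _ _ _ _ E T (P x)) => // [A mA APx|Q bQ cQ].
  apply: sx => //; apply: P0.
  have EP : commutant (spectral_projections E `|` adjoints (spectral_projections E)) (E A).
    apply/commutant_spectralP; split=> [|B y mB]; first exact: spectral_bounded.
    by rewrite spectral_comm.
  by have [_ ->] := commutantE PYY EP (spectral_dom E x mA).
exact: generators_commute.
Qed.

Lemma E_separating_generators : exists (I : Type) (f : I -> S -> option R[i]),
  [/\ forall i, E_measurable E (f i), E_separating E f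
    & forall i, exists2 T, X T & is_spectral_integral E (f i) T].
Proof.
have /choice[g gP] : forall T, exists g, X T -> borel_measurable g /\ is_sint E g T.
  move=> T; have [XT|nX] := pselect (X T); last by exists (cst 0).
  by have [g mg gT] := generators_sint XT; exists g.
pose G : set (set S) := [set A | exists2 T, X T & exists2 B : set (complexB R),
  measurable B & A = g T @^-1` B].
have Gm : G `<=` @measurable _ S.
  move=> _ [T XT [B mB ->]]; have [mg _] := gP T XT.
  by have := mg measurableT B mB; rewrite setTI.
pose E0 := sub_spectral_measure E Gm.
(* Operators commuting with the restricted measure commute with every T in X and with the adjoints,
   since T is the integral of a function measurable for the smaller sigma-algebra; E A belongs to
   the double commutant of X by [hG]. *)
have commE A Q : measurable A -> bounded_operator Q -> commutes_with_spectral E0 Q ->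
    commutes (E A) Q.
  move=> mA bQ cQ.
  have c T Z : X T -> bounded_operator Z -> commutes_with_spectral E0 Z -> commutes T Z.
    move=> XT bZ cZ; have [mg gT] := gP T XT; apply: is_sint_commutes mg gT bZ _.
    move=> B mB x; apply: cZ; apply: sub_sigma_algebra; exists T => //.
    by exists B.
  have QY : commutant (X `|` adjoints X) Q.
    split=> // T [XT|[T0 XT aT]]; first exact: c.
    have [Q' bQ' QQ'] := bounded_adjoint bQ.
    have cQ' := commutes_with_spectral_adjoint QQ' cQ.
    exact: adjoint_commutes aT QQ' (c _ _ XT bQ' cQ').
  have EY : generated_vN X (E A).
    by rewrite hG; apply: commutant2; [exact: spectral_projections_bounded|left; exists A].
  move=> x _; split; first exact: spectral_dom.
  by have [_ ->] := commutantE EY QY (bounded_domE bQ x).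
have [x sx] := separating_vector E hH.
have key A : measurable A -> exists B, <<s G >> B /\ E_null E ((A `\` B) `|` (B `\` A)).
  move=> mA; have bA := spectral_bounded E mA.
  have [||||f mf fA] := @affiliated_is_sint _ _ _ _ E0 (E A) x.
  - by move=> B /(sub_measurable Gm) mB; exact: sx.
  - exact: bounded_seq_closed.
  - exact: spectral_dom.
  - by move=> Q; exact: commE.
  (* With [B] the support of f, E A vanishes on the range of the complement of B, and E B vanishes
     on the kernel of E A; both differences of A and B are thus null. *)
  have [B [mB kB cB]] := is_sint_support mf fA; exists B; split; first exact: mB.
  have {}mB := sub_measurable Gm mB; apply: E_nullU; [split=> [|y]|split=> [|y]].
  - exact: measurableD.
  - by rewrite setDE -spectralI//; exact: measurableC.
  - exact: measurableD.
  - rewrite setDE -spectralI//; last exact: measurableC.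
    apply: kB; first exact: spectral_dom.
    by rewrite spectralI ?setICr ?spectral_val0//; exact: measurableC.
have [A [N [mA N0 sepA]]] := standard_countable_base hE.
have /choice[B BP] : forall j, exists B, <<s G >> B /\ E_null E ((A j `\` B) `|` (B `\` A j)).
  by move=> j; exact: key.
have /choice[Y YP] : forall j, exists Y, [/\ countable Y, Y `<=` X &
    forall s t, (forall T, Y T -> g T s = g T t) -> B j s -> B j t].
  move=> j; apply: (sigma_algebra_countable_support _ (BP j).1).
  move=> _ [T XT [C mC ->]]; exists T => // s t st; by rewrite /preimage/= st.
pose Z := \bigcup_j Y j.
have ZX : Z `<=` X by move=> T [j _]; have [_ + _] := YP j; apply.
have cZ : countable Z by apply: bigcup_countable => [|j _]; [exact: countableP|case: (YP j)].
have sint_i (i : Z) : borel_measurable (g (set_val i)) /\ is_sint E (g (set_val i)) (set_val i).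
  by apply: gP; apply: ZX; exact: set_valP.
exists Z, (fun i s => Some (g (set_val i) s)); split=> [i||i].
- exists (g (set_val i)); first by case: (sint_i i).
  by exists set0; [exact: E_null0|].
- split=> [i||].
  + by exists set0; [exact: E_null0|move=> s _; exists (g (set_val i) s)].
  + have [e einj] := countable_injP _ cZ.
    apply/countable_injP; exists (e \o set_val) => i j _ _ /= eij.
    by apply: val_inj; apply: einj eij; apply: mem_set; exact: set_valP.
  exists (N `|` \bigcup_j ((A j `\` B j) `|` (B j `\` A j))).
    by apply: E_nullU => //; apply: E_null_bigcup => j; case: (BP j).
  split=> [i s _|s t Ns Nt st]; first by exists (g (set_val i) s).
  apply: contrapT => nst; apply: st; apply: sepA => [Ks|Kt|j As].
  + by apply: Ns; left.
  + by apply: Nt; left.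
  (* Passage from [A j] to [B j] at s, from s to t inside [B j] because all generators in [Y j]
     agree there, and back to [A j] at t; the two exchanges hold off the null set. *)
  have [_ _ hB] := YP j.
  have Bs : B j s.
    by apply: contrapT => nB; apply: Ns; right; exists j => //; left.
  apply: contrapT => nA; apply: Nt; right; exists j => //; right; split=> //.
  apply: hB Bs => T YT; have ZT : Z T by exists j.
  apply: contrapT => ngT; apply: nst; exists (exist _ T (mem_set ZT)).
  by case.
- exists (set_val i); first by apply: ZX; exact: set_valP.
  by have [mg gT] := sint_i i; apply/is_sintP.
Qed.

End Necessity.

Theorem theorem3 (R : realType) (d : measure_display) (S : measurableType d)
    (H : hilbertType R) (hH : separable H)
    (E : spectral_measure S H) (hE : standard_spectral_measure E)
    (X : set (operator H))
    (hX : forall T, X T -> closed_operator T /\ densely_defined T) :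
  generated_vN X = generated_vN (spectral_projections E) <->
  (forall T, X T -> exists f : S -> option R[i],
     E_measurable E f /\ is_spectral_integral E f T) /\
  (exists (I : Type) (f : I -> S -> option R[i]),
     [/\ forall i, E_measurable E (f i),
         E_separating E f
       & forall i, exists2 T, X T & is_spectral_integral E (f i) T]).
Proof.
split=> [hG|[hT [I [f [mf sepf fX]]]]].
  split; last exact: E_separating_generators hH hE hX hG.
  move=> T XT; have [g mg gT] := generators_sint hH hX hG XT.
  exists (fun s => Some (g s)); split; last exact/is_sintP.
  by exists g => //; exists set0; [exact: E_null0|].
(* The generated algebras agree because already the first commutants coincide. *)
rewrite /generated_vN; congr commutant; apply/seteqP; split=> Q cQ.
  apply/commutant_spectralP; split; first exact: commutant_bounded cQ.
  exact: (commutant_of_separating hE mf sepf fX cQ).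
have [bQ {}cQ] := (commutant_spectralP E Q).1 cQ.
exact: (commutant_subset_of_sint hT bQ cQ).
Qed.
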